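(* Let $0 < \mathfrak{p} < \frac{\pi}{2}$, and let $(u_n)_{n\in\mathbb{N}}$ be a sequence of maps in $H^1_{\rm loc}(\mathbb{R},\mathbb{C})$ with $E(u_n) < \frac{2\sqrt2}{3}$ for every $n$, such that $$p(u_n) \to \mathfrak{p} \quad\text{and}\quad E(u_n) \to E_{\min}(\mathfrak{p}), \quad\text{as } n \to +\infty.$$ Then there exist a subsequence $(u_{\sigma(n)})_{n\in\mathbb{N}}$, a sequence of points $(a_n)_{n\in\mathbb{N}}$ in $\mathbb{R}$, and a real number $\theta$ such that, as $n\to+\infty$, $$u_{\sigma(n)}(\cdot + a_{\sigma(n)}) \to e^{i\theta}\, \mathfrak{v}_{c(\mathfrak{p})}(\cdot) \quad \text{uniformly on every compact subset of } \mathbb{R},$$ $$1 - |u_{\sigma(n)}(\cdot + a_{\sigma(n)})|^2 \to 1 - |\mathfrak{v}_{c(\mathfrak{p})}(\cdot)|^2 \quad \text{in } L^2(\mathbb{R}),$$ and $$u_{\sigma(n)}'(\cdot + a_{\sigma(n)}) \to e^{i\theta}\, \mathfrak{v}_{c(\mathfrak{p})}'(\cdot) \quad \text{in } L^2(\mathbb{R}).$$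
   Context: For $v \in H^1_{\rm loc}(\mathbb{R},\mathbb{C})$, the Ginzburg-Landau energy is $E(v) = \int_{\mathbb{R}} e(v) \in [0,+\infty]$ with $e(v) = \frac12 |v'|^2 + \frac14 (1-|v|^2)^2$. Any $v \in H^1_{\rm loc}(\mathbb{R},\mathbb{C})$ with $E(v) < \frac{2\sqrt2}{3}$ satisfies $\inf_{\mathbb{R}} |v| > 0$, so it can be written $v = \varrho \exp(i\varphi)$ with $\varrho = |v|$ and $\varphi$ a continuous real-valued phase, $\varphi \in H^1_{\rm loc}(\mathbb{R})$. For such $v$ the renormalized momentum is $p(v) = \frac12 \int_{\mathbb{R}} (1-\varrho^2)\varphi'$ (a convergent integral). $E_{\min}(\mathfrak{p}) = \inf\{ E(v) : v \in H^1_{\rm loc}(\mathbb{R},\mathbb{C}),\ E(v) < \frac{2\sqrt2}{3},\ p(v) = \mathfrak{p}\}$. For $0 \leq c < \sqrt2$, $\mathfrak{v}_c(x) = \sqrt{\frac{2-c^2}{2}} \tanh\Big( \frac{\sqrt{2-c^2}}{2} x \Big) - i \frac{c}{\sqrt2}$. For $0 < \mathfrak{p} < \frac{\pi}{2}$, $c(\mathfrak{p})$ denotes the unique $c \in (0,\sqrt2)$ such that $\mathfrak{p} = \frac{\pi}{2} - \arctan\Big(\frac{c}{\sqrt{2-c^2}}\Big) - \frac{c}{2}\sqrt{2-c^2}$. *)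

(* Defs.v *)
From HB Require Import structures.
From mathcomp Require Import all_boot all_order all_algebra.
From mathcomp Require Import complex.
From mathcomp Require Import all_classical all_reals all_analysis.

Set Implicit Arguments.
Unset Strict Implicit.
Unset Printing Implicit Defensive.
Import Order.TTheory GRing.Theory Num.Theory.
Import numFieldNormedType.Exports.

Local Open Scope classical_set_scope.
Local Open Scope complex_scope.
Local Open Scope ring_scope.

Section Sobolev.
Context {R : realType}.
Local Notation mu := (@lebesgue_measure R).
Implicit Types f g phi : R -> R.

Definition L2loc f :=
  measurable_fun setT f /\ locally_integrable setT (fun x => f x ^+ 2).

(* C^1_c instead of C^oo_c: by density both classes of test functions define
   the same weak derivative in L^2_loc (cf. Brezis, Functional Analysis,
   Sobolev Spaces and PDE, Section 8.2). *)
Definition test_function phi :=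
  [/\ forall x, derivable phi x 1, continuous (derive1 phi)
    & compact (closure [set x | phi x != 0])].

Definition weak_derivative f g :=
  forall phi, test_function phi ->
    \int[mu]_x (f x * derive1 phi x) = - \int[mu]_x (g x * phi x).

(* An element of H^1_loc(R) is represented by its continuous representative,
   which is the one used for pointwise values, phases and uniform limits. *)
Definition H1loc f :=
  [/\ continuous f, L2loc f & exists2 g, L2loc g & weak_derivative f g].

(* The weak derivative is unique up to a null set; wderiv f is a choice of a
   representative, meaningful when H1loc f holds. *)
Definition wderiv f : R -> R :=
  xget (cst 0) [set g | L2loc g /\ weak_derivative f g].

Definition H1locC (v : R -> R[i]) :=
  H1loc (fun x => complex.Re (v x)) /\ H1loc (fun x => complex.Im (v x)).

Definition wderivC (v : R -> R[i]) (x : R) : R[i] :=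
  wderiv (fun y => complex.Re (v y)) x +i* wderiv (fun y => complex.Im (v y)) x.

End Sobolev.

Section Complex.
Context {R : realType}.

(* `|z| would have type R[i] instead of R. *)
Definition cmod (z : R[i]) : R := ComplexField.Normc.normc z.

Definition expi (t : R) : R[i] := cos t +i* sin t.

Definition tanh (x : R) : R := (expR x - expR (- x)) / (expR x + expR (- x)).

End Complex.

Section GinzburgLandau.
Context {R : realType}.
Local Notation mu := (@lebesgue_measure R).
Implicit Types v : R -> R[i].

Definition energy_density v (x : R) : R :=
  2^-1 * cmod (wderivC v x) ^+ 2 + 4^-1 * (1 - cmod (v x) ^+ 2) ^+ 2.

Definition energy v : \bar R := (\int[mu]_x (energy_density v x)%:E)%E.

Definition energy_threshold : R := 2 * Num.sqrt 2 / 3.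

Definition is_phase v (phi : R -> R) :=
  H1loc phi /\ forall x, v x = (cmod (v x))%:C * expi (phi x).

(* When v does not vanish, the phase is unique up to a constant in 2 pi Z, so
   that the momentum does not depend on the choice made here. *)
Definition phase v : R -> R := xget (cst 0) [set phi | is_phase v phi].

Definition momentum v : R :=
  2^-1 * \int[mu]_x ((1 - cmod (v x) ^+ 2) * wderiv (phase v) x).

Definition admissible v := H1locC v /\ (energy v < energy_threshold%:E)%E.

Definition Emin (p : R) : \bar R :=
  ereal_inf [set energy v | v in [set v | admissible v /\ momentum v = p]].

Definition soliton (c x : R) : R[i] :=
  (Num.sqrt ((2 - c ^+ 2) / 2) * tanh (Num.sqrt (2 - c ^+ 2) / 2 * x))
    -i* (c / Num.sqrt 2).

(* The unique such c when 0 < p < pi / 2. *)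
Definition speed (p : R) : R :=
  xget 0 [set c | 0 < c < Num.sqrt 2 /\
    p = pi / 2 - atan (c / Num.sqrt (2 - c ^+ 2))
        - c / 2 * Num.sqrt (2 - c ^+ 2)].

End GinzburgLandau.

Section Convergence.
Context {R : realType}.
Local Notation mu := (@lebesgue_measure R).

Definition cvg_locally_uniformly (f : nat -> R -> R[i]) (g : R -> R[i]) :=
  forall K : set R, compact K -> forall e : R, 0 < e ->
    \forall n \near \oo, forall x, K x -> cmod (f n x - g x) < e.

(* Membership in L^2 is part of the convergence because Lnorm is defined for
   every function, even a nonmeasurable one. *)
Definition L2 (f : R -> R) := f \in Lfun mu 2%:E.

Definition L2C (f : R -> R[i]) :=
  L2 (fun x => complex.Re (f x)) /\ L2 (fun x => complex.Im (f x)).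

Definition cvg_L2 (f : nat -> R -> R) (g : R -> R) :=
  [/\ forall n, L2 (f n), L2 g
    & Lnorm mu 2%:E (fun x => (f n x - g x)%:E) @[n --> \oo] --> 0%E].

Definition cvg_L2C (f : nat -> R -> R[i]) (g : R -> R[i]) :=
  [/\ forall n, L2C (f n), L2C g
    & Lnorm mu 2%:E (fun x => (cmod (f n x - g x))%:E) @[n --> \oo] --> 0%E].

End Convergence.

(* Main.v *)
Require Import Defs.
From HB Require Import structures.
From mathcomp Require Import all_boot all_order all_algebra.
From mathcomp Require Import complex ring lra.
From mathcomp Require Import all_classical all_reals all_analysis measurable_realfun.

Set Implicit Arguments.
Unset Strict Implicit.
Unset Printing Implicit Defensive.
Import Order.TTheory GRing.Theory Num.Theory.
Import numFieldNormedType.Exports.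

Local Open Scope classical_set_scope.
Local Open Scope complex_scope.
Local Open Scope ring_scope.

(* Write v = rho exp(i phi) and eta = 1 - rho^2, translate a maximum point of
   eta to 0 and let kap^2 = 1 - b^2 be the maximum.  Completing squares on each
   side of 0 (a calibration) gives
     E(v) = sqrt 2 b p(v) + 2 calib_value b kap + excess,
   where the nonnegative excess controls the L^2 norms of
   phi' - b eta / (sqrt 2 (1 - eta)) and of
   eta' + eta (2 (kap^2 - eta))^(1/2) on x >= 0 (eta' - ... on x <= 0); all of
   these vanish on the soliton of speed sqrt 2 b.  As a function of b, the
   quantity sqrt 2 b p + 2 calib_value b kap has a strict minimum at the b for
   which the soliton has momentum p, and its value there is the energy of that
   soliton.  Hence b converges and the excess tends to 0 along a minimizing
   sequence.  Comparison for the perturbed first-order equation yields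
   eta >= eta_* - o(1) locally; since the momenta converge, the strict convexity
   of s^2 / (1 - s) turns this into convergence of eta in L^2(R), which gives
   the local uniform convergence of the phases, and convergence of the energies
   gives that of v' in L^2(R).  The phases at the maximum point lie in a compact
   set modulo 2 pi, whence the subsequence. *)

(** * Locally integrable functions and their primitives *)

(** The bound [2 sqrt 2 / 3] enters only through [barrier]: a map that vanishes somewhere climbs the
    barrier on one side of its zero and descends on the other, each at a cost close to [sqrt 2 / 3].
    The estimates are one-sided. [Emin] is bounded above by inserting the soliton, and energies are
    bounded below because the excess is nonnegative. Comparison bounds [eta] from below only, on
    bounded sets; a surplus of [eta], local or at infinity, is excluded by the momentum. Indeed,
    when [slip] is small, [eta * psi] is close to [b / sqrt 2 * eta^2 / (1 - eta)], so the integral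
    of this convex function of [eta] cannot much exceed its soliton value. No phase has to be
    constructed for a given map: a nonzero momentum already implies that one exists
    ([momentum_is_phase]). Up to [stability] there are no sequences: each smallness is a condition
    on [d] near [0^'+], fixed before the map is quantified. A weak derivative is a representative
    chosen up to a null set, so calculus is done on pairs [primitive f g] and integrals over
    segments. *)

Section LocallyIntegrable.
Context {R : realType}.
Local Notation mu := (@lebesgue_measure R).
Implicit Types f g h : R -> R.

Definition locL1 g :=
  measurable_fun setT g /\ forall a b, mu.-integrable `[a, b] (EFin \o g).

Lemma continuous_meas f : continuous f -> measurable_fun setT f.
Proof. exact: continuous_measurable_fun. Qed.

Lemma locL1_continuous f : continuous f -> locL1 f.
Proof.
move=> cf; split=> [|a b]; first exact: continuous_meas.
apply: continuous_compact_integrable; first exact: segment_compact.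
exact: continuous_subspaceT.
Qed.

Lemma locL1_le f g : measurable_fun setT f -> (forall x, `|f x| <= g x) ->
  locL1 g -> locL1 f.
Proof.
move=> mf fg [mg ig]; split=> // a b.
apply: (le_integrable _ _ _ (ig a b)) => //=.
- by apply/measurable_EFinP; exact: measurable_funS mf.
- by move=> x _; rewrite lee_fin (le_trans (fg x))// ler_norm.
Qed.

Lemma locL1D f g : locL1 f -> locL1 g -> locL1 (fun x => f x + g x).
Proof.
move=> [mf f1] [mg g1]; split=> [|a b]; first exact: measurable_funD.
by apply: integrableD (f1 a b) (g1 a b).
Qed.

Lemma locL1N f : locL1 f -> locL1 (fun x => - f x).
Proof.
move=> [mf f1]; split=> [|a b]; first exact: measurableT_comp.
by apply: integrableN (f1 a b).
Qed.

Lemma locL1B f g : locL1 f -> locL1 g -> locL1 (fun x => f x - g x).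
Proof. by move=> f1 g1; apply: locL1D => //; exact: locL1N. Qed.

Lemma locL1M f g : continuous f -> locL1 g -> locL1 (fun x => f x * g x).
Proof.
move=> cf [mg ig]; split=> [|a b].
  by apply: measurable_funM => //; exact: continuous_meas.
apply: integrableMr (ig a b) => //.
  by apply: measurable_funS (continuous_meas cf).
have [ab|ba] := leP a b; last first.
  exists 0; split=> // M _ x /=; rewrite in_itv/= => /andP[ax xb].
  by have := lt_le_trans ba (le_trans ax xb); rewrite ltxx.
have cnf : {within `[a, b], continuous (fun x => `|f x|)}.
  by apply: continuous_subspaceT => x; apply: cvg_norm; exact: cf.
have [c _ fc] := EVT_max ab cnf.
exists `|f c|; split; first exact: num_real.
by move=> M cM x xab /=; rewrite (le_trans (fc x xab))// ltW.
Qed.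

Lemma locL1Z (k : R) g : locL1 g -> locL1 (fun x => k * g x).
Proof. by apply: locL1M => x; exact: cvg_cst. Qed.

Lemma locL1_norm g : locL1 g -> locL1 (fun x => `|g x|).
Proof.
move=> [mg ig]; split=> [|a b]; first exact: measurableT_comp.
exact: integrable_norm (ig a b).
Qed.

Lemma locL1_cst (k : R) : locL1 (fun=> k).
Proof. by apply: locL1_continuous => x; exact: cvg_cst. Qed.

Lemma locL1_integrable g : mu.-integrable setT (EFin \o g) -> locL1 g.
Proof.
move=> ig; split=> [|a b].
  by apply/measurable_EFinP; exact: measurable_int ig.
exact: integrableS ig.
Qed.

Definition sqrL1 g := measurable_fun setT g /\ locL1 (fun x => g x ^+ 2).

Lemma sqrL1_locL1 g : sqrL1 g -> locL1 g.
Proof.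
move=> [mg g2]; apply: (@locL1_le _ (fun x => 1 + g x ^+ 2)) => //.
  move=> x; rewrite -(real_normK (num_real (g x))).
  by have := sqr_ge0 (`|g x| - 1); nra.
by apply: locL1D => //; exact: locL1_cst.
Qed.

Lemma sqrL1D f g : sqrL1 f -> sqrL1 g -> sqrL1 (fun x => f x + g x).
Proof.
move=> f2 g2; have m := measurable_funD f2.1 g2.1; split=> //.
apply: (@locL1_le _ (fun x => 2 * (f x ^+ 2 + g x ^+ 2))).
- exact: measurable_funX.
- by move=> x; rewrite ger0_norm ?sqr_ge0//; have := sqr_ge0 (f x - g x); nra.
- by apply: locL1Z; apply: locL1D; [case: f2|case: g2].
Qed.

Lemma sqrL1_continuous f : continuous f -> sqrL1 f.
Proof.
move=> cf; split; first exact: continuous_meas.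
by apply: locL1_continuous => x; exact: (cvgM (cf x) (cf x)).
Qed.

Lemma sqrL1Ml f g : continuous f -> sqrL1 g -> sqrL1 (fun x => f x * g x).
Proof.
move=> cf [mg g2]; split.
  by apply: measurable_funM => //; exact: continuous_meas.
have := @locL1M (fun x => f x ^+ 2) (fun x => g x ^+ 2).
move=> /(_ (fun x => cvgM (cf x) (cf x)) g2).
by under [X in locL1 X]eq_fun do rewrite -exprMn.
Qed.

Lemma L2loc_sqrL1 g : L2loc g <-> sqrL1 g.
Proof.
split=> [[mg [mg2 _ ig2]]|[mg g2]]; split=> //.
  split=> // a b; apply/integrableP; split.
    by apply/measurable_EFinP; exact: measurable_funS mg2.
  by apply: ig2 => //; exact: segment_compact.
split; [by case: g2|exact: openT|move=> K _ cK].
have [M [_ KM]] := compact_bounded cK.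
have KI : K `<=` `[- (`|M| + 1), `|M| + 1].
  move=> x Kx; rewrite /= in_itv/= -ler_norml; apply: KM => //.
  by rewrite (le_lt_trans (ler_norm M))// ltrDl.
have /integrableP[_] := g2.2 (- (`|M| + 1)) (`|M| + 1).
apply: le_lt_trans; apply: ge0_subset_integral => //=.
- exact: compact_measurable.
- apply/measurable_EFinP; apply: measurableT_comp => //.
  by case: g2 => m2 _; exact: measurable_funS m2.
Qed.

End LocallyIntegrable.

Section Primitives.
Context {R : realType}.
Local Notation mu := (@lebesgue_measure R).
Implicit Types f g h : R -> R.

Lemma itv_intD f g a b : locL1 f -> locL1 g ->
  \int[mu]_(x in `[a, b]) (f x + g x) =
  \int[mu]_(x in `[a, b]) f x + \int[mu]_(x in `[a, b]) g x.
Proof. by move=> [_ f1] [_ g1]; apply: RintegralD. Qed.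

Lemma itv_intB f g a b : locL1 f -> locL1 g ->
  \int[mu]_(x in `[a, b]) (f x - g x) =
  \int[mu]_(x in `[a, b]) f x - \int[mu]_(x in `[a, b]) g x.
Proof. by move=> [_ f1] [_ g1]; apply: RintegralB. Qed.

Lemma itv_intZ (k : R) g a b : locL1 g ->
  \int[mu]_(x in `[a, b]) (k * g x) = k * \int[mu]_(x in `[a, b]) g x.
Proof. by move=> [_ g1]; apply: RintegralZl. Qed.

Lemma itv_int_le f g a b : locL1 f -> locL1 g ->
  (forall x, a <= x <= b -> f x <= g x) ->
  \int[mu]_(x in `[a, b]) f x <= \int[mu]_(x in `[a, b]) g x.
Proof.
by move=> [_ f1] [_ g1] fg; apply: le_Rintegral => // x /=; rewrite in_itv; exact: fg.
Qed.

Lemma itv_int_eq f g a b : (forall x, a <= x <= b -> f x = g x) ->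
  \int[mu]_(x in `[a, b]) f x = \int[mu]_(x in `[a, b]) g x.
Proof.
by move=> fg; apply: eq_Rintegral => x; rewrite inE/= in_itv; exact: fg.
Qed.

Lemma itv_int_ge0 f a b : (forall x, a <= x <= b -> 0 <= f x) ->
  0 <= \int[mu]_(x in `[a, b]) f x.
Proof.
by move=> f0; apply: Rintegral_ge0 => x /=; rewrite in_itv; exact: f0.
Qed.

Lemma itv_int_norm f a b : locL1 f ->
  `|\int[mu]_(x in `[a, b]) f x| <= \int[mu]_(x in `[a, b]) `|f x|.
Proof. by move=> [_ f1]; apply: le_normr_Rintegral. Qed.

Lemma itv_int_split f a b c : locL1 f -> a <= b -> b <= c ->
  \int[mu]_(x in `[a, c]) f x =
  \int[mu]_(x in `[a, b]) f x + \int[mu]_(x in `[b, c]) f x.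
Proof.
move=> [_ f1] ab bc.
have := @Rintegral_itvB _ f (BLeft a) (BRight c) b (f1 a c).
rewrite !bnd_simp => /(_ ab bc)/eqP; rewrite subr_eq => /eqP ->.
rewrite addrC Rintegral_itv_obnd_cbnd//.
by apply: integrableS (f1 b c) => //; exact: subset_itv_oc_cc.
Qed.

Lemma itv_int_cst (k a b : R) : a <= b ->
  \int[mu]_(x in `[a, b]) k = k * (b - a).
Proof.
move=> ab; rewrite Rintegral_cst//= lebesgue_measure_itv/= lte_fin.
by case: ltgtP ab => //= -> _; rewrite subrr.
Qed.

Lemma itv_int_sub f a b c d : locL1 f -> (forall x, 0 <= f x) ->
  c <= a -> a <= b -> b <= d ->
  \int[mu]_(x in `[a, b]) f x <= \int[mu]_(x in `[c, d]) f x.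
Proof.
move=> f1 f0 ca ab bd.
rewrite (@itv_int_split _ c a d)// ?(le_trans ab)//.
rewrite (@itv_int_split _ a b d)//.
have H x y : 0 <= \int[mu]_(z in `[x, y]) f z by apply: itv_int_ge0.
by have := H c a; have := H b d; lra.
Qed.

(** Real induction: near the supremum of the [t] with [P a t], the local hypothesis extends [P] past
    that supremum unless [b] is reached. It reduces an additive estimate on [[a, b]] to short
    intervals around each point. *)
Lemma interval_induction (P : R -> R -> Prop) (a b : R) : a <= b ->
  (forall x y z, x <= y -> y <= z -> P x y -> P y z -> P x z) ->
  (forall x, a <= x <= b -> exists2 d, 0 < d &
     forall s t, a <= s -> s <= x -> x <= t -> t <= b -> t - s < d -> P s t) ->
  P a b.
Proof.
move=> ab Pcat Ploc.
pose S := [set t | a <= t <= b /\ P a t].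
have Sa : S a.
  split; first by rewrite lexx.
  have [|d d0 Pd] := Ploc a; first by rewrite lexx.
  by apply: Pd; rewrite ?lexx// subrr.
have Sub : ubound S b by move=> t [/andP[]].
have hS : has_sup S by split; [exists a|exists b].
pose s := sup S.
have as_ : a <= s by apply: ub_le_sup => //; exists b.
have sb : s <= b by apply: ge_sup => //; exists a.
have [|d d0 Pd] := Ploc s; first by rewrite as_.
have d20 : 0 < d / 2 by rewrite divr_gt0.
have [t [/andP[at_ tb] Pat] st] := sup_adherent d20 hS.
have ts : t <= s by apply: ub_le_sup; [exists b|split; rewrite ?at_].
have [sd|bs] := leP (s + d / 4) b; last first.
  by apply: (Pcat _ t) => //; apply: Pd => //; rewrite -/s in st; lra.
have Pas : P a (s + d / 4).
  apply: (Pcat _ t) => //; first lra.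
  by apply: Pd => //; rewrite -/s in st; lra.
have : s + d / 4 <= s.
  apply: ub_le_sup; first by exists b.
  by split=> //; rewrite sd andbT; lra.
by lra.
Qed.

(* That is, [f] is locally absolutely continuous with derivative [g] a.e. *)
Definition primitive f g := [/\ continuous f, locL1 g &
  forall a b, a <= b -> f b - f a = \int[mu]_(x in `[a, b]) g x].

Lemma primitive_continuous f g : primitive f g -> continuous f.
Proof. by case. Qed.

Lemma primitive_locL1 f g : primitive f g -> locL1 g.
Proof. by case. Qed.

Lemma primitiveE f g a b : primitive f g -> a <= b ->
  \int[mu]_(x in `[a, b]) g x = f b - f a.
Proof. by case=> _ _ H ab; rewrite H. Qed.

Lemma primitiveD f1 g1 f2 g2 : primitive f1 g1 -> primitive f2 g2 ->
  primitive (fun x => f1 x + f2 x) (fun x => g1 x + g2 x).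
Proof.
move=> [c1 l1 e1] [c2 l2 e2]; split; last first.
- by move=> a b ab; rewrite itv_intD// -e1// -e2//; ring.
- exact: locL1D.
- by move=> x; apply: cvgD; [exact: c1|exact: c2].
Qed.

Lemma primitiveZ (k : R) f g : primitive f g ->
  primitive (fun x => k * f x) (fun x => k * g x).
Proof.
move=> [c l e]; split; last first.
- by move=> a b ab; rewrite itv_intZ// -e//; ring.
- exact: locL1Z.
- by move=> x; apply: cvgM; [exact: cvg_cst|exact: c].
Qed.

Lemma primitive_cst (k : R) : primitive (fun=> k) (fun=> 0).
Proof.
split; last by move=> a b ab; rewrite itv_int_cst// subrr mul0r.
- by move=> x; exact: cvg_cst.
- exact: locL1_cst.
Qed.

Lemma eq_primitive f f' g g' : f =1 f' -> g =1 g' ->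
  primitive f g -> primitive f' g'.
Proof. by move=> /funext -> /funext ->. Qed.

Lemma primitiveN f g : primitive f g ->
  primitive (fun x => - f x) (fun x => - g x).
Proof.
by move=> /(primitiveZ (-1)); apply: eq_primitive => x; rewrite mulN1r.
Qed.

Lemma primitiveB f1 g1 f2 g2 : primitive f1 g1 -> primitive f2 g2 ->
  primitive (fun x => f1 x - f2 x) (fun x => g1 x - g2 x).
Proof. by move=> p1 /primitiveN; exact: primitiveD. Qed.

(** The chain rule is proved without differentiating [f] at points. The defect [D] is additive over
    intervals and, on short ones, at most [e] times the integral of [|g|]; [interval_induction]
    propagates this bound, and [e] is arbitrary. *)
Lemma primitive_comp (h h' f g : R -> R) : primitive f g ->
  (forall x, is_derive (f x) (1 : R) h (h' (f x))) ->
  continuous (fun x => h' (f x)) ->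
  primitive (fun x => h (f x)) (fun x => h' (f x) * g x).
Proof.
move=> [cf lg fE] dh ch'.
have lk : locL1 (fun x => h' (f x) * g x) by apply: locL1M.
have chf : continuous (fun x => h (f x)).
  move=> x; apply: (@continuous_comp _ _ _ f h); first exact: cf.
  by apply/differentiable_continuous/derivable1_diffP; case: (dh x).
split=> // a b ab.
pose D x y := h (f y) - h (f x) - \int[mu]_(z in `[x, y]) (h' (f z) * g z).
pose M x y := \int[mu]_(z in `[x, y]) `|g z|.
have Mge0 x y : 0 <= M x y by apply: itv_int_ge0.
suff H e : 0 < e -> `|D a b| <= e * M a b.
  apply/eqP; rewrite -subr_eq0 -normr_le0 -/(D a b); apply/ler_addgt0Pr => e e0.
  have M1 : 0 < M a b + 1 by rewrite ltr_wpDl.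
  rewrite add0r (le_trans (H (e / (M a b + 1)) _))// ?divr_gt0//.
  by rewrite -mulrA ger_pMr// mulrC ler_pdivrMr// mul1r ler_wpDr.
move=> e0; apply: (interval_induction (P := fun x y => `|D x y| <= e * M x y) ab).
  move=> x y z xy yz Hxy Hyz; rewrite /M (@itv_int_split _ x y z)//; last exact: locL1_norm.
  rewrite mulrDr (le_trans _ (lerD Hxy Hyz))// (le_trans _ (ler_normD _ _))//.
  rewrite /D (@itv_int_split _ x y z)// le_eqVlt; apply/orP; left; apply/eqP.
  by congr `|_|; ring.
move=> x _.
have e20 : 0 < e / 2 by rewrite divr_gt0.
have /cvgrPdist_lt/(_ _ e20) := ch' x.
rewrite nearE => /nbhs_ballP[d /= d0 Hd].
exists d => // s t _ sx xt _ tsd.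
have st : s <= t by exact: le_trans xt.
have close z : s <= z <= t -> `|h' (f x) - h' (f z)| < e / 2.
  move=> /andP[sz zt]; apply: Hd; rewrite /ball/= ltr_norml; apply/andP; split; lra.
(* Mean value theorem for [h] between [f s] and [f t]; the intermediate value theorem pulls the
   point back to some [z] in [[s, t]], so [h] need only be differentiable at values of [f]. *)
have [z zst hE] : exists2 z, s <= z <= t &
    h (f t) - h (f s) = h' (f z) * (f t - f s).
  have imf y : Num.min (f s) (f t) <= y <= Num.max (f s) (f t) ->
      exists2 z, s <= z <= t & f z = y.
    move=> yst; have [|c cst cy] := @IVT R f s t y st _ yst.
      exact: continuous_subspaceT.
    by exists c => //; rewrite in_itv in cst.
  have dhy y : Num.min (f s) (f t) <= y <= Num.max (f s) (f t) ->
      is_derive y (1 : R) h (h' y).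
    by move=> /imf[z _ <-]; exact: dh.
  have cth (p q : R) : (forall y : R, p <= y <= q -> is_derive y (1 : R) h (h' y)) ->
      {within `[p, q], continuous h}.
    move=> Hd'; apply: derivable_within_continuous => y; rewrite in_itv/= => yy.
    by case: (Hd' y yy).
  case: (leP (f s) (f t)) => fst.
    have dh2 y : f s <= y <= f t -> is_derive y (1 : R) h (h' y).
      by move=> yy; apply: dhy; rewrite min_l// max_r.
    have [|y yst ->] := @MVT_segment R h h' (f s) (f t) fst _ (cth _ _ dh2).
      by move=> y; rewrite in_itv/= => /andP[y1 y2]; apply: dh2; rewrite !ltW.
    have [|z zst zy] := imf y; first by rewrite min_l// max_r// -in_itv.
    by exists z => //; rewrite zy.
  have dh2 y : f t <= y <= f s -> is_derive y (1 : R) h (h' y).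
    by move=> yy; apply: dhy; rewrite min_r ?max_l// ltW.
  have [|y yst E] := @MVT_segment R h h' (f t) (f s) (ltW fst) _ (cth _ _ dh2).
    by move=> y; rewrite in_itv/= => /andP[y1 y2]; apply: dh2; rewrite !ltW.
  have [|z zst zy] := imf y; first by rewrite min_r ?max_l -?in_itv// ltW.
  by exists z => //; rewrite zy -opprB E; ring.
have lcst (k : R) : locL1 (fun y => k * g y) by apply: locL1Z.
rewrite /D hE fE// -itv_intZ// -itv_intB//.
apply: (le_trans (itv_int_norm _ _ _)); first exact: locL1B.
rewrite /M -itv_intZ; last exact: locL1_norm.
apply: itv_int_le.
- by apply: locL1_norm; exact: locL1B.
- by apply: locL1Z; exact: locL1_norm.
move=> y yst; rewrite -mulrBl normrM ler_wpM2r// ltW//.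
have := close z zst; have := close y yst; rewrite !ltr_norml; lra.
Qed.

Lemma primitive_sqr f g : primitive f g ->
  primitive (fun x => f x ^+ 2) (fun x => 2 * f x * g x).
Proof.
move=> p; have cf := primitive_continuous p.
apply: (@primitive_comp (fun y => y ^+ 2) (fun y => 2 * y)) => // [x|x].
  by apply: is_derive_eq; rewrite /= /GRing.scale/=; ring.
by apply: cvgM; [exact: cvg_cst|exact: cf].
Qed.

(** Polarization: the product is a difference of squares, which the chain rule handles. *)
Lemma primitiveM f1 g1 f2 g2 : primitive f1 g1 -> primitive f2 g2 ->
  primitive (fun x => f1 x * f2 x) (fun x => g1 x * f2 x + f1 x * g2 x).
Proof.
move=> p1 p2.
have := primitiveZ 4^-1 (primitiveB (primitive_sqr (primitiveD p1 p2))
                                     (primitive_sqr (primitiveB p1 p2))).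
by apply: eq_primitive => x; field.
Qed.

Lemma primitive_C1 f g : (forall x, is_derive x (1 : R) f (g x)) ->
  continuous g -> primitive f g.
Proof.
move=> df cg.
have pid : primitive (fun x => x) (fun=> 1).
  split; first by move=> x; exact: cvg_id.
    exact: locL1_cst.
  by move=> a b ab; rewrite itv_int_cst// mul1r.
by have := primitive_comp pid df cg; apply: eq_primitive => x; rewrite ?mulr1.
Qed.

End Primitives.

(** * Translations, reflection, and the passage from segments to the line *)

Section WholeLine.
Context {R : realType}.
Local Notation mu := (@lebesgue_measure R).
Implicit Types f g h : R -> R.

Lemma measurable_shift (a : R) : measurable_fun setT (fun x : R => x + a).
Proof.
by apply: continuous_meas => x; apply: cvgD; [exact: cvg_id|exact: cvg_cst].
Qed.

Lemma lebesgue_measure_shift (a : R) (A : set R) : measurable A ->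
  pushforward mu ((fun x => x + a) : R -> measurableTypeR R) A = mu A.
Proof.
have ms : measurable_fun [set: R] ((fun x => x + a) : R -> measurableTypeR R).
  exact: measurable_shift.
move=> mA; apply/esym/(lebesgue_measure_unique
  (mu := measure_function_pushforward__canonical__measure_function_Measure mu ms))
  => //= _ [[x y]] _ <-.
rewrite /pushforward /=.
have -> : (fun z : R => z + a) @^-1` `]x, y]%classic = `]x - a, y - a]%classic.
  by apply/seteqP; split=> z /=; rewrite !in_itv/= ltrBlDr lerBrDr.
rewrite !lebesgue_measure_itv/= !lte_fin ltrD2r.
by case: ifP => // _; rewrite -!EFinB; congr EFin; ring.
Qed.

Section MeasurePreserving.
Variable s : R -> measurableTypeR R.
Hypothesis ms : measurable_fun [set: R] s.
Hypothesis mp : forall A, measurable A -> pushforward mu s A = mu A.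

Lemma ge0_integral_mp (f : R -> \bar R) : measurable_fun setT f ->
  (forall x, 0%E <= f x)%E ->
  (\int[mu]_x f (s x) = \int[mu]_x f x)%E.
Proof.
move=> mf f0.
rewrite -[LHS]/(\int[mu]_(x in s @^-1` setT) (f \o s) x)%E.
rewrite -ge0_integral_pushforward//=.
by apply: eq_measure_integral => A mA _; exact: mp.
Qed.

Lemma integral_mp (f : R -> \bar R) : measurable_fun setT f ->
  (\int[mu]_x f (s x) = \int[mu]_x f x)%E.
Proof.
move=> mf; rewrite integralE [RHS]integralE; congr (_ - _)%E.
  rewrite -[RHS](ge0_integral_mp (measurable_funepos mf) (funepos_ge0 f)).
  by apply: eq_integral => x _; rewrite !funeposE.
rewrite -[RHS](ge0_integral_mp (measurable_funeneg mf) (funeneg_ge0 f)).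
by apply: eq_integral => x _; rewrite !funenegE.
Qed.

Lemma integrable_mp (f : R -> \bar R) :
  mu.-integrable setT f -> mu.-integrable setT (fun x => f (s x)).
Proof.
move=> /integrableP[mf fi]; apply/integrableP; split.
  exact: measurableT_comp.
rewrite (ge0_integral_mp (f := fun x => `|f x|%E))//.
exact: measurableT_comp.
Qed.

Variables x y x' y' : R.
Hypothesis sE : forall t, (x <= t <= y) = (x' <= s t <= y').

Lemma itv_int_mp (g : R -> R) : locL1 g ->
  \int[mu]_(t in `[x, y]) g (s t) = \int[mu]_(t in `[x', y']) g t.
Proof.
move=> [mg _]; rewrite Rintegral_mkcond [RHS]Rintegral_mkcond /Rintegral.
rewrite -[in RHS]integral_mp; last first.
  apply/measurable_EFinP; apply/(measurable_restrictT _ _).1 => //.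
  exact: measurable_funS mg.
congr fine; apply: eq_integral => t _; rewrite !patchE.
congr (EFin (if _ then _ else _)).
by apply/idP/idP; rewrite !inE /= !in_itv/= sE.
Qed.

Lemma itv_integrable_mp (g : R -> R) : locL1 g ->
  mu.-integrable `[x, y] (fun t => (g (s t))%:E).
Proof.
move=> [mg ig].
have mI (u v : R) : measurable (`[u, v] : set (measurableTypeR R)).
  exact: measurable_itv.
have := ig x' y'; move=> /(integrable_mkcond _ (mI _ _))/integrable_mp H.
apply/(integrable_mkcond _ (mI _ _)); move: H.
apply: eq_integrable => // t _; rewrite !patchE.
congr (if _ then _ else _).
by apply/idP/idP; rewrite !inE /= !in_itv/= sE.
Qed.

End MeasurePreserving.

Lemma integral_shift (a : R) (f : R -> \bar R) : measurable_fun setT f ->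
  (\int[mu]_x f (x + a)%R = \int[mu]_x f x)%E.
Proof.
apply: (@integral_mp (fun x => x + a)); first exact: measurable_shift.
exact: lebesgue_measure_shift.
Qed.

Lemma locL1_shift (a : R) g : locL1 g -> locL1 (fun x => g (x + a)).
Proof.
move=> lg; split=> [|x y].
  by apply: measurableT_comp (measurable_shift a); case: lg.
apply: (@itv_integrable_mp (fun x => x + a) _ _ _ _ (x + a) (y + a)) => //.
- exact: measurable_shift.
- exact: lebesgue_measure_shift.
- by move=> t; rewrite !lerD2r.
Qed.

Lemma sqrL1_shift (a : R) g : sqrL1 g -> sqrL1 (fun x => g (x + a)).
Proof.
move=> [mg g2]; split; last exact: (locL1_shift a g2).
by apply: measurableT_comp => //; exact: measurable_shift.
Qed.

Lemma primitive_shift (a : R) f g : primitive f g ->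
  primitive (fun x => f (x + a)) (fun x => g (x + a)).
Proof.
move=> [cf lg fE]; split; last first.
- move=> x y xy.
  rewrite (@itv_int_mp (fun x => x + a) _ _ _ _ (x + a) (y + a))//.
  + by rewrite -fE// lerD2r.
  + exact: measurable_shift.
  + exact: lebesgue_measure_shift.
  + by move=> t; rewrite !lerD2r.
- exact: locL1_shift.
- move=> x; apply: (@continuous_comp _ _ _ (fun x => x + a) f) => //.
    by apply: cvgD; [exact: cvg_id|exact: cvg_cst].
  exact: cf.
Qed.

Let measurable_opp : measurable_fun setT (fun x : R => - x).
Proof. by apply: continuous_meas => x; apply: cvgN; exact: cvg_id. Qed.

Let opp_itv (x y t : R) : (x <= t <= y) = (- y <= - t <= - x).
Proof. by rewrite !lerN2 andbC. Qed.

Lemma itv_int_opp (x y : R) (g : R -> R) : locL1 g ->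
  \int[mu]_(t in `[x, y]) g (- t) = \int[mu]_(t in `[- y, - x]) g t.
Proof.
apply: (@itv_int_mp (fun x => - x)) => //.
- exact: lebesgue_measureN.
Qed.

Lemma locL1_opp g : locL1 g -> locL1 (fun x => g (- x)).
Proof.
move=> lg; split=> [|x y].
  by apply: measurableT_comp measurable_opp; case: lg.
apply: (@itv_integrable_mp (fun x => - x) _ _ _ _ (- y) (- x)) => //.
- exact: lebesgue_measureN.
Qed.

Lemma primitive_opp f g : primitive f g ->
  primitive (fun x => f (- x)) (fun x => - g (- x)).
Proof.
move=> [cf lg fE]; split; last first.
- move=> x y xy.
  have -> : \int[mu]_(t in `[x, y]) - g (- t) =
            \int[mu]_(t in `[x, y]) (-1 * g (- t)).
    by apply: itv_int_eq => t _; rewrite mulN1r.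
  rewrite itv_intZ ?itv_int_opp//; last exact: locL1_opp.
  by rewrite -fE ?lerN2//; ring.
- by apply: locL1N; exact: locL1_opp.
- move=> x; apply: (@continuous_comp _ _ _ (fun x => - x) f).
    by apply: cvgN; exact: cvg_id.
  exact: cf.
Qed.

Lemma itv_int_fin_num f a b : locL1 f ->
  (\int[mu]_(x in `[a, b]) (f x)%:E)%E \is a fin_num.
Proof.
by move=> [_ if_]; have H := integrable_fin_num _ (if_ a b); apply: H.
Qed.

Lemma cvg_itv_int f : locL1 f -> (forall x, 0 <= f x) ->
  ((\int[mu]_(x in `[- n%:R, n%:R]) f x)%:E @[n --> \oo] -->
   \int[mu]_x (f x)%:E)%E.
Proof.
move=> lf f0; have [mf if_] := lf.
pose F (n : nat) : set (measurableTypeR R) := `[- n%:R, n%:R]%classic.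
have nF : {homo F : n m / (n <= m)%N >-> (n <= m)%O}.
  move=> n m nm; apply/subsetPset => x; rewrite /F /= !in_itv/= => /andP[h1 h2].
  have nm' : (n%:R : R) <= m%:R by rewrite ler_nat.
  by apply/andP; split; lra.
have := @ge0_nondecreasing_set_cvg_integral _ _ R F (EFin \o f) (@lebesgue_measure R) nF.
have -> : \bigcup_i F i = setT by exact: bigcup_itvT.
have -> : (fun i => \int[mu]_(x in F i) (EFin \o f) x)%E =
          (fun n : nat => (\int[mu]_(x in F n) f x)%:E).
  by apply/funext => n; rewrite fineK//; exact: itv_int_fin_num.
apply.
- by move=> i; exact: measurable_itv.
- by move=> i; apply/measurable_EFinP; exact: measurable_funS mf.
- by move=> i x _; rewrite lee_fin.
Qed.

Lemma int_le_itv_int f (C : R) : locL1 f -> (forall x, 0 <= f x) ->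
  (forall n : nat, \int[mu]_(x in `[- n%:R, n%:R]) f x <= C) ->
  (\int[mu]_x (f x)%:E <= C%:E)%E.
Proof.
move=> lf f0 fC; apply: (@cvge_to_le _ _ _ _ _ _ _ (cvg_itv_int lf f0)).
by apply: nearW => n; rewrite lee_fin.
Qed.

Lemma itv_int_le_int f a b : locL1 f -> (forall x, 0 <= f x) ->
  ((\int[mu]_(x in `[a, b]) f x)%:E <= \int[mu]_x (f x)%:E)%E.
Proof.
move=> lf f0; have [mf _] := lf; rewrite fineK; last exact: itv_int_fin_num.
apply: ge0_subset_integral => //; first exact/measurable_EFinP.
by move=> x _; rewrite lee_fin.
Qed.

Lemma le_integrable_ge0 f g : measurable_fun setT f ->
  mu.-integrable setT (EFin \o g) -> (forall x, `|f x| <= g x) ->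
  mu.-integrable setT (EFin \o f).
Proof.
move=> mf ig fg; apply: (le_integrable _ _ _ ig) => //=.
- exact/measurable_EFinP.
- by move=> x _; rewrite lee_fin (le_trans (fg x))// ler_norm.
Qed.

Lemma ge0_integrable f : measurable_fun setT f -> (forall x, 0 <= f x) ->
  (\int[mu]_x (f x)%:E < +oo)%E -> mu.-integrable setT (EFin \o f).
Proof.
move=> mf f0 fi; apply/integrableP; split; first exact/measurable_EFinP.
apply: le_lt_trans fi; apply: ge0_le_integral => //=.
- by apply/measurable_EFinP; exact: measurableT_comp.
- exact/measurable_EFinP.
- by move=> x _; rewrite ger0_norm.
Qed.

Lemma Rint_itv_le f a b : mu.-integrable setT (EFin \o f) ->
  (forall x, 0 <= f x) ->
  \int[mu]_(x in `[a, b]) f x <= \int[mu]_x f x.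
Proof.
move=> fi f0; rewrite -lee_fin [leRHS]fineK; last exact: (integrable_fin_num measurableT fi).
by apply: itv_int_le_int => //; exact: locL1_integrable.
Qed.

Lemma Rint_le_itv f C : mu.-integrable setT (EFin \o f) ->
  (forall x, 0 <= f x) ->
  (forall n : nat, \int[mu]_(x in `[- n%:R, n%:R]) f x <= C) ->
  \int[mu]_x f x <= C.
Proof.
move=> fi f0 fC; rewrite -lee_fin [leLHS]fineK; last exact: (integrable_fin_num measurableT fi).
by apply: int_le_itv_int => //; exact: locL1_integrable.
Qed.

Lemma cvg_Rint f : mu.-integrable setT (EFin \o f) -> (forall x, 0 <= f x) ->
  \int[mu]_(x in `[- n%:R, n%:R]) f x @[n --> \oo] --> \int[mu]_x f x.
Proof.
move=> fi f0; have := cvg_itv_int (locL1_integrable fi) f0.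
have ffin := integrable_fin_num measurableT fi.
by rewrite -(fineK ffin) => /fine_cvg.
Qed.

(** The difference [h] has integral 0 over every segment, hence vanishes at its Lebesgue points on
    each half-line starting at [- n]; countably many half-lines cover the line. This is what makes
    the representative chosen by [wderiv] harmless. *)
Lemma primitive_ae_unique f g1 g2 : primitive f g1 -> primitive f g2 ->
  {ae mu, forall x, g1 x = g2 x}.
Proof.
move=> p1 p2; have := primitiveB p1 p2.
move=> [_ [mh ih] hE]; set h := (fun x => g1 x - g2 x) in mh ih hE.
have lh : locally_integrable setT h.
  split; [exact: mh|exact: openT|move=> K _ cK].
  have [M [_ KM]] := compact_bounded cK.
  have KI : K `<=` `[- (`|M| + 1), `|M| + 1]%classic.
    move=> x Kx; rewrite /= in_itv/= -ler_norml; apply: KM => //.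
    by rewrite (le_lt_trans (ler_norm M))// ltrDl.
  have /integrableP[_] := ih (- (`|M| + 1)) (`|M| + 1).
  apply: le_lt_trans; apply: ge0_subset_integral => //=.
  - exact: compact_measurable.
  - apply/measurable_EFinP; apply: measurableT_comp => //.
    exact: measurable_funS mh.
have H (n : nat) : {ae mu, forall x, - n%:R < x -> h x = 0}.
  have := @FTC1 R h (BLeft (- n%:R)) (ih _) lh.
  apply: filterS; first exact: (ae_filter_ringOfSetsType mu).
  move=> x /= Hx nx; have [] := Hx; first by rewrite lte_fin.
  move=> _ <-.
  rewrite derive1E -(@derive_cst R R R 0 x 1).
  apply: near_eq_derive.
  near=> y; rewrite -hE ?subrr//; apply: ltW.
  near: y; exact: lt_nbhsr.
have := ae_foralln H; apply: filterS.
move=> x hx; apply/eqP; rewrite -subr_eq0; apply/eqP; apply: (hx (Num.bound `|x|)).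
by have := archi_boundP (normr_ge0 x); rewrite ltrNl; apply: le_lt_trans; rewrite -normrN ler_norm.
Unshelve. all: by end_near. Qed.

End WholeLine.

(** * Weak derivatives and primitives *)

Section WeakDerivatives.
Context {R : realType}.
Local Notation mu := (@lebesgue_measure R).
Implicit Types f g : R -> R.

(** Suited to piecewise quadratic functions, for which the remainder bound is a finite case
    analysis, kinks of the derivative included. *)
Lemma is_derive_quadratic (f : R -> R) (x l C : R) :
  (forall h, `|f (x + h) - f x - l * h| <= C * h ^+ 2) ->
  is_derive x (1 : R) f l.
Proof.
move=> H; have C0 : 0 <= C.
  by have := le_trans (normr_ge0 _) (H 1); rewrite expr1n mulr1.
suff : h^-1 *: ((f \o shift x) (h *: (1 : R)) - f x) @[h --> (0 : R)^'] --> l.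
  move=> cl; split; first by apply/cvg_ex; exists l.
  exact/cvg_lim.
apply/cvgrPdist_le => e e0; near=> h.
have h0 : h != 0 by near: h; exact: nbhs_dnbhs_neq.
rewrite /= /GRing.scale/= mulr1 distrC.
have -> : h^-1 * (f (h + x) - f x) - l = h^-1 * (f (x + h) - f x - l * h).
  by rewrite (addrC h); field.
rewrite normrM normfV ler_pdivrMl ?normr_gt0// (le_trans (H h))//.
rewrite -(real_normK (num_real h)) expr2 mulrA mulrC ler_pM2l ?normr_gt0//.
have : `|h| <= e / (C + 1).
  near: h; apply: dnbhs0_le; rewrite divr_gt0// ltr_wpDl//.
rewrite ler_pdivlMr ?ltr_wpDl//; have := normr_ge0 h; nra.
Unshelve. all: by end_near. Qed.

Lemma is_derive_sqr_pos (x : R) :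
  is_derive x (1 : R) (fun s => Num.max s 0 ^+ 2) (2 * Num.max x 0).
Proof.
apply: (@is_derive_quadratic _ _ _ 1) => h; rewrite mul1r ler_norml.
have [hx|hx] := leP x 0; have [hy|hy] := leP (x + h) 0;
  apply/andP; split; nra.
Qed.

Lemma continuous_pos : continuous (fun s : R => Num.max s 0).
Proof. by move=> x; apply: continuous_max; [exact: cvg_id|exact: cvg_cst]. Qed.

(* A C^1 cutoff, equal to 0 on ]-oo, 0] and to 1 on [2, +oo[. *)
Definition cutoff (s : R) := 2^-1 *
  (Num.max s 0 ^+ 2 - 2 * Num.max (s - 1) 0 ^+ 2 + Num.max (s - 2) 0 ^+ 2).
(** The tent of height 1 supported on [[0, 2]], as a second difference of the positive part. *)
Definition dcutoff (s : R) :=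
  Num.max s 0 - 2 * Num.max (s - 1) 0 + Num.max (s - 2) 0.

Lemma is_derive_cutoff_affine (a k x : R) :
  is_derive x (1 : R) (fun t => cutoff (k * (t - a))) (k * dcutoff (k * (x - a))).
Proof.
pose q (t : R) := Num.max t 0 ^+ 2.
have dq (j : R) : is_derive x (1 : R) (fun t => q (k * (t - a) - j))
    (2 * Num.max (k * (x - a) - j) 0 * k).
  apply: (@is_derive1_comp R q (fun t => k * (t - a) - j)).
    exact: is_derive_sqr_pos.
  by apply: is_derive_eq; rewrite /GRing.scale/= !subr0 mulr1.
have -> : (fun t => cutoff (k * (t - a))) = (fun t => 2^-1 * (q (k * (t - a) - 0)
   - 2 * q (k * (t - a) - 1) + q (k * (t - a) - 2))).
  by apply/funext => t; rewrite /cutoff /q subr0.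
apply: is_derive_eq.
by rewrite /GRing.scale/= /dcutoff !subr0; field.
Qed.

Lemma dcutoff_ge0 (s : R) : 0 <= dcutoff s.
Proof.
rewrite /dcutoff; have [h1|h1] := leP s 0; have [h2|h2] := leP (s - 1) 0;
  have [h3|h3] := leP (s - 2) 0; lra.
Qed.

Lemma dcutoff0 s : (s <= 0) || (2 <= s) -> dcutoff s = 0.
Proof.
move=> /orP H; rewrite /dcutoff; have [h1|h1] := leP s 0; have [h2|h2] := leP (s - 1) 0;
  have [h3|h3] := leP (s - 2) 0; case: H => H; lra.
Qed.

Lemma cutoff_le0 s : s <= 0 -> cutoff s = 0.
Proof.
move=> H; rewrite /cutoff; have [h1|h1] := leP s 0; have [h2|h2] := leP (s - 1) 0;
  have [h3|h3] := leP (s - 2) 0; try lra; ring.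
Qed.

Lemma cutoff_ge2 s : 2 <= s -> cutoff s = 1.
Proof.
move=> H; rewrite /cutoff; have [h1|h1] := leP s 0; have [h2|h2] := leP (s - 1) 0;
  have [h3|h3] := leP (s - 2) 0; try lra; try field.
have -> : s = 2 by lra.
by rewrite (_ : 2 - 1 = 1) ?expr1n ?expr0n /= ?expr2; lra.
Qed.

Lemma cutoff01 s : 0 <= cutoff s <= 1.
Proof.
rewrite /cutoff; have [h1|h1] := leP s 0; have [h2|h2] := leP (s - 1) 0;
  have [h3|h3] := leP (s - 2) 0; apply/andP; split; nra.
Qed.

Lemma continuous_dcutoff_affine (a k : R) :
  continuous (fun t => k * dcutoff (k * (t - a))).
Proof.
have caff (j : R) : continuous (fun t : R => k * (t - a) - j).
  move=> x; apply: cvgB; last exact: cvg_cst.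
  apply: cvgM; first exact: cvg_cst.
  by apply: cvgB; [exact: cvg_id|exact: cvg_cst].
have cm (j : R) : continuous (fun t : R => Num.max (k * (t - a) - j) 0).
  move=> x; apply: (@continuous_comp _ _ _ (fun t : R => k * (t - a) - j)
    (fun s : R => Num.max s 0)).
    exact: caff.
  exact: continuous_pos.
have cm0 : continuous (fun t : R => Num.max (k * (t - a)) 0).
  have -> : (fun t => Num.max (k * (t - a)) 0) =
      (fun t => Num.max (k * (t - a) - 0) 0) by apply/funext => t; rewrite subr0.
  exact: cm.
move=> x; apply: cvgM; first exact: cvg_cst.
rewrite /dcutoff; apply: cvgD; last exact: cm.
apply: cvgB; last by apply: cvgM; [exact: cvg_cst|exact: cm].
exact: cm0.
Qed.

Lemma Rint_support f (a b : R) : (forall x, ~~ (a <= x <= b) -> f x = 0) ->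
  \int[mu]_x f x = \int[mu]_(x in `[a, b]) f x.
Proof.
move=> f0; rewrite [RHS]Rintegral_mkcond; apply: eq_Rintegral => x _.
rewrite patchE; case: ifPn => //; rewrite notin_setE/= in_itv/= => /negP.
exact: f0.
Qed.

(** Integration by parts on a segment wider than the support of the test function, so that the
    boundary terms vanish. *)
Lemma primitive_weak f g : primitive f g -> weak_derivative f g.
Proof.
move=> pfg phi [dphi cphi cK].
have dphi' x : is_derive x (1 : R) phi (derive1 phi x).
  by split; [exact: dphi|rewrite derive1E].
have pphi := primitive_C1 dphi' cphi.
have [M [_ KM]] := compact_bounded cK.
pose A := `|M| + 1.
have A0 : 0 <= A by rewrite addr_ge0.
have phi0 x : A < `|x| -> phi x = 0.
  move=> Ax; apply: contrapT => /eqP px; move: Ax; apply/negP; rewrite -leNgt.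
  apply: KM; first by rewrite (le_lt_trans (ler_norm M))// ltrDl.
  exact: subset_closure.
have out x : ~~ (- (A + 1) <= x <= A + 1) -> A + 1 < `|x|.
  by rewrite -ler_norml -ltNge.
have dphi0 x : A < `|x| -> derive1 phi x = 0.
  move=> Ax; rewrite derive1E -(@derive_cst R R R 0 x 1).
  apply: near_eq_derive; near=> y; apply: phi0; near: y.
  by apply: (cvgr_gt `|x|) => //; apply: cvg_norm; exact: cvg_id.
have lt1 x : A + 1 < `|x| -> A < `|x| by apply: lt_trans; rewrite ltrDl.
rewrite (@Rint_support _ (- (A + 1)) (A + 1)); last first.
  by move=> x /out/lt1/dphi0 ->; rewrite mulr0.
rewrite (@Rint_support (fun x => g x * phi x) (- (A + 1)) (A + 1)); last first.
  by move=> x /out/lt1/phi0 ->; rewrite mulr0.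
have pp := primitiveM pfg pphi.
have AA : - (A + 1) <= A + 1 by lra.
have := primitiveE pp AA.
rewrite (phi0 (A + 1)); last by rewrite ger0_norm ?ltrDl//; lra.
rewrite (phi0 (- (A + 1))); last by rewrite normrN ger0_norm ?ltrDl//; lra.
rewrite !mulr0 subrr itv_intD; last first.
- exact: locL1M (primitive_continuous pfg) (primitive_locL1 pphi).
- have := locL1M (primitive_continuous pphi) (primitive_locL1 pfg).
  by under eq_fun do rewrite mulrC.
by move/eqP; rewrite addrC addr_eq0 => /eqP.
Unshelve. all: by end_near. Qed.

Lemma cvg_itv_int_right g (a : R) : locL1 g ->
  \int[mu]_(t in `[a, x]) g t @[x --> a^'+] --> 0.
Proof.
move=> [mg ig]; have a1 : a <= a + 1 by rewrite lerDl.
have := parameterized_integral_continuous a1 (ig a (a + 1)).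
have a1' : a < a + 1 by rewrite ltrDl.
move=> /(continuous_within_itvP _ a1')[_ + _].
by rewrite /parameterized_integral set_itv1 Rintegral_set1.
Qed.

(** The du Bois-Reymond argument with explicit test functions: a smoothed indicator of [[a, b]]
    whose edges have width [s], with [s] small. *)
Lemma weak_primitive f g : continuous f -> locL1 g -> weak_derivative f g ->
  primitive f g.
Proof.
move=> cf lg fg; split=> // a b ab.
move: ab; rewrite le_eqVlt => /predU1P[->|ab].
  by rewrite subrr set_itv1 Rintegral_set1.
apply/eqP; rewrite -subr_eq0 -normr_le0; apply/ler_addgt0Pr => e e0.
have e40 : 0 < e / 4 by rewrite divr_gt0.
have lng := locL1_norm lg.
(* On [[c, c + s]] both the oscillation of [f] and the mass of [g] are at most [e / 4]; applied at
   [a] and at [b], this gives the four errors that add up to [e]. *)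
have small c : exists2 d, 0 < d & forall s, 0 < s -> s < d ->
    (forall t, c <= t <= c + s -> `|f t - f c| <= e / 4) /\
    \int[mu]_(t in `[c, c + s]) `|g t| <= e / 4.
  have /cvgrPdist_le/(_ _ e40) := cf c.
  rewrite nearE => /nbhs_ballP[d /= d0 Hd].
  have := cvg_itv_int_right c lng => /cvgrPdist_le/(_ _ e40).
  rewrite nearE => /nbhs_ballP[d' /= d'0 Hd'].
  exists (Num.min d d'); first by rewrite lt_min d0.
  move=> s s0; rewrite lt_min => /andP[sd sd']; split.
    move=> t /andP[ct ts]; rewrite distrC; apply: Hd; rewrite /ball/= ltr_norml.
    by apply/andP; split; lra.
  have := Hd' (c + s); rewrite /ball/= sub0r normrN => H.
  rewrite (le_trans (ler_norm _))// H ?ltrDl//.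
  by rewrite opprD addrA subrr sub0r normrN gtr0_norm.
have [da da0 Ha] := small a.
have [db db0 Hb] := small b.
pose s := Num.min (Num.min da db) (b - a) / 2.
have m0 : 0 < Num.min (Num.min da db) (b - a) by rewrite !lt_min da0 db0 subr_gt0.
have s0 : 0 < s by rewrite divr_gt0.
have : s < Num.min (Num.min da db) (b - a).
  by rewrite /s ltr_pdivrMr// ltr_pMr// ltr1n.
rewrite !lt_min => /andP[/andP[sda sdb] sba].
have [fa ga] := Ha s s0 sda.
have [fb gb] := Hb s s0 sdb.
pose k := 2 / s.
have k0 : 0 < k by rewrite divr_gt0.
have ks : k * s = 2 by rewrite /k divfK// gt_eqF.
pose K c t := cutoff (k * (t - c)).
pose dK c t := k * dcutoff (k * (t - c)).
have pK c : primitive (K c) (dK c).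
  by apply: primitive_C1 => [x|]; [exact: is_derive_cutoff_affine|exact: continuous_dcutoff_affine].
have K0 c t : t <= c -> K c t = 0.
  by move=> tc; apply: cutoff_le0; rewrite pmulr_rle0// subr_le0.
have K1 c t : c + s <= t -> K c t = 1.
  by move=> ct; apply: cutoff_ge2; rewrite -ks ler_pM2l//; lra.
have dK0 c t : (t <= c) || (c + s <= t) -> dK c t = 0.
  move=> H; rewrite /dK dcutoff0 ?mulr0//; case/orP: H => H.
    by rewrite pmulr_rle0// subr_le0 H.
  by rewrite -ks ler_pM2l//; apply/orP; right; lra.
have dKge0 c t : 0 <= dK c t by rewrite mulr_ge0 ?dcutoff_ge0// ltW.
(* A trapezoid that rises on [[a, a + s]] and falls on [[b, b + s]]. Its derivative is a difference
   of two bumps of mass 1, so its pairing with [f] is almost [f a - f b]. *)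
pose phi t := K a t - K b t.
pose dphi t := dK a t - dK b t.
have dphiE x : is_derive x (1 : R) phi (dphi x).
  apply: is_deriveB; exact: is_derive_cutoff_affine.
have dphi1 : derive1 phi = dphi.
  by apply/funext => x; rewrite derive1E; apply: derive_val.
have phi0 x : ~~ (a <= x <= b + s) -> phi x = 0.
  rewrite negb_and -!ltNge /phi => /orP[H|H].
    by rewrite !K0 ?subrr// ltW// (lt_trans H).
  by rewrite !K1 ?subrr//; move: H ab s0; clear; lra.
have tphi : test_function phi.
  split; first by move=> x; case: (dphiE x).
    rewrite dphi1 => x; apply: cvgB; exact: continuous_dcutoff_affine.
  apply: (@subclosed_compact _ _ `[a, b + s]%classic).
  - exact: closed_closure.
  - exact: segment_compact.
  - have cI : closed (`[a, b + s]%classic : set R) by exact: interval_closed.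
    rewrite ((closure_id _).1 cI).
    apply: closure_subset => x /=; rewrite in_itv/=.
    by apply: contraNT => /phi0 ->.
have := fg phi tphi; rewrite dphi1.
have out x : ~~ (a <= x <= b + s) -> (x <= a) || (a + s <= x) /\ (x <= b) || (b + s <= x).
  by rewrite negb_and -!ltNge => /orP[H|H]; split; apply/orP; [left|left|right|right]; move: H ab s0 sba; clear; lra.
rewrite (@Rint_support _ a (b + s)); last first.
  by move=> x /out[h1 h2]; rewrite /dphi !dK0// subrr mulr0.
rewrite (@Rint_support (fun x => g x * phi x) a (b + s)); last first.
  by move=> x /phi0 ->; rewrite mulr0.
have abs : a <= b + s by lra.
have lfK c : locL1 (fun x => f x * dK c x).
  by apply: locL1M cf _; case: (pK c).
have lK c (z : R) : locL1 (fun x => z * dK c x).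
  by apply: locL1Z; case: (pK c).
have XE c : a <= c -> c <= b -> (forall t, c <= t <= c + s -> `|f t - f c| <= e / 4) ->
    `|\int[mu]_(x in `[a, b + s]) (f x * dK c x) - f c| <= e / 4.
  move=> ac cb fc.
  have ldK : locL1 (dK c) by case: (pK c).
  have dK1 : \int[mu]_(x in `[a, b + s]) dK c x = 1.
    by rewrite (primitiveE (pK c) abs) K1 ?K0 ?subr0//; lra.
  rewrite -{1}[f c]mulr1 -{1}dK1 -itv_intZ// -itv_intB//.
  rewrite (le_trans (itv_int_norm _ _ _))//; first exact: locL1B.
  have <- : \int[mu]_(x in `[a, b + s]) (e / 4 * dK c x) = e / 4.
    by rewrite itv_intZ// dK1 mulr1.
  apply: itv_int_le => //; first by apply: locL1_norm; exact: locL1B.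
  move=> x _; rewrite -mulrBl normrM (ger0_norm (dKge0 _ _)).
  have [xc|xc] := boolP (c <= x <= c + s).
    by rewrite ler_wpM2r//; exact: fc.
  rewrite dK0 ?mulr0//; move: xc; rewrite negb_and -!ltNge => /orP[H|H].
    by rewrite ltW.
  by rewrite (ltW H) orbT.
have Xa := XE a (lexx _) (ltW ab) fa.
have Xb := XE b (ltW ab) (lexx _) fb.
have -> : \int[mu]_(x in `[a, b + s]) (f x * dphi x) =
    \int[mu]_(x in `[a, b + s]) (f x * dK a x) - \int[mu]_(x in `[a, b + s]) (f x * dK b x).
  by rewrite -itv_intB//; apply: itv_int_eq => x _; rewrite mulrBr.
have cphi : continuous phi by case: (primitiveB (pK a) (pK b)).
have lgphi : locL1 (fun x => g x * phi x).
  by have := locL1M cphi lg; under eq_fun do rewrite mulrC.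
have bbs : b <= b + s by rewrite lerDl ltW.
rewrite (itv_int_split lgphi (ltW ab) bbs) => W.
have phi1 x : `|phi x| <= 1.
  have /andP[h1 h2] := cutoff01 (k * (x - a)).
  have /andP[h3 h4] := cutoff01 (k * (x - b)).
  by rewrite ler_norml /phi /K; apply/andP; split; move: h1 h2 h3 h4; clear; lra.
have G2 : `|\int[mu]_(x in `[b, b + s]) (g x * phi x)| <= e / 4.
  rewrite (le_trans (itv_int_norm _ _ _))// (le_trans _ gb)//.
  apply: itv_int_le => //; first exact: locL1_norm.
  by move=> x _; rewrite normrM ler_piMr.
have G1 : `|\int[mu]_(x in `[a, b]) g x - \int[mu]_(x in `[a, b]) (g x * phi x)| <= e / 4.
  rewrite -itv_intB//; have lgg := locL1B lg lgphi.
  rewrite (le_trans (itv_int_norm _ _ _))//.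
  have asb : a + s <= b by move: sba; clear; lra.
  have aas : a <= a + s by move: s0; clear; lra.
  rewrite (itv_int_split (locL1_norm lgg) aas asb).
  rewrite [X in _ + X](@itv_int_eq _ _ (fun=> 0)); last first.
    move=> x /andP[h1 h2]; rewrite /phi K1// (K0 b)// subr0 mulr1 subrr normr0//.
  rewrite itv_int_cst// mul0r addr0 (le_trans _ ga)//.
  apply: itv_int_le => //; first exact: locL1_norm.
  move=> x /andP[h1 h2]; rewrite -{1}[g x]mulr1 -mulrBr normrM ler_piMr//.
  have xb : x <= b by move: h2 asb; clear; lra.
  rewrite /phi (K0 b)// subr0; have /andP[h3 h4] := cutoff01 (k * (x - a)).
  by rewrite ler_norml /K; apply/andP; split; move: h3 h4; clear; lra.
move: Xa Xb G1 G2 W; rewrite add0r !ler_norml.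
clear; move=> /andP[? ?] /andP[? ?] /andP[? ?] /andP[? ?] ?.
by apply/andP; split; lra.
Qed.

Lemma H1locP f : H1loc f <->
  continuous f /\ exists2 g, sqrL1 g & primitive f g.
Proof.
split=> [[cf _ [g /L2loc_sqrL1 g2 fg]]|[cf [g g2 pfg]]].
  by split=> //; exists g => //; exact: weak_primitive cf (sqrL1_locL1 g2) fg.
split=> //; first by apply/L2loc_sqrL1; exact: sqrL1_continuous.
by exists g; [exact/L2loc_sqrL1|exact: primitive_weak].
Qed.

Lemma wderivP f : H1loc f -> sqrL1 (wderiv f) /\ primitive f (wderiv f).
Proof.
move=> [cf _ ex]; have : exists g, L2loc g /\ weak_derivative f g.
  by case: ex => g; exists g.
move=> /(xgetPex (cst 0)); rewrite -/(wderiv f) => -[/L2loc_sqrL1 g2 fg].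
by split=> //; exact: weak_primitive (sqrL1_locL1 g2) fg.
Qed.

End WeakDerivatives.

(** * The profile of the soliton *)

Section SolitonProfile.
Context {R : realType}.
Local Notation mu := (@lebesgue_measure R).
Implicit Types x y k : R.

Let den_gt0 x : 0 < expR x + expR (- x) :> R.
Proof. by rewrite addr_gt0 ?expR_gt0. Qed.

Lemma is_derive_tanh x : is_derive x (1 : R) tanh (1 - tanh x ^+ 2).
Proof.
have d0 := lt0r_neq0 (den_gt0 x).
have dN : is_derive x (1 : R) (fun y : R => expR (- y)) (- expR (- x)).
  have := @is_derive1_comp R expR (fun y => - y) x (expR (- x)) (-1).
  by rewrite mulrN1; apply; exact: is_derive_eq.
have dn : is_derive x (1 : R) (fun y : R => expR y - expR (- y))
    (expR x + expR (- x)).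
  by apply: is_derive_eq; rewrite opprK.
have dd : is_derive x (1 : R) (fun y : R => expR y + expR (- y))
    (expR x - expR (- x)).
  exact: is_derive_eq.
have dv := @is_deriveV R (fun y : R => expR y + expR (- y)) x _ 1 d0 dd.
have dM := is_deriveM dn dv.
apply: (is_derive_eq dM).
by rewrite /tanh /GRing.scale/=; field.
Qed.

Lemma tanh0 : tanh (0 : R) = 0.
Proof. by rewrite /tanh oppr0 subrr mul0r. Qed.

Lemma tanhN x : tanh (- x) = - tanh x.
Proof. by rewrite /tanh opprK -mulNr opprB [expR (- x) + expR x]addrC. Qed.

Lemma tanh_ge0 x : 0 <= x -> 0 <= tanh x.
Proof.
move=> x0; rewrite /tanh divr_ge0 // ?(ltW (den_gt0 x))// subr_ge0 ler_expR; lra.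
Qed.

Lemma tanh_lt1 x : tanh x < 1.
Proof. by rewrite /tanh ltr_pdivrMr// mul1r; have := expR_gt0 (- x); lra. Qed.

Lemma sqr_tanh_lt1 x : tanh x ^+ 2 < 1.
Proof.
by have h := tanh_lt1 x; have := tanh_lt1 (- x); rewrite tanhN => ?; nra.
Qed.

(** [1 - tanh x = 2 / (exp (2 x) + 1)] and [exp (2 x) >= 1 + 2 x]. *)
Lemma tanh_lower x : 0 <= x -> 1 - (1 + x)^-1 <= tanh x.
Proof.
move=> x0; have x1 : 0 < 1 + x by lra.
have d0 := den_gt0 x; have ex := expR_gt0 x.
rewrite lerBlDr -lerBlDl.
have -> : 1 - tanh x = 2 * expR (- x) / (expR x + expR (- x)).
  by rewrite /tanh; field; rewrite lt0r_neq0.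
rewrite ler_pdivrMr// -(ler_pM2l x1) [leRHS]mulrA divff ?lt0r_neq0// mul1r.
have e2 : 1 + (x + x) <= expR x * expR x by rewrite -expRD expR_ge1Dx.
have e3 : expR x * expR (- x) = 1 by rewrite expRN divff ?lt0r_neq0.
have := expR_gt0 (- x).
rewrite -(ler_pM2l ex) mulrDr !(mulrCA (expR x)) e3 !mulr1; lra.
Qed.

Lemma sqrt2_gt0 : 0 < Num.sqrt 2 :> R.
Proof. by rewrite sqrtr_gt0. Qed.

Lemma sqrt2K : Num.sqrt 2 * Num.sqrt 2 = 2 :> R.
Proof. by rewrite -expr2 sqr_sqrtr. Qed.

(* With a^2 + k^2 = 1, the soliton of speed sqrt 2 a is [profile k x - i a]. *)
Definition profile k x : R := k * tanh (k / Num.sqrt 2 * x).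

(** This is [1 - |v|^2] for the soliton [v], as [a^2 + k^2 = 1]; it is also [sqrt 2] times the
    derivative of [profile k]. *)
Definition profile_eta k x : R := k ^+ 2 - profile k x ^+ 2.

Lemma is_derive_profile k x :
  is_derive x (1 : R) (profile k) (profile_eta k x / Num.sqrt 2).
Proof.
have dl : is_derive x (1 : R) (fun y => k / Num.sqrt 2 * y) (k / Num.sqrt 2).
  by apply: is_derive_eq; rewrite /GRing.scale/= mulr1.
have dt := is_derive1_comp (is_derive_tanh (k / Num.sqrt 2 * x)) dl.
have := is_deriveZ k dt; rewrite /profile => dk.
apply: (is_derive_eq dk).
rewrite /profile_eta /profile /GRing.scale/=; field.
by rewrite lt0r_neq0// sqrt2_gt0.
Qed.

Lemma is_derive_profile_eta k x : is_derive x (1 : R) (profile_eta k)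
  (- (Num.sqrt 2 * profile k x * profile_eta k x)).
Proof.
have dp := is_derive_profile k x; rewrite /profile_eta.
apply: is_derive_eq; rewrite /GRing.scale/= -/(profile_eta k x).
have s0 := lt0r_neq0 sqrt2_gt0.
have -> : profile_eta k x / Num.sqrt 2 = 2^-1 * Num.sqrt 2 * profile_eta k x.
  apply: (mulIf s0); rewrite divfK//.
  by rewrite mulrAC -[2^-1 * _ * _]mulrA sqrt2K mulVf// mul1r.
by field.
Qed.

Lemma continuous_profile k : continuous (profile k).
Proof.
move=> x; apply/differentiable_continuous/derivable1_diffP.
by case: (is_derive_profile k x).
Qed.

Lemma continuous_profile_eta k : continuous (profile_eta k).
Proof.
move=> x; apply/differentiable_continuous/derivable1_diffP.
by case: (is_derive_profile_eta k x).
Qed.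

Lemma primitive_profile k :
  primitive (profile k) (fun x => profile_eta k x / Num.sqrt 2).
Proof.
apply: primitive_C1; first exact: is_derive_profile.
by move=> x; apply: cvgM; [exact: continuous_profile_eta|exact: cvg_cst].
Qed.

Lemma primitive_profile_eta k : primitive (profile_eta k)
  (fun x => - (Num.sqrt 2 * profile k x * profile_eta k x)).
Proof.
apply: primitive_C1; first exact: is_derive_profile_eta.
move=> x; apply: cvgN; apply: cvgM; last exact: continuous_profile_eta.
by apply: cvgM; [exact: cvg_cst|exact: continuous_profile].
Qed.

Lemma profile0 k : profile k 0 = 0.
Proof. by rewrite /profile mulr0 tanh0 mulr0. Qed.

Lemma profileN k x : profile k (- x) = - profile k x.
Proof. by rewrite /profile mulrN tanhN mulrN. Qed.

Lemma profile_etaN k x : profile_eta k (- x) = profile_eta k x.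
Proof. by rewrite /profile_eta profileN sqrrN. Qed.

Lemma profile_ge0 k x : 0 <= k -> 0 <= x -> 0 <= profile k x.
Proof.
move=> k0 x0; rewrite /profile mulr_ge0// tanh_ge0// mulr_ge0// divr_ge0//.
Qed.

Lemma profile_eta_ge0 k x : 0 <= profile_eta k x.
Proof.
rewrite /profile_eta /profile exprMn.
by have := sqr_tanh_lt1 (k / Num.sqrt 2 * x); have := sqr_ge0 k; nra.
Qed.

Lemma profile_eta_le k x : profile_eta k x <= k ^+ 2.
Proof. by rewrite /profile_eta; have := sqr_ge0 (profile k x); lra. Qed.

Lemma sqr_profile_le k x : profile k x ^+ 2 <= k ^+ 2.
Proof. by have := profile_eta_ge0 k x; rewrite /profile_eta subr_ge0. Qed.

Lemma cvg_profile k : 0 < k -> profile k n%:R @[n --> \oo] --> k.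
Proof.
move=> k0; have ks : 0 < k / Num.sqrt 2 by rewrite divr_gt0// sqrt2_gt0.
rewrite -[X in _ --> X]mulr1; apply: cvgM; first exact: cvg_cst.
have H : (1 - (1 + k / Num.sqrt 2 * n%:R)^-1) @[n --> \oo] --> (1 : R).
  rewrite -[X in _ --> X]subr0; apply: cvgB; first exact: cvg_cst.
  apply/gtr0_cvgV0.
    by near=> n; rewrite ltr_wpDr// mulr_ge0// ltW.
  apply/cvgryPge => A; near=> n.
  have : A / (k / Num.sqrt 2) <= n%:R by near: n; exact: nbhs_infty_ger.
  by rewrite ler_pdivrMr// mulrC => h; rewrite (le_trans h)// lerDr.
apply: (squeeze_cvgr _ H (@cvg_cst _ _ _ _ _)).
apply: nearW => n; apply/andP; split; last exact/ltW/tanh_lt1.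
by apply: tanh_lower; rewrite mulr_ge0// ltW.
Unshelve. all: by end_near. Qed.

End SolitonProfile.

(** * Energy barriers *)

Section Barrier.
Context {R : realType}.
Implicit Types q s : R.

(* Its derivative in s is s / (2 sqrt 2 (1 + q^2 - s)^(1/2)), so that for every
   q > 0 the energy density of v bounds |(barrier q eta)'|; the parameter q
   keeps the square root away from 0 where v vanishes. *)
Definition barrier (q s : R) :=
  (Num.sqrt (1 + q ^+ 2) - Num.sqrt (1 + q ^+ 2 - s)) ^+ 2 *
  (2 * Num.sqrt (1 + q ^+ 2) + Num.sqrt (1 + q ^+ 2 - s)) / (3 * Num.sqrt 2).

Let sqrt2_ge : 7 / 5 <= Num.sqrt 2 :> R.
Proof.
by rewrite -(@ler_pXn2r _ 2) ?nnegrE ?sqrtr_ge0 ?sqr_sqrtr//; lra.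
Qed.

Let sqrt2_le : Num.sqrt 2 <= 3 / 2 :> R.
Proof.
by rewrite -(@ler_pXn2r _ 2) ?nnegrE ?sqrtr_ge0 ?sqr_sqrtr//; lra.
Qed.

Lemma barrier0 q : barrier q 0 = 0.
Proof. by rewrite /barrier subr0 subrr expr0n/= !mul0r. Qed.

(** Since [(T - t) * (T + t) = s], the barrier is quadratically small where [eta] is small; such
    points are taken as the feet of the barrier. *)
Lemma barrier_le_sqr q s : `|s| <= 1 -> barrier q s <= s ^+ 2.
Proof.
rewrite ler_norml => /andP[s1 s2]; rewrite /barrier.
have q2 := sqr_ge0 q.
set T := Num.sqrt (1 + _); set t := Num.sqrt (1 + _ - s).
have T0 : 0 <= T by rewrite sqrtr_ge0.
have t0 : 0 <= t by rewrite sqrtr_ge0.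
have T2 : T ^+ 2 = 1 + q ^+ 2 by rewrite sqr_sqrtr//; lra.
have t2 : t ^+ 2 = T ^+ 2 - s by rewrite T2 sqr_sqrtr//; lra.
have T1 : 1 <= T by nra.
have tT : t <= 2 * T by nra.
have e : (T - t) * (T + t) = s by nra.
have dT : (T - t) ^+ 2 * T <= s ^+ 2.
  have : (T - t) ^+ 2 * T ^+ 2 <= s ^+ 2.
    by rewrite -e exprMn ler_wpM2l ?sqr_ge0//; nra.
  by apply: le_trans; rewrite ler_wpM2l ?sqr_ge0//; nra.
have d0 : 0 < 3 * Num.sqrt 2 :> R by have := sqrt2_ge; lra.
rewrite ler_pdivrMr//.
apply: (@le_trans _ _ ((T - t) ^+ 2 * (4 * T))).
  by rewrite ler_wpM2l ?sqr_ge0//; lra.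
have := sqr_ge0 s; have := sqrt2_ge; nra.
Qed.

Lemma barrier_lt q s s' : 0 <= s -> s < s' -> s' <= 1 -> barrier q s < barrier q s'.
Proof.
move=> s0 ss s1; rewrite /barrier.
have q2 := sqr_ge0 q.
set T := Num.sqrt (1 + _); set t := Num.sqrt (1 + _ - s).
set t' := Num.sqrt (1 + _ - s').
have T0 : 0 <= T by rewrite sqrtr_ge0.
have t0 : 0 <= t by rewrite sqrtr_ge0.
have t0' : 0 <= t' by rewrite sqrtr_ge0.
have T2 : T ^+ 2 = 1 + q ^+ 2 by rewrite sqr_sqrtr//; lra.
have t2 : t ^+ 2 = T ^+ 2 - s by rewrite T2 sqr_sqrtr//; lra.
have t2' : t' ^+ 2 = T ^+ 2 - s' by rewrite T2 sqr_sqrtr//; lra.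
have tT : t <= T by nra.
have tt : t' < t by nra.
have d0 : 0 < (3 * Num.sqrt 2)^-1 :> R by rewrite invr_gt0; have := sqrt2_ge; lra.
rewrite ltr_pM2r// -subr_gt0.
have -> : (T - t') ^+ 2 * (2 * T + t') - (T - t) ^+ 2 * (2 * T + t) =
  (t - t') * (3 * T ^+ 2 - (t ^+ 2 + t * t' + t' ^+ 2)) by ring.
rewrite mulr_gt0 ?subr_gt0//.
have : t * t' <= t ^+ 2 by nra.
have : t' ^+ 2 < t ^+ 2 by nra.
nra.
Qed.

(** The bound amounts to [|v| <= 4], that is [1 - s <= 16]. If [t > 4], the factors
    [(T - t)^2 >= 25 / 4] and [2 T + t >= 6] already make the barrier far too high. *)
Lemma barrier_bound s : s <= 1 -> 2 * barrier 1 s <= 1 -> -15 <= s.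
Proof.
rewrite /barrier expr1n; set T := Num.sqrt (1 + 1); set t := Num.sqrt (1 + 1 - s) => s1.
have T0 : 0 <= T by rewrite sqrtr_ge0.
have t0 : 0 <= t by rewrite sqrtr_ge0.
have T2 : T ^+ 2 = 2 by rewrite sqr_sqrtr//; lra.
have t2 : t ^+ 2 = 2 - s by rewrite sqr_sqrtr//; lra.
have d0 : 0 < 3 * Num.sqrt 2 :> R by have := sqrt2_ge; lra.
rewrite mulrA ler_pdivrMr// mul1r => H.
have : t <= 4; last by nra.
rewrite leNgt; apply/negP => t4.
have T1 : 1 <= T by nra.
have T32 : T <= 3 / 2 by nra.
have h1 : 25 / 4 <= (T - t) ^+ 2 by nra.
have h2 : 6 <= 2 * T + t by lra.
have := sqrt2_le; nra.
Qed.

(** At [q = 0], twice the barrier is exactly the threshold [2 sqrt 2 / 3]; the loss is linear in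
    [q]. *)
Lemma barrier1_lower (q : R) : 0 < q -> q <= 1 ->
  2 * Num.sqrt 2 / 3 - 3 * q <= 2 * barrier q 1.
Proof.
move=> q0 q1; rewrite /barrier.
have -> : 1 + q ^+ 2 - 1 = q ^+ 2 by ring.
rewrite sqrtr_sqr (gtr0_norm q0).
set T := Num.sqrt (1 + q ^+ 2).
have T0 : 0 <= T by rewrite sqrtr_ge0.
have q2 := sqr_ge0 q.
have T2 : T ^+ 2 = 1 + q ^+ 2 by rewrite sqr_sqrtr//; lra.
have T1 : 1 <= T by nra.
have Tq : q <= T by nra.
have s0 := @sqrt2_gt0 R.
have d0 : 0 < 3 * Num.sqrt 2 :> R by lra.
rewrite mulrA ler_pdivlMr//.
have -> : (2 * Num.sqrt 2 / 3 - 3 * q) * (3 * Num.sqrt 2) =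
   2 * (Num.sqrt 2 * Num.sqrt 2) - 9 * q * Num.sqrt 2 by field.
rewrite sqrt2K.
have : (T - q) ^+ 2 * (2 * T + q) = 2 * T ^+ 3 - 3 * T ^+ 2 * q + q ^+ 3 by ring.
have T3 : 1 <= T ^+ 3 by rewrite exprn_ege1.
have q3 : 0 <= q ^+ 3 by rewrite exprn_ge0// ltW.
have := sqrt2_ge; nra.
Qed.

Lemma is_derive_sqrt (x : R) : 0 < x ->
  is_derive x (1 : R) (@Num.sqrt R) (2 * Num.sqrt x)^-1.
Proof. by move=> x0; exact: is_derive1_sqrt. Qed.

Lemma is_derive_barrier q s : 0 < q -> s <= 1 ->
  is_derive s (1 : R) (barrier q) (s / (2 * Num.sqrt 2 * Num.sqrt (1 + q ^+ 2 - s))).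
Proof.
move=> q0 s1; have q2 : 0 < q ^+ 2 by rewrite exprn_gt0.
have w0 : 0 < 1 + q ^+ 2 - s by lra.
have da : is_derive s (1 : R) (fun s => 1 + q ^+ 2 - s) (-1).
  by apply: is_derive_eq; ring.
pose t := Num.sqrt (1 + q ^+ 2 - s).
have t0 : 0 < t by rewrite sqrtr_gt0.
pose T := Num.sqrt (1 + q ^+ 2).
have T2 : T ^+ 2 = 1 + q ^+ 2 by rewrite sqr_sqrtr//; lra.
have t2 : t ^+ 2 = 1 + q ^+ 2 - s by rewrite sqr_sqrtr// ltW.
pose w := fun s : R => Num.sqrt (1 + q ^+ 2 - s).
have dw : is_derive s (1 : R) w ((2 * t)^-1 * -1) by exact: (@is_derive1_comp R Num.sqrt (fun s => 1 + q ^+ 2 - s) s _ _ (is_derive_sqrt w0) da).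
have s0 := lt0r_neq0 (@sqrt2_gt0 R).
have -> : barrier q = (fun s => (T - w s) ^+ 2 * (2 * T + w s) * (3 * Num.sqrt 2)^-1).
  by [].
apply: is_derive_eq; rewrite /GRing.scale/= -/t.
rewrite -[w s]/t; have e : s = T ^+ 2 - t ^+ 2 by rewrite T2 t2; ring.
rewrite [X in X / _]e !(mulr0, add0r, mul1r, mulrN1).
have t1 := lt0r_neq0 t0.
by field; rewrite s0 t1.
Qed.

End Barrier.

(** * Consequences of a finite energy: absence of zeros, bounds, a maximum of [eta] *)

Section EnergyBounds.
Context {R : realType}.
Local Notation mu := (@lebesgue_measure R).

(** Stands in for decay at infinity: were [f >= e] on a segment of length [N], its integral would be
    at least [e * N = C + e], more than the total [C]. *)
Lemma small_value (f : R -> R) (e a : R) :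
  mu.-integrable setT (EFin \o f) -> (forall x, 0 <= f x) -> 0 < e ->
  (exists2 y, a <= y & f y < e) /\ (exists2 y, y <= a & f y < e).
Proof.
move=> fi f0 e0; have lf := locL1_integrable fi.
pose C := \int[mu]_x f x.
have C0 : 0 <= C by apply: Rintegral_ge0.
pose N := C / e + 1.
have N0 : 0 <= N by rewrite addr_ge0// divr_ge0// ltW.
have small b : exists2 y, b <= y <= b + N & f y < e.
  apply: contrapT => H.
  have ef y : b <= y <= b + N -> e <= f y.
    by move=> yb; rewrite leNgt; apply/negP => fy; apply: H; exists y.
  have bN : b <= b + N by rewrite lerDl.
  have : e * N <= C.
    have := Rint_itv_le b (b + N) fi f0.
    apply: le_trans; rewrite -[X in e * X](addKr b) addrC -itv_int_cst//.
    by apply: itv_int_le => //; exact: locL1_cst.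
  rewrite /N mulrDr mulrCA divff ?lt0r_neq0// mulr1; lra.
split.
  by have [y /andP[y1 _] fy] := small a; exists y.
by have [y /andP[_ y2] fy] := small (a - N); exists y => //; lra.
Qed.

Variables v1 v2 g1 g2 : R -> R.
Hypothesis p1 : primitive v1 g1.
Hypothesis p2 : primitive v2 g2.

Definition eta x := 1 - (v1 x ^+ 2 + v2 x ^+ 2).
Definition deta x := - (2 * v1 x * g1 x + 2 * v2 x * g2 x).
Definition edens x := 2^-1 * (g1 x ^+ 2 + g2 x ^+ 2) + 4^-1 * eta x ^+ 2.

Hypothesis ei : mu.-integrable setT (EFin \o edens).

Lemma primitive_eta : primitive eta deta.
Proof.
have := primitiveB (primitive_cst 1) (primitiveD (primitive_sqr p1) (primitive_sqr p2)).
by apply: eq_primitive => x //; rewrite /deta sub0r.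
Qed.

Lemma eta_le1 x : eta x <= 1.
Proof. by rewrite /eta; have := sqr_ge0 (v1 x); have := sqr_ge0 (v2 x); lra. Qed.

Lemma edens_ge0 x : 0 <= edens x.
Proof.
rewrite /edens; have := sqr_ge0 (g1 x); have := sqr_ge0 (g2 x).
by have := sqr_ge0 (eta x); lra.
Qed.

Lemma small_eta (e a : R) : 0 < e ->
  (exists2 y, a <= y & `|eta y| < e) /\ (exists2 y, y <= a & `|eta y| < e).
Proof.
move=> e0; have e20 : 0 < 4^-1 * e ^+ 2 by rewrite mulr_gt0// exprn_gt0.
have H y : edens y < 4^-1 * e ^+ 2 -> `|eta y| < e.
  move=> h; rewrite -(@ltr_pXn2r _ 2) ?nnegrE ?normr_ge0 ?ltW//.
  rewrite real_normK ?num_real//; move: h; rewrite /edens.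
  by have := sqr_ge0 (g1 y); have := sqr_ge0 (g2 y); lra.
have [[y y1 y2] [z z1 z2]] := small_value a ei edens_ge0 e20.
by split; [exists y|exists z] => //; exact: H.
Qed.

(** Cauchy-Schwarz gives [deta^2 <= 4 |v|^2 |v'|^2], and [|v|^2 = 1 - eta] is below
    [w^2 = 1 + q^2 - eta]; hence [r = deta / (2 w)] satisfies [r^2 <= |v'|^2], and
    [|eta * r| / sqrt 2] is at most the energy density. *)
Lemma barrier_variation q x y : 0 < q -> x <= y ->
  `|barrier q (eta y) - barrier q (eta x)| <= \int[mu]_(t in `[x, y]) edens t.
Proof.
move=> q0 xy; have q2 : 0 < q ^+ 2 by rewrite exprn_gt0.
pose b' s := s / (2 * Num.sqrt 2 * Num.sqrt (1 + q ^+ 2 - s)).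
have ceta := primitive_continuous primitive_eta.
have ct : continuous (fun t => Num.sqrt (1 + q ^+ 2 - eta t)).
  move=> t; apply: (@continuous_comp _ _ _ (fun t => 1 + q ^+ 2 - eta t) Num.sqrt).
    by apply: cvgB; [exact: cvg_cst|exact: ceta].
  exact: sqrt_continuous.
have t0 t : 0 < Num.sqrt (1 + q ^+ 2 - eta t).
  by rewrite sqrtr_gt0; have := eta_le1 t; lra.
have s2 := @sqrt2_gt0 R.
have cb' : continuous (fun t => b' (eta t)).
  move=> t; apply: cvgM; first exact: ceta.
  apply: cvgV; first by rewrite !mulf_neq0// lt0r_neq0.
  by apply: cvgM; [exact: cvg_cst|exact: ct].
have db t : is_derive (eta t) (1 : R) (barrier q) (b' (eta t)).
  by apply: is_derive_barrier => //; exact: eta_le1.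
have pb := primitive_comp primitive_eta db cb'.
have le := locL1_integrable ei.
rewrite -(primitiveE pb xy).
rewrite (le_trans (itv_int_norm _ _ (primitive_locL1 pb)))//.
apply: itv_int_le => //; first exact: locL1_norm (primitive_locL1 pb).
move=> t _; rewrite /b'; have w0 := t0 t.
set w := Num.sqrt (1 + q ^+ 2 - eta t) in w0 *.
set s := Num.sqrt 2 in s2 *.
have w2 : w ^+ 2 = 1 + q ^+ 2 - eta t.
  by rewrite sqr_sqrtr//; have := eta_le1 t; lra.
have ss : s ^+ 2 = 2 by rewrite sqr_sqrtr.
pose r := deta t / (2 * w).
have r2 : r ^+ 2 <= g1 t ^+ 2 + g2 t ^+ 2.
  rewrite /r expr_div_n ler_pdivrMr; last by rewrite exprn_gt0// mulr_gt0.
  rewrite exprMn w2 /deta /eta.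
  have h1 := sqr_ge0 (v1 t * g2 t - v2 t * g1 t).
  have h2 : 0 <= q ^+ 2 * (g1 t ^+ 2 + g2 t ^+ 2).
    by rewrite mulr_ge0 ?addr_ge0 ?sqr_ge0.
  lra.
have -> : eta t / (2 * s * w) * deta t = eta t * r / s.
  by rewrite /r; field; rewrite !lt0r_neq0.
have -> : eta t * r / s = s * (eta t * r) / 2.
  by rewrite -ss; field; rewrite lt0r_neq0.
have h1 := sqr_ge0 (s * r - eta t); have h2 := sqr_ge0 (s * r + eta t).
rewrite ler_norml /edens; apply/andP; split; nra.
Qed.

Let E := \int[mu]_x edens x.

(** The barrier must fall from its value at [x] to almost 0 on each side of [x], whence the factor
    2. *)
Lemma barrier_le_energy q x : 0 < q -> 2 * barrier q (eta x) <= E.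
Proof.
move=> q0; apply/ler_addgt0Pr => e e0.
have d0 : 0 < Num.min 1 (e / 2) by rewrite lt_min ltr01 divr_gt0.
have [[y xy hy] [z zx hz]] := small_eta x d0.
have small t : `|eta t| < Num.min 1 (e / 2) -> barrier q (eta t) <= e / 2.
  rewrite lt_min => /andP[h1 h2]; apply: (le_trans (barrier_le_sqr _ (ltW h1))).
  by rewrite -(real_normK (num_real (eta t))); have := normr_ge0 (eta t); nra.
have by_ := small _ hy; have bz := small _ hz.
have V1 := barrier_variation q0 xy; have V2 := barrier_variation q0 zx.
have := Rint_itv_le z y ei edens_ge0.
rewrite (itv_int_split (locL1_integrable ei) zx xy) -/E.
move: V1 V2; rewrite !ler_norml => /andP[? ?] /andP[? ?]; lra.
Qed.

Lemma eta_lt1 x : E < energy_threshold -> eta x < 1.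
Proof.
move=> Eth; rewrite lt_neqAle eta_le1 andbT; apply/eqP => e1.
rewrite /energy_threshold in Eth.
(* Dividing the gap to the threshold by 4 beats the loss [3 * q] of [barrier1_lower]. *)
pose q := Num.min 1 ((2 * Num.sqrt 2 / 3 - E) / 4).
have q0 : 0 < q by rewrite lt_min ltr01 divr_gt0// subr_gt0.
have q1 : q <= 1 by rewrite ge_min lexx.
have qE : q <= (2 * Num.sqrt 2 / 3 - E) / 4 by rewrite ge_min lexx orbT.
have := barrier1_lower q0 q1; have := barrier_le_energy x q0.
by rewrite e1; lra.
Qed.

Lemma eta_lower x : E <= 1 -> -15 <= eta x.
Proof.
move=> E1; apply: barrier_bound; first exact: eta_le1.
exact: le_trans (barrier_le_energy x ltr01) E1.
Qed.

(** Outside some [[- n, n]] the energy is less than [b / 2]. A point there with [eta > eta x1] has a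
    barrier above [b], yet it is joined, within the tail, to a point where the barrier is at most
    [b / 2]. So [eta <= eta x1] outside, and a maximum over a large segment is global. *)
Lemma eta_max x1 : 0 < eta x1 -> exists x0, forall x, eta x <= eta x0.
Proof.
move=> e1; set b := barrier 1 (eta x1).
have b0 : 0 < b by have := barrier_lt 1 (lexx 0) e1 (eta_le1 _); rewrite barrier0.
have b20 : 0 < b / 2 by rewrite divr_gt0.
have lee := locL1_integrable ei.
have /cvgrPdist_lt/(_ _ b20) [n _ Hn] := cvg_Rint ei edens_ge0.
have {Hn} := Hn n (leqnn n); rewrite /= -/E => Hn.
have In := Rint_itv_le (- n%:R) n%:R ei edens_ge0.
have n0 : (0 : R) <= n%:R by rewrite ler0n.
have nn : - n%:R <= n%:R :> R by lra.
have Hn' : E - b / 2 < \int[mu]_(x in `[- n%:R, n%:R]) edens x.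
  by move: Hn; rewrite ltr_norml -/E => /andP[_]; lra.
have small t : `|eta t| < Num.min 1 (b / 2) -> barrier 1 (eta t) <= b / 2.
  rewrite lt_min => /andP[h1 h2]; apply: (le_trans (barrier_le_sqr _ (ltW h1))).
  by rewrite -(real_normK (num_real (eta t))); have := normr_ge0 (eta t); nra.
have m0 : 0 < Num.min 1 (b / 2) by rewrite lt_min ltr01.
have ige0 s t : 0 <= \int[mu]_(x in `[s, t]) edens x.
  by apply: itv_int_ge0 => z _; exact: edens_ge0.
have notbig x : barrier 1 (eta x) < b -> eta x <= eta x1.
  move=> bx; rewrite leNgt; apply/negP => xx.
  by have := barrier_lt 1 (ltW e1) xx (eta_le1 x); rewrite -/b; lra.
have tailr x : n%:R < x -> eta x <= eta x1.
  move=> nx; have [[y xy hy] _] := small_eta x m0.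
  have by_ := small _ hy; have V := barrier_variation ltr01 xy.
  have := Rint_itv_le (- n%:R) y ei edens_ge0.
  rewrite (@itv_int_split _ edens _ n%:R)//; last by lra.
  rewrite (@itv_int_split _ edens n%:R x)//; last by lra.
  rewrite -/E => Iy; apply: notbig; have := ige0 n%:R x.
  move: V; rewrite ler_norml => /andP[? ?]; lra.
have taill x : x < - n%:R -> eta x <= eta x1.
  move=> nx; have [_ [y xy hy]] := small_eta x m0.
  have by_ := small _ hy; have V := barrier_variation ltr01 xy.
  have := Rint_itv_le y n%:R ei edens_ge0.
  rewrite (@itv_int_split _ edens _ (- n%:R))//; last by lra.
  rewrite (@itv_int_split _ edens y x)//; last by lra.
  rewrite -/E => Iy; apply: notbig; have := ige0 x (- n%:R).
  move: V; rewrite ler_norml => /andP[? ?]; lra.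
pose N := n%:R + `|x1|.
have NN : - N <= N by have := normr_ge0 x1; rewrite /N; lra.
have ceta : {within `[- N, N], continuous eta}.
  exact/continuous_subspaceT/(primitive_continuous primitive_eta).
have [x0 _ max0] := EVT_max NN ceta.
have m1 : eta x1 <= eta x0.
  apply: max0; rewrite in_itv/= -ler_norml /N; lra.
exists x0 => x; have [xN|] := boolP (- N <= x <= N); first by apply: max0; rewrite in_itv.
rewrite negb_and -!ltNge => /orP[h|h]; apply: le_trans m1.
  by apply: taill; have := normr_ge0 x1; rewrite /N in h; lra.
by apply: tailr; have := normr_ge0 x1; rewrite /N in h; lra.
Qed.

End EnergyBounds.

(** * Calibration *)

Section Calibration.
Context {R : realType}.
Local Notation mu := (@lebesgue_measure R).

Lemma continuous_antiderivative (g : R -> R) : continuous g ->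
  exists G : R -> R, forall y, is_derive y (1 : R) G (g y).
Proof.
move=> cg; have lg := locL1_continuous cg.
(* The signed integral from 0: unless [y = 0], one of the two segments is empty. *)
pose G y := \int[mu]_(t in `[0, y]) g t - \int[mu]_(t in `[y, 0]) g t.
exists G => y.
have GE a z : a <= z -> G z = G a + \int[mu]_(t in `[a, z]) g t.
  have I0 (s t : R) : t < s -> \int[mu]_(x in `[s, t]) g x = 0.
    by move=> ts; rewrite set_itv_ge ?Rintegral_set0// bnd_simp -ltNge.
  have I1 (s : R) : \int[mu]_(x in `[s, s]) g x = 0.
    by rewrite set_itv1 Rintegral_set1.
  move=> az; rewrite /G; have [a0|a0] := leP 0 a.
    rewrite (itv_int_split lg a0 az).
    have -> : \int[mu]_(t in `[a, 0]) g t = 0.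
      by move: a0; rewrite le_eqVlt => /predU1P[<-|/I0//].
    have -> : \int[mu]_(t in `[z, 0]) g t = 0.
      by move: (le_trans a0 az); rewrite le_eqVlt => /predU1P[<-|/I0//].
    by rewrite !subr0.
  rewrite (I0 0 a)//; have [z0|z0] := leP 0 z.
    rewrite (itv_int_split lg (ltW a0) z0).
    have -> : \int[mu]_(t in `[z, 0]) g t = 0.
      by move: z0; rewrite le_eqVlt => /predU1P[<-|/I0//].
    by ring.
  by rewrite (I0 0 z)// (itv_int_split lg az (ltW z0)); ring.
have y1 : y - 1 < y by rewrite ltrBlDr ltrDl.
have [dF F'] : derivable (fun z => \int[mu]_(t in `[y - 1, z]) g t) y 1 /\
    derive1 (fun z => \int[mu]_(t in `[y - 1, z]) g t) y = g y.
  apply: (@continuous_FTC1_closed R g (y - 1) y (y + 1)) => //.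
  - by rewrite ltrDl.
  - by case: lg.
  - exact: cg.
have dG : \forall z \near y, G z = G (y - 1) + \int[mu]_(t in `[y - 1, z]) g t.
  by near=> z; apply: GE; near: z; exact: lt_le_nbhsr.
have dH : is_derive y (1 : R) (fun z => G (y - 1) + \int[mu]_(t in `[y - 1, z]) g t) (g y).
  have dF' : is_derive y (1 : R) (fun z => \int[mu]_(t in `[y - 1, z]) g t) (g y).
    by apply: DeriveDef; [exact: dF|rewrite -derive1E; exact: F'].
  by have := is_deriveD (is_derive_cst (G (y - 1)) y 1) dF'; rewrite add0r.
have [dHd dHv] := dH; apply: DeriveDef.
  have dG' : \forall z \near y, G (y - 1) + \int[mu]_(t in `[y - 1, z]) g t = G z.
    by apply: filterS dG => z ->.
  exact: (near_eq_derivable dG').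
by rewrite (near_eq_derive _ dG).
Unshelve. all: by end_near. Qed.

Variables a k : R.
Hypothesis a0 : 0 < a.
Hypothesis k0 : 0 < k.
Hypothesis ak : a ^+ 2 + k ^+ 2 = 1.

(* Only the values at s <= k^2, where 1 - s >= a^2, matter; the maximum makes
   the function continuous on the whole line. *)
Definition calib (s : R) :=
  s * Num.sqrt (2 * (k ^+ 2 - s)) / (4 * Num.max (1 - s) (a ^+ 2)).

Let a20 : 0 < a ^+ 2. Proof. by rewrite exprn_gt0. Qed.

Let max_gt0 s : 0 < Num.max (1 - s) (a ^+ 2).
Proof. by rewrite lt_max a20 orbT. Qed.

Lemma continuous_calib : continuous calib.
Proof.
move=> s; apply: cvgM.
  apply: cvgM; first exact: cvg_id.
  apply: (@continuous_comp _ _ _ (fun s => 2 * (k ^+ 2 - s)) Num.sqrt).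
    apply: cvgM; first exact: cvg_cst.
    by apply: cvgB; [exact: cvg_cst|exact: cvg_id].
  exact: sqrt_continuous.
apply: cvgV; first by rewrite mulf_neq0// lt0r_neq0.
apply: cvgM; first exact: cvg_cst.
apply: (@continuous_max _ _ (fun s : R => 1 - s) (fun=> a ^+ 2) s); last exact: cvg_cst.
by apply: cvgB; [exact: cvg_cst|exact: cvg_id].
Qed.

Lemma calibE s : s <= k ^+ 2 ->
  calib s = s * Num.sqrt (2 * (k ^+ 2 - s)) / (4 * (1 - s)).
Proof. by move=> sk; rewrite /calib max_l// -ak; lra. Qed.

Definition calib_value := (k - k ^+ 3 / 3 - a * atan (k / a)) / Num.sqrt 2.

(** The substitution [t = (k^2 - s)^(1/2)] turns the integral of [calib] over [[0, k^2]] into that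
    of [t^2 (k^2 - t^2) / (a^2 + t^2) / sqrt 2] over [[0, k]], and this fraction is
    [1 - t^2 - a^2 / (a^2 + t^2)]; [F] is its antiderivative. *)
Lemma calib_antiderivative_value (G : R -> R) :
  (forall y, is_derive y (1 : R) G (calib y)) ->
  G (k ^+ 2) - G 0 = calib_value.
Proof.
move=> dG; have k20 : 0 < k ^+ 2 by rewrite exprn_gt0.
pose F t := t - t ^+ 3 / 3 - a * atan (t / a).
pose w s := Num.sqrt (k ^+ 2 - s).
pose H s := - F (w s) / Num.sqrt 2.
have s0 := @sqrt2_gt0 R.
have an0 := lt0r_neq0 a0.
have dF t : is_derive t (1 : R) F (1 - t ^+ 2 - (1 + (t / a) ^+ 2)^-1).
  have dl : is_derive t (1 : R) (fun t => t / a) (a^-1).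
    by apply: is_derive_eq; rewrite /GRing.scale/= mulr0 add0r mulr1.
  have da := @is_derive1_comp R atan (fun t => t / a) t _ _ (is_derive1_atan _) dl.
  have da' : is_derive t (1 : R) (fun t => atan (t / a)) ((1 + (t / a) ^+ 2)^-1 * a^-1) by [].
  rewrite /F; apply: is_derive_eq; rewrite /GRing.scale/=.
  have t1 : 1 + (t / a) ^+ 2 != 0 by rewrite lt0r_neq0// ltr_wpDr ?sqr_ge0.
  have t2 : a ^+ 2 + t ^+ 2 != 0 by rewrite lt0r_neq0// ltr_wpDr ?sqr_ge0.
  by field; rewrite an0 t2.
have dw s : s < k ^+ 2 -> is_derive s (1 : R) w ((2 * w s)^-1 * -1).
  move=> sk; apply: (@is_derive1_comp R Num.sqrt (fun s => k ^+ 2 - s)).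
    by apply: is_derive_sqrt; rewrite subr_gt0.
  by apply: is_derive_eq; ring.
have dH s : s < k ^+ 2 -> is_derive s (1 : R) H (calib s).
  move=> sk; have dws := dw s sk.
  have dFw := @is_derive1_comp R F w s _ _ (dF (w s)) dws.
  have dFw' : is_derive s (1 : R) (fun s => F (w s))
    ((1 - w s ^+ 2 - (1 + (w s / a) ^+ 2)^-1) * ((2 * w s)^-1 * -1)) by [].
  rewrite /H; apply: is_derive_eq; rewrite /GRing.scale/= calibE ?ltW//.
  have ws : 0 < w s by rewrite sqrtr_gt0 subr_gt0.
  have w2 : w s ^+ 2 = k ^+ 2 - s by rewrite sqr_sqrtr// subr_ge0 ltW.
  have -> : Num.sqrt (2 * (k ^+ 2 - s)) = 2 / Num.sqrt 2 * w s.
    rewrite sqrtrM// -/(w s); congr (_ * _).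
    by apply: (mulIf (lt0r_neq0 s0)); rewrite divfK ?lt0r_neq0// sqrt2K.
  have sE : s = k ^+ 2 - w s ^+ 2 by rewrite w2; ring.
  have sE1 : 1 - s = a ^+ 2 + w s ^+ 2 by rewrite w2 -ak; ring.
  rewrite sE1 !mulr0 add0r [X in _ = X * _ / _]sE.
  have aw : a ^+ 2 + w s ^+ 2 != 0 by rewrite lt0r_neq0// ltr_wpDr ?sqr_ge0.
  have k2 : k ^+ 2 = 1 - a ^+ 2 by rewrite -ak; ring.
  rewrite k2; field.
  by rewrite an0 aw !lt0r_neq0.
have cH : continuous H.
  move=> s; apply: cvgM; last exact: cvg_cst.
  apply: cvgN; apply: (@continuous_comp _ _ _ w F); last first.
    by apply/differentiable_continuous/derivable1_diffP; case: (dF (w s)).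
  apply: (@continuous_comp _ _ _ (fun s => k ^+ 2 - s) Num.sqrt).
    by apply: cvgB; [exact: cvg_cst|exact: cvg_id].
  exact: sqrt_continuous.
have cG : continuous G.
  move=> s; apply/differentiable_continuous/derivable1_diffP; by case: (dG s).
(* The chain rule through the square root stops before [k^2]; continuity of [H] at the endpoint is
   enough for the mean value theorem. *)
have dGH s : s \in `]0, (k ^+ 2)[ -> is_derive s (1 : R) (fun s => G s - H s) 0.
  rewrite in_itv/= => /andP[_ sk]; have dHs := dH s sk.
  by have := is_deriveB (dG s) dHs; rewrite subrr.
have cGH : {within `[0, k ^+ 2], continuous (fun s => G s - H s)}.
  by apply: continuous_subspaceT => s; apply: cvgB; [exact: cG|exact: cH].
have [c _] := MVT_segment (ltW k20) dGH cGH.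
rewrite mul0r => /eqP; rewrite subr_eq0 => /eqP.
have Hk : H (k ^+ 2) = 0.
  by rewrite /H /w subrr sqrtr0 /F mul0r atan0 expr0n/=; ring.
have H0 : H 0 = - calib_value.
  by rewrite /H /w subr0 sqrtr_sqr gtr0_norm// /F /calib_value mulNr.
by rewrite Hk H0 => h; rewrite -[G 0](addrK (- - calib_value)) -h; ring.
Qed.

End Calibration.

Section Excess.
Context {R : realType}.
Local Notation mu := (@lebesgue_measure R).
Variables (a k : R) (eta deta psi : R -> R).
Hypothesis a0 : 0 < a.
Hypothesis k0 : 0 < k.
Hypothesis ak : a ^+ 2 + k ^+ 2 = 1.
Hypothesis peta : primitive eta deta.
Hypothesis lpsi : locL1 psi.

(* The energy density of a map with 1 - |v|^2 = eta and phase derivative psi. *)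
Definition hdens x := deta x ^+ 2 / (8 * (1 - eta x))
  + (1 - eta x) * psi x ^+ 2 / 2 + eta x ^+ 2 / 4.
(* On the soliton, [slip] vanishes, [defect_r] vanishes for x >= 0 and
   [defect_l] for x <= 0. *)
Definition slip x := psi x - a / Num.sqrt 2 * eta x / (1 - eta x).
Definition defect_r x := deta x + eta x * Num.sqrt (2 * (k ^+ 2 - eta x)).
Definition defect_l x := deta x - eta x * Num.sqrt (2 * (k ^+ 2 - eta x)).

Hypothesis hi : mu.-integrable setT (EFin \o hdens).
Hypothesis eta_low : forall x, -15 <= eta x.
Hypothesis eta_hi : forall x, eta x <= k ^+ 2.
Hypothesis eta_at0 : eta 0 = k ^+ 2.

Let E := \int[mu]_x hdens x.
Let M := 2^-1 * \int[mu]_x (eta x * psi x).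
Definition excess := E - Num.sqrt 2 * a * M - 2 * calib_value a k.

Let a20 : 0 < a ^+ 2. Proof. by rewrite exprn_gt0. Qed.

Let rho x : a ^+ 2 <= 1 - eta x.
Proof. by have := eta_hi x; rewrite -ak; lra. Qed.

Let rho0 x : 0 < 1 - eta x. Proof. exact: lt_le_trans (rho x). Qed.

Let rho16 x : 1 - eta x <= 16. Proof. by have := eta_low x; lra. Qed.

Let s0 := @sqrt2_gt0 R.

Let ceta := primitive_continuous peta.

Lemma sqr_eta_le x : eta x ^+ 2 <= 4 * hdens x.
Proof.
have h1 : 0 <= deta x ^+ 2 / (8 * (1 - eta x)).
  by rewrite divr_ge0 ?sqr_ge0// mulr_ge0// ltW.
have h2 : 0 <= (1 - eta x) * psi x ^+ 2 / 2.
  by rewrite divr_ge0// mulr_ge0 ?sqr_ge0// ltW.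
by rewrite /hdens; lra.
Qed.

(** 128 is [8 * 16], from [1 - eta <= 16]. *)
Lemma sqr_deta_le x : deta x ^+ 2 <= 128 * hdens x.
Proof.
have h1 : deta x ^+ 2 / 128 <= deta x ^+ 2 / (8 * (1 - eta x)).
  rewrite ler_wpM2l ?sqr_ge0// lef_pV2 ?posrE//; last by rewrite mulr_gt0.
  by have := rho16 x; lra.
have h2 : 0 <= (1 - eta x) * psi x ^+ 2 / 2.
  by rewrite divr_ge0// mulr_ge0 ?sqr_ge0// ltW.
by rewrite /hdens; have := sqr_ge0 (eta x); lra.
Qed.

Lemma sqr_psi_le x : psi x ^+ 2 <= 2 / a ^+ 2 * hdens x.
Proof.
have h1 : 0 <= deta x ^+ 2 / (8 * (1 - eta x)).
  by rewrite divr_ge0 ?sqr_ge0// mulr_ge0// ltW.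
rewrite mulrAC ler_pdivlMr//.
have : psi x ^+ 2 * a ^+ 2 <= psi x ^+ 2 * (1 - eta x).
  by rewrite ler_wpM2l ?sqr_ge0.
by rewrite /hdens; have := sqr_ge0 (eta x); lra.
Qed.

Lemma hdens_ge0 x : 0 <= hdens x.
Proof. by have := sqr_eta_le x; have := sqr_ge0 (eta x); lra. Qed.

Let lh : locL1 hdens := locL1_integrable hi.

Let leta_psi : locL1 (fun x => eta x * psi x).
Proof. exact: locL1M. Qed.

Lemma eta_psi_integrable : mu.-integrable setT (EFin \o (fun x => eta x * psi x)).
Proof.
pose C := 2 + (a ^+ 2)^-1.
have ig : mu.-integrable setT (EFin \o (fun x => C * hdens x)).
  exact: (integrableZl measurableT C hi).
apply: (le_integrable_ge0 _ ig) => [|x]; first by case: leta_psi.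
have := sqr_eta_le x; have := sqr_psi_le x.
have := sqr_ge0 (eta x - psi x); have := sqr_ge0 (eta x + psi x).
by rewrite /C ler_norml => *; apply/andP; split; lra.
Qed.

(** The density of [E - sqrt 2 * a * M]. Adding or subtracting the exact derivative
    [calib (eta) * deta] turns it into a sum of squares. *)
Definition wdens x := hdens x - a / Num.sqrt 2 * (eta x * psi x).

Let lw : locL1 wdens.
Proof. by apply: locL1B => //; exact: locL1Z. Qed.

(** Expanding the right side leaves [h^2 * (S^2 + 4 b^2) / (8 r)], which the hypothesis reduces to
    [h^2 / 4]. It is used with [r = 1 - eta], [b = a / sqrt 2] and
    [S = + or - (2 (k^2 - eta))^(1/2)]. *)
Lemma square_completion (b r S d t h : R) : r != 0 -> S ^+ 2 + 4 * b ^+ 2 = 2 * r :> R ->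
  d ^+ 2 / (8 * r) + r * t ^+ 2 / 2 + h ^+ 2 / 4 - b * (h * t) + h * S / (4 * r) * d =
  r * (t - b * h / r) ^+ 2 / 2 + (d + h * S) ^+ 2 / (8 * r).
Proof.
move=> r0 Sb.
have -> : r * (t - b * h / r) ^+ 2 / 2 =
    r * t ^+ 2 / 2 - b * (h * t) + b ^+ 2 * h ^+ 2 / (2 * r) by field.
have -> : (d + h * S) ^+ 2 / (8 * r) =
    d ^+ 2 / (8 * r) + h * S / (4 * r) * d + h ^+ 2 * S ^+ 2 / (8 * r) by field.
have : h ^+ 2 * (S ^+ 2 + 4 * b ^+ 2 - 2 * r) / (8 * r) =
    h ^+ 2 * S ^+ 2 / (8 * r) + b ^+ 2 * h ^+ 2 / (2 * r) - h ^+ 2 / 4 by field.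
rewrite Sb subrr mulr0 mul0r => /esym/eqP; rewrite subr_eq0 => /eqP <-.
by ring.
Qed.

Let completion_cond x :
  Num.sqrt (2 * (k ^+ 2 - eta x)) ^+ 2 + 4 * (a / Num.sqrt 2) ^+ 2 = 2 * (1 - eta x).
Proof.
have k2 : k ^+ 2 = 1 - a ^+ 2 by rewrite -ak; ring.
by rewrite sqr_sqrtr ?mulr_ge0 ?subr_ge0// expr_div_n sqr_sqrtr// k2; field.
Qed.

Lemma defect_rE x : wdens x + calib a k (eta x) * deta x =
  (1 - eta x) * slip x ^+ 2 / 2 + defect_r x ^+ 2 / (8 * (1 - eta x)).
Proof.
rewrite calibE// /wdens /hdens /slip /defect_r.
by rewrite -(square_completion _ _ _ (lt0r_neq0 (rho0 x)) (completion_cond x)).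
Qed.

Lemma defect_lE x : wdens x - calib a k (eta x) * deta x =
  (1 - eta x) * slip x ^+ 2 / 2 + defect_l x ^+ 2 / (8 * (1 - eta x)).
Proof.
rewrite calibE// /wdens /hdens /slip /defect_l.
have := completion_cond x; rewrite -[X in X + _ = _ -> _]sqrrN => H.
have := square_completion (deta x) (psi x) (eta x) (lt0r_neq0 (rho0 x)) H.
by rewrite mulrN !mulNr => <-.
Qed.

Let slip_part_ge0 x : 0 <= (1 - eta x) * slip x ^+ 2 / 2.
Proof. by rewrite divr_ge0// mulr_ge0 ?sqr_ge0// ltW. Qed.

Let defect_part_ge x d : d ^+ 2 / 128 <= d ^+ 2 / (8 * (1 - eta x)).
Proof.
rewrite ler_wpM2l ?sqr_ge0// lef_pV2 ?posrE//; last by rewrite mulr_gt0.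
by have := rho16 x; lra.
Qed.

Let lcal : locL1 (fun x => calib a k (eta x) * deta x).
Proof.
apply: locL1M; last exact: primitive_locL1 peta.
move=> x; apply: (@continuous_comp _ _ _ eta (calib a k)); first exact: ceta.
exact: continuous_calib.
Qed.

Let lr : locL1 (fun x => wdens x + calib a k (eta x) * deta x).
Proof. exact: locL1D. Qed.

Let ll : locL1 (fun x => wdens x - calib a k (eta x) * deta x).
Proof. exact: locL1B. Qed.

Let r_ge0 x : 0 <= wdens x + calib a k (eta x) * deta x.
Proof.
rewrite defect_rE; have := slip_part_ge0 x; have := defect_part_ge x (defect_r x).
by have := sqr_ge0 (defect_r x); lra.
Qed.

Let l_ge0 x : 0 <= wdens x - calib a k (eta x) * deta x.
Proof.
rewrite defect_lE; have := slip_part_ge0 x; have := defect_part_ge x (defect_l x).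
by have := sqr_ge0 (defect_l x); lra.
Qed.

Lemma wdens_ge0 x : 0 <= wdens x.
Proof. by have := r_ge0 x; have := l_ge0 x; lra. Qed.

Lemma wdens_integrable : mu.-integrable setT (EFin \o wdens).
Proof.
have := integrableZl measurableT (a / Num.sqrt 2) eta_psi_integrable.
exact: (integrableB measurableT hi).
Qed.

Lemma Rint_wdens : \int[mu]_x wdens x = E - Num.sqrt 2 * a * M.
Proof.
rewrite RintegralB//; last exact: (integrableZl measurableT _ eta_psi_integrable).
rewrite RintegralZl//; last exact: eta_psi_integrable.
rewrite /M -/E; congr (_ - _); rewrite mulrA; congr (_ * _).
apply: (mulIf (lt0r_neq0 s0)); rewrite divfK ?lt0r_neq0//.
have -> : Num.sqrt 2 * a * 2^-1 * Num.sqrt 2 = a * (Num.sqrt 2 * Num.sqrt 2) / 2 by ring.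
by rewrite sqrt2K mulfK.
Qed.

Lemma small_eta_hydro (e b : R) : 0 < e ->
  (exists2 y, b <= y & `|eta y| < e) /\ (exists2 y, y <= b & `|eta y| < e).
Proof.
move=> e0; have e20 : 0 < 4^-1 * e ^+ 2 by rewrite mulr_gt0// exprn_gt0.
have H y : hdens y < 4^-1 * e ^+ 2 -> `|eta y| < e.
  move=> h; rewrite -(@ltr_pXn2r _ 2) ?nnegrE ?normr_ge0 ?ltW//.
  rewrite real_normK ?num_real//; have := sqr_eta_le y; lra.
have [[y y1 y2] [z z1 z2]] := small_value b hi hdens_ge0 e20.
by split; [exists y|exists z] => //; exact: H.
Qed.

(* Integrating the calibration identity on both sides of the maximum of eta. *)
Lemma excess_bound L : 0 <= L ->
  \int[mu]_(x in `[0, L]) (wdens x + calib a k (eta x) * deta x) +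
  \int[mu]_(x in `[- L, 0]) (wdens x - calib a k (eta x) * deta x) <= excess.
Proof.
move=> L0; have [G dG] := continuous_antiderivative (continuous_calib (k := k) a0).
have Gv := calib_antiderivative_value a0 k0 ak dG.
have pG : primitive (fun x => G (eta x)) (fun x => calib a k (eta x) * deta x).
  apply: (primitive_comp (h' := calib a k) peta) => x.
  apply: (@continuous_comp _ _ _ eta (calib a k)).
    exact: ceta.
  exact: continuous_calib.
apply/ler_addgt0Pr => e e0.
have e20 : 0 < e / 2 by rewrite divr_gt0.
have [d d0 Hd] : exists2 d, 0 < d & forall s, `|s| < d -> `|G 0 - G s| < e / 2.
  have cG0 : {for 0, continuous G}.
    by apply/differentiable_continuous/derivable1_diffP; case: (dG 0).
  have /cvgrPdist_lt/(_ _ e20) := cG0.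
  rewrite nearE => /nbhs_ballP[d /= d0 Hd]; exists d => // s sd.
  by apply: Hd; rewrite /ball/= sub0r normrN.
(* The integrals are cut at points [y] and [z] beyond [L] where [eta] is so small that [G (eta)] is
   within [e / 2] of [G 0]; the integrands being nonnegative, enlarging [[- L, L]] only increases
   the left side. *)
have [[y Ly hy] _] := small_eta_hydro L d0.
have [_ [z zL hz]] := small_eta_hydro (- L) d0.
have L0' : - L <= 0 by rewrite oppr_le0.
have := itv_int_sub lr r_ge0 (lexx 0) L0 Ly.
rewrite [X in _ <= X -> _](itv_intD _ _ lw lcal) (primitiveE pG (le_trans L0 Ly)).
have := itv_int_sub ll l_ge0 zL L0' (lexx 0).
rewrite [X in _ <= X -> _](itv_intB _ _ lw lcal) (primitiveE pG (le_trans zL L0')).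
have := Rint_itv_le z y wdens_integrable wdens_ge0.
rewrite (itv_int_split lw (le_trans zL L0') (le_trans L0 Ly)) Rint_wdens.
rewrite eta_at0 /excess -Gv.
have := Hd _ hy; have := Hd _ hz; rewrite !ltr_norml => /andP[? ?] /andP[? ?].
lra.
Qed.

Let continuous_defect : continuous (fun x => eta x * Num.sqrt (2 * (k ^+ 2 - eta x))).
Proof.
move=> x; apply: cvgM; first exact: ceta.
apply: (@continuous_comp _ _ _ (fun x => 2 * (k ^+ 2 - eta x)) Num.sqrt).
  apply: cvgM; first exact: cvg_cst.
  by apply: cvgB; [exact: cvg_cst|exact: ceta].
exact: sqrt_continuous.
Qed.

Let defect_r_le x : defect_r x ^+ 2 <= 128 * (wdens x + calib a k (eta x) * deta x).
Proof.
rewrite defect_rE; have := slip_part_ge0 x; have := defect_part_ge x (defect_r x).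
lra.
Qed.

Let defect_l_le x : defect_l x ^+ 2 <= 128 * (wdens x - calib a k (eta x) * deta x).
Proof.
rewrite defect_lE; have := slip_part_ge0 x; have := defect_part_ge x (defect_l x).
lra.
Qed.

Lemma locL1_defect_r : locL1 (fun x => defect_r x ^+ 2).
Proof.
apply: (@locL1_le _ _ (fun x => 128 * (wdens x + calib a k (eta x) * deta x))).
- apply: measurable_funX; apply: measurable_funD; last exact: continuous_meas.
  by case: (primitive_locL1 peta).
- by move=> x; rewrite ger0_norm ?sqr_ge0.
- exact: locL1Z.
Qed.

Lemma locL1_defect_l : locL1 (fun x => defect_l x ^+ 2).
Proof.
apply: (@locL1_le _ _ (fun x => 128 * (wdens x - calib a k (eta x) * deta x))).
- apply: measurable_funX; apply: measurable_funB; last exact: continuous_meas.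
  by case: (primitive_locL1 peta).
- by move=> x; rewrite ger0_norm ?sqr_ge0.
- exact: locL1Z.
Qed.

Lemma excess_defect_r L : 0 <= L -> \int[mu]_(x in `[0, L]) defect_r x ^+ 2 <= 128 * excess.
Proof.
move=> L0; have := excess_bound L0.
have : 0 <= \int[mu]_(x in `[- L, 0]) (wdens x - calib a k (eta x) * deta x).
  by apply: itv_int_ge0 => x _; exact: l_ge0.
have : \int[mu]_(x in `[0, L]) defect_r x ^+ 2 <=
       128 * \int[mu]_(x in `[0, L]) (wdens x + calib a k (eta x) * deta x).
  rewrite -itv_intZ//; apply: itv_int_le => //; first exact: locL1_defect_r.
  exact: locL1Z.
lra.
Qed.

Lemma excess_defect_l L : 0 <= L -> \int[mu]_(x in `[- L, 0]) defect_l x ^+ 2 <= 128 * excess.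
Proof.
move=> L0; have := excess_bound L0.
have : 0 <= \int[mu]_(x in `[0, L]) (wdens x + calib a k (eta x) * deta x).
  by apply: itv_int_ge0 => x _; exact: r_ge0.
have : \int[mu]_(x in `[- L, 0]) defect_l x ^+ 2 <=
       128 * \int[mu]_(x in `[- L, 0]) (wdens x - calib a k (eta x) * deta x).
  rewrite -itv_intZ//; apply: itv_int_le => //; first exact: locL1_defect_l.
  exact: locL1Z.
lra.
Qed.

Lemma slip_meas : measurable_fun setT slip.
Proof.
apply: measurable_funB; first by case: lpsi.
apply: continuous_meas => x; apply: cvgM.
  by apply: cvgM; [exact: cvg_cst|exact: ceta].
apply: cvgV; first exact: lt0r_neq0.
by apply: cvgB; [exact: cvg_cst|exact: ceta].
Qed.

Let slip_le x d : slip x ^+ 2 <=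
  2 / a ^+ 2 * ((1 - eta x) * slip x ^+ 2 / 2 + d ^+ 2 / (8 * (1 - eta x))).
Proof.
have h1 : 0 <= d ^+ 2 / (8 * (1 - eta x)).
  by rewrite divr_ge0 ?sqr_ge0// mulr_ge0// ltW.
have : slip x ^+ 2 * a ^+ 2 <= slip x ^+ 2 * (1 - eta x).
  by rewrite ler_wpM2l ?sqr_ge0.
move=> hsl; have aa := lt0r_neq0 a0; rewrite -(ler_pM2r a20).
have -> (Z : R) : 2 / a ^+ 2 * Z * a ^+ 2 = 2 * Z by field.
lra.
Qed.

Lemma locL1_slip : locL1 (fun x => slip x ^+ 2).
Proof.
apply: (@locL1_le _ _ (fun x => 2 / a ^+ 2 * (wdens x + calib a k (eta x) * deta x))).
- exact: measurable_funX slip_meas.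
- by move=> x; rewrite ger0_norm ?sqr_ge0// defect_rE; exact: slip_le.
- exact: locL1Z.
Qed.

Lemma excess_slip L : 0 <= L ->
  \int[mu]_(x in `[- L, L]) slip x ^+ 2 <= 2 / a ^+ 2 * excess.
Proof.
move=> L0; have L0' : - L <= 0 by rewrite oppr_le0.
rewrite (itv_int_split locL1_slip L0' L0).
apply: (@le_trans _ _ (2 / a ^+ 2 * (
  \int[mu]_(x in `[0, L]) (wdens x + calib a k (eta x) * deta x) +
  \int[mu]_(x in `[- L, 0]) (wdens x - calib a k (eta x) * deta x)))); last first.
  by rewrite ler_pM2l ?divr_gt0//; exact: excess_bound.
rewrite mulrDr addrC -!itv_intZ//; apply: lerD; apply: itv_int_le => //.
- exact: locL1_slip.
- exact: locL1Z.
- by move=> x _; rewrite defect_rE; exact: slip_le.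
- exact: locL1_slip.
- exact: locL1Z.
- by move=> x _; rewrite defect_lE; exact: slip_le.
Qed.

Lemma excess_ge0 : 0 <= excess.
Proof.
apply: le_trans (excess_bound (lexx 0)); rewrite addr_ge0//.
  by apply: itv_int_ge0 => x _; exact: r_ge0.
by apply: itv_int_ge0 => x _; exact: l_ge0.
Qed.

End Excess.

(** * Perturbations of the soliton in hydrodynamical variables *)

Section Comparison.
Context {R : realType}.
Local Notation mu := (@lebesgue_measure R).
Implicit Types (k kap eps d L t x : R) (eta deta : R -> R).

(* The equation eta' = - eta (2 (kap^2 - eta))^(1/2) is not Lipschitz at the
   maximum; y = (kap^2 - eta + eps^2)^(1/2) is compared to the solution
   profile k of Y' = (k^2 - Y^2) / sqrt 2. *)
Lemma comparison_quantitative k kap eps d L eta deta x :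
  0 < k -> k <= 1 -> 0 < kap -> kap <= 1 -> 0 < eps -> eps <= 1 ->
  primitive eta deta -> (forall x, -15 <= eta x) ->
  (forall x, eta x <= kap ^+ 2) -> eta 0 = kap ^+ 2 -> `|kap - k| <= d ->
  locL1 (fun x => defect_r kap eta deta x ^+ 2) ->
  (forall L, 0 <= L -> \int[mu]_(x in `[0, L]) defect_r kap eta deta x ^+ 2 <= d) ->
  0 <= x -> x <= L ->
  Num.max (Num.sqrt (kap ^+ 2 + eps ^+ 2 - eta x) - profile k x) 0 ^+ 2 <=
  eps ^+ 2 + 10 * (L * (2 * d + 7 * eps) + d / (4 * eps ^+ 3)).
Proof.
move=> k0 k1 kap0 kap1 e0 e1 peta elow ehi eta0 kd lQ Qd x0 xL.
set C := kap ^+ 2 + eps ^+ 2.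
have e20 : 0 < eps ^+ 2 by rewrite exprn_gt0.
have e30 : 0 < eps ^+ 3 by rewrite exprn_gt0.
pose y s := Num.sqrt (C - eta s).
have Ce s : eps ^+ 2 <= C - eta s by have := ehi s; rewrite /C; lra.
have Ce0 s : 0 < C - eta s by exact: lt_le_trans (Ce s).
have ceta := primitive_continuous peta.
have y0 s : 0 < y s by rewrite sqrtr_gt0.
have y2 s : y s ^+ 2 = C - eta s by rewrite sqr_sqrtr// ltW.
have ye s : eps <= y s.
  by rewrite -(@ler_pXn2r _ 2) ?nnegrE ?(ltW (y0 s)) ?(ltW e0)// y2.
have kap2 : kap ^+ 2 <= 1 by rewrite expr_le1// ltW.
have eps2 : eps ^+ 2 <= 1 by rewrite expr_le1// ltW.
have y5 s : y s <= 5.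
  rewrite -(@ler_pXn2r _ 2) ?nnegrE ?(ltW (y0 s))// y2 /C.
  by have := elow s; lra.
have cy : continuous y.
  move=> s; apply: (@continuous_comp _ _ _ (fun s => C - eta s) Num.sqrt).
    by apply: cvgB; [exact: cvg_cst|exact: ceta].
  exact: sqrt_continuous.
have py : primitive y (fun s => (2 * y s)^-1 * -1 * deta s).
  apply: (@primitive_comp _ (fun s => Num.sqrt (C - s))
    (fun s => (2 * Num.sqrt (C - s))^-1 * -1)) => [|s|s]; first exact: peta.
    apply: (@is_derive1_comp R Num.sqrt (fun s => C - s)).
      by apply: is_derive_sqrt.
    by apply: is_derive_eq; ring.
  apply: cvgM; last exact: cvg_cst.
  apply: cvgV; first by rewrite mulf_neq0// lt0r_neq0// y0.
  by apply: cvgM; [exact: cvg_cst|exact: cy].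
pose D s := y s - profile k s.
pose dD s := (2 * y s)^-1 * -1 * deta s - profile_eta k s / Num.sqrt 2.
have pD : primitive D dD by exact: primitiveB py (primitive_profile k).
have cD := primitive_continuous pD.
(* Only the positive part of [D = y - profile k] is followed. Its square is C^1 along the flow and
   starts from [eps^2], since [y 0 = eps]. *)
pose h (s : R) := Num.max s 0 ^+ 2.
have ph : primitive (fun s => h (D s)) (fun s => 2 * Num.max (D s) 0 * dD s).
  apply: (@primitive_comp _ h (fun s : R => 2 * Num.max s 0)) => [|s|s]; first exact: pD.
    exact: is_derive_sqr_pos.
  apply: cvgM; first exact: cvg_cst.
  apply: (@continuous_comp _ _ _ D (fun s : R => Num.max s 0)).
    exact: cD.
  exact: continuous_pos.
pose Q := defect_r kap eta deta.
(* 10 is [2 * 5]: the positive part of [D] is at most 5, because [y^2 <= 2 + 15]. *)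
pose K s := 10 * ((2 * d + 7 * eps) + Q s ^+ 2 / (4 * eps ^+ 3)).
have d0 : 0 <= d by exact: le_trans kd.
have kk2 : `|kap ^+ 2 - k ^+ 2| <= 2 * d.
  rewrite subr_sqr normrM mulrC; apply: ler_pM => //.
  by rewrite gtr0_norm ?addr_gt0//; lra.
have lK : locL1 K.
  apply: locL1Z; apply: locL1D; first exact: locL1_cst.
  by under eq_fun do rewrite mulrC; exact: locL1Z.
have s0 := @sqrt2_gt0 R.
have s1 : 1 <= Num.sqrt 2 :> R.
  by rewrite -(@ler_pXn2r _ 2) ?nnegrE ?sqrtr_ge0 ?sqr_sqrtr// expr1n; lra.
have point s : 0 <= s <= x -> 2 * Num.max (D s) 0 * dD s <= K s.
  move=> /andP[ss _].
  have Qs : 0 <= Q s ^+ 2 / (4 * eps ^+ 3) by rewrite divr_ge0 ?sqr_ge0 ?mulr_ge0// ltW.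
  have K0 : 0 <= K s by rewrite /K; lra.
  have [D0|D0] := leP (D s) 0; first by rewrite mulr0 mul0r.
  have Y0 := profile_ge0 (ltW k0) ss.
  have D5 : D s <= 5 by rewrite /D; have := y5 s; lra.
  suff dDK : dD s <= (2 * d + 7 * eps) + Q s ^+ 2 / (4 * eps ^+ 3).
    rewrite /K; nra.
  have ys := y0 s; have yn := lt0r_neq0 ys; have sn := lt0r_neq0 s0.
  pose r := Num.sqrt (kap ^+ 2 - eta s).
  have r0 : 0 <= r by rewrite sqrtr_ge0.
  have r2 : r ^+ 2 = y s ^+ 2 - eps ^+ 2.
    by rewrite sqr_sqrtr ?subr_ge0// y2 /C; ring.
  have ys' := ltW ys; have e0' := ltW e0.
  have ry : r <= y s.
    by rewrite -(@ler_pXn2r _ 2) ?nnegrE// r2; move: e20; clear; lra.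
  have yr : y s - r <= eps.
    rewrite -(@ler_pXn2r _ 2) ?nnegrE ?subr_ge0//.
    have -> : eps ^+ 2 = y s ^+ 2 - r ^+ 2 by rewrite r2; ring.
    nra.
  have QE : deta s = Q s - eta s * (Num.sqrt 2 * r).
    by rewrite /Q /defect_r sqrtrM// -/r; ring.
  have etar : eta s * r / y s <= eta s + 5 * eps.
    rewrite ler_pdivrMr//; have y5s := y5 s.
    have [h0|h0] := leP 0 (eta s); first by move: h0 ry ys' e0'; clear; nra.
    have hy : - eta s <= y s ^+ 2.
      by rewrite y2 /C; have := sqr_ge0 kap; move: e20; clear; lra.
    have h1 : eta s * r <= eta s * (y s - eps).
      by rewrite ler_wnM2l ?(ltW h0)//; move: yr; clear; lra.
    have h2 : - eta s * eps <= y s ^+ 2 * eps by rewrite ler_wpM2r.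
    have h3 : y s * (y s * eps) <= 5 * (y s * eps) by rewrite ler_wpM2r// mulr_ge0.
    by move: h1 h2 h3; clear; lra.
  have dDE : dD s = (eta s * r / y s - profile_eta k s) / Num.sqrt 2 - Q s / (2 * y s).
    rewrite /dD QE.
    have s2 : Num.sqrt 2 / 2 = (Num.sqrt 2)^-1 :> R.
      by apply: (mulfI sn); rewrite mulrA sqrt2K !divff.
    have -> : (2 * y s)^-1 * -1 * (Q s - eta s * (Num.sqrt 2 * r)) =
      eta s * r / y s * (Num.sqrt 2 / 2) - Q s / (2 * y s) by field.
    by rewrite s2; ring.
  (* That is, [profile k s ^ 2 <= y s ^ 2] where [D > 0]: the right side of the equation decreases
     in the unknown, so a positive gap is not amplified and no Gronwall factor appears. *)
  have DY : profile_eta k s + y s ^+ 2 - k ^+ 2 >= 0.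
    by rewrite /profile_eta; move: D0 Y0; rewrite /D; clear; nra.
  have part1 : (eta s * r / y s - profile_eta k s) / Num.sqrt 2 <= 2 * d + 6 * eps.
    have num : eta s * r / y s - profile_eta k s <= 2 * d + 6 * eps.
      have : eta s = C - y s ^+ 2 by rewrite y2; ring.
      have : eps ^+ 2 <= eps by move: e0 e1; clear; nra.
      by move: kk2 DY etar e0'; rewrite ler_norml /C => /andP[_ +]; clear; lra.
    by rewrite ler_pdivrMr// (le_trans num)// ler_peMr//; move: d0 e0'; clear; lra.
  (* Young's inequality with weight [eps^3]: the remaining term [eps^3 / (4 y^2)] is at most [eps]
     because [y >= eps]. *)
  have part2 : - (Q s / (2 * y s)) <= eps + Q s ^+ 2 / (4 * eps ^+ 3).
    pose z := (y s)^-1.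
    have z0 : 0 < z by rewrite invr_gt0.
    have zy : y s * z = 1 by rewrite divff.
    have ze : eps * z <= 1 by rewrite -zy ler_pM2r.
    have -> : Q s / (2 * y s) = Q s * z / 2 by rewrite /z; field.
    rewrite -lerBlDl ler_pdivlMr ?mulr_gt0//.
    have := sqr_ge0 (Q s + eps ^+ 3 * z).
    have ez0 : 0 <= eps * z by rewrite mulr_ge0// ltW.
    have ezz : eps * z * (eps * z) <= 1 by rewrite mulr_ile1.
    have e4 : 0 <= eps * eps ^+ 3 by rewrite mulr_ge0// ltW.
    have : eps * eps ^+ 3 * (eps * z * (eps * z)) <= eps * eps ^+ 3 by rewrite ler_piMr.
    have -> : (Q s + eps ^+ 3 * z) ^+ 2 = Q s ^+ 2 + 2 * eps ^+ 3 * z * Q s +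
      eps * eps ^+ 3 * (eps * z * (eps * z)) by ring.
    by move: e4; clear; lra.
  by rewrite dDE; move: part1 part2; clear; lra.
have := itv_int_le (primitive_locL1 ph) lK point.
rewrite (primitiveE ph x0).
have -> : h (D 0) = eps ^+ 2.
  rewrite /h /D profile0 subr0 max_l ?ltW//.
  by rewrite y2 /C eta0; ring.
rewrite -/C -/(y x) -/(D x) -/(h (D x)) lerBlDl => H; apply: (le_trans H).
have lQ3 : locL1 (fun s => Q s ^+ 2 / (4 * eps ^+ 3)).
  by under eq_fun do rewrite mulrC; exact: locL1Z.
rewrite lerD2l /K itv_intZ; last by apply: locL1D => //; exact: locL1_cst.
rewrite ler_pM2l// itv_intD//; last exact: locL1_cst.
rewrite itv_int_cst// subr0 lerD//.
  by rewrite mulrC ler_pM2r// ltr_pwDr// ?mulr_ge0// mulr_gt0.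
under [X in X <= _]eq_Rintegral do rewrite mulrC.
rewrite itv_intZ// mulrC ler_pM2r ?invr_gt0 ?mulr_gt0//.
exact: Qd.
Qed.

End Comparison.

Section NearSoliton.
Context {R : realType}.
Local Notation mu := (@lebesgue_measure R).

Definition soliton_momentum (a k : R) := atan (k / a) - a * k.

(* [d] bounds the calibration excess, the defect of momentum and the distance
   of (b, kap) to the parameters (a, k) of the soliton. *)
Record near_soliton (a k d b kap : R) (eta deta psi : R -> R) : Prop := {
  ns_b0 : 0 < b;
  ns_kap0 : 0 < kap;
  ns_bkap : b ^+ 2 + kap ^+ 2 = 1;
  ns_peta : primitive eta deta;
  ns_lpsi : locL1 psi;
  ns_int : mu.-integrable setT (EFin \o hdens eta deta psi);
  ns_E : \int[mu]_x hdens eta deta psi x <= 1;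
  ns_low : forall x, -15 <= eta x;
  ns_hi : forall x, eta x <= kap ^+ 2;
  ns_at0 : eta 0 = kap ^+ 2;
  ns_excess : excess b kap eta deta psi <= d;
  ns_kap : `|kap - k| <= d;
  ns_b : `|b - a| <= d;
  ns_mom : `|2^-1 * \int[mu]_x (eta x * psi x) - soliton_momentum a k| <= d }.

Lemma near0_mul (C s : R) : 0 < s -> \forall d \near (0 : R)^'+, d * C <= s.
Proof.
move=> s0; near=> d.
have d0 : 0 < d by near: d; exact: nbhs_right_gt.
have C1 : 0 < `|C| + 1 by rewrite ltr_wpDl.
have : d <= s / (`|C| + 1) by near: d; apply: nbhs_right_ltW; rewrite divr_gt0.
rewrite ler_pdivlMr//; apply: le_trans; rewrite ler_pM2l//.
by have := ler_norm C; lra.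
Unshelve. all: by end_near. Qed.

Variables a k : R.
Hypothesis a0 : 0 < a.
Hypothesis k0 : 0 < k.
Hypothesis ak : a ^+ 2 + k ^+ 2 = 1.

Let sqr_le1 (x y : R) : 0 < x -> 0 < y -> x ^+ 2 + y ^+ 2 = 1 -> x <= 1.
Proof. by move=> x0 y0 xy; have := sqr_ge0 y; nra. Qed.

Let k1 : k <= 1. Proof. by apply: (sqr_le1 k0 a0); rewrite addrC. Qed.
Let a1 : a <= 1. Proof. exact: (sqr_le1 a0 k0). Qed.

Lemma ns_b_lower : \forall d \near (0 : R)^'+, forall b kap eta deta psi,
  near_soliton a k d b kap eta deta psi -> a / 2 <= b.
Proof.
have a20 : 0 < a / 2 by rewrite divr_gt0.
apply: filterS (near0_mul 1 a20) => d da b kap eta deta psi.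
by move=> /ns_b; rewrite ler_norml => /andP[? ?]; lra.
Qed.

Let sqr_dist (x y d : R) : 0 < x -> x <= 1 -> 0 < y -> y <= 1 -> `|x - y| <= d ->
  `|x ^+ 2 - y ^+ 2| <= 2 * d.
Proof.
move=> x0 x1 y0 y1 xy; rewrite subr_sqr normrM mulrC; apply: ler_pM => //.
by rewrite gtr0_norm ?addr_gt0//; lra.
Qed.

Lemma comparison_right L t : 0 <= L -> 0 < t ->
  \forall d \near (0 : R)^'+, forall kap eta deta,
  0 < kap -> kap <= 1 -> primitive eta deta -> (forall x, -15 <= eta x) ->
  (forall x, eta x <= kap ^+ 2) -> eta 0 = kap ^+ 2 -> `|kap - k| <= d ->
  locL1 (fun x => defect_r kap eta deta x ^+ 2) ->
  (forall L, 0 <= L -> \int[mu]_(x in `[0, L]) defect_r kap eta deta x ^+ 2 <= d) ->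
  forall x, 0 <= x -> x <= L -> profile_eta k x - eta x <= t.
Proof.
(* Since [y + profile k x <= 6], a bound [t / 12] on the positive part of [y - profile k x] costs
   [t / 2]; the other half of [t] absorbs [k^2 - kap^2]. *)
move=> L0 t0; pose T := (t / 12) ^+ 2.
have T0 : 0 < T by rewrite exprn_gt0// divr_gt0.
have c0 : 0 < 1 + 70 * L by lra.
(* [eps] depends on [t] and [L] only and is fixed before [d], so that [d / eps^3] can still be made
   small. *)
pose eps := Num.min 1 (T / 2 / (1 + 70 * L)).
have e0 : 0 < eps by rewrite lt_min ltr01 !divr_gt0.
have e1 : eps <= 1 by rewrite ge_min lexx.
have eT : eps * (1 + 70 * L) <= T / 2 by rewrite -ler_pdivlMr// ge_min lexx orbT.
have e30 : 0 < eps ^+ 3 by rewrite exprn_gt0.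
have T20 : 0 < T / 2 by rewrite divr_gt0.
have t40 : 0 < t / 4 by rewrite divr_gt0.
have N1 := near0_mul (20 * L + 10 / (4 * eps ^+ 3)) T20.
apply: filterS2 N1 (near0_mul 1 t40) => d d1 d2 kap eta deta kap0 kap1 peta elow ehi eta0 kd lQ Qd x x0 xL.
have := comparison_quantitative k0 k1 kap0 kap1 e0 e1 peta elow ehi eta0 kd lQ Qd x0 xL.
set y := Num.sqrt _; set m := Num.max _ 0 => H.
have y0 : 0 <= y by rewrite sqrtr_ge0.
have e20 : 0 < eps ^+ 2 by rewrite exprn_gt0.
have ee : eps ^+ 2 <= eps by nra.
have y2 : y ^+ 2 = kap ^+ 2 + eps ^+ 2 - eta x.
  by rewrite sqr_sqrtr//; have := ehi x; lra.
have kap21 : kap ^+ 2 <= 1 by rewrite expr_le1// ltW.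
have eps21 : eps ^+ 2 <= 1 by rewrite expr_le1// ltW.
have y5 : y <= 5.
  by rewrite -(@ler_pXn2r _ 2) ?nnegrE// y2; have := elow x; lra.
have mT : m <= t / 12.
  have m0 : 0 <= m by rewrite le_max lexx orbT.
  have t12 : 0 <= t / 12 by rewrite divr_ge0// ltW.
  rewrite -(@ler_pXn2r _ 2) ?nnegrE//; apply: (le_trans H); rewrite -/T.
  have -> : d / (4 * eps ^+ 3) = d * (10 / (4 * eps ^+ 3)) / 10 by field; rewrite lt0r_neq0.
  lra.
have Y0 := profile_ge0 (ltW k0) x0.
have Y1 : profile k x <= 1.
  have := sqr_profile_le k x; have : k ^+ 2 <= 1 by rewrite expr_le1// ltW.
  by nra.
have t120 : 0 < t / 12 by rewrite divr_gt0.
have yY : y - profile k x <= m by rewrite le_max lexx.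
have etaE : eta x = kap ^+ 2 + eps ^+ 2 - y ^+ 2 by rewrite y2; ring.
have kk2 : k ^+ 2 - kap ^+ 2 <= 2 * d.
  have := sqr_dist kap0 kap1 k0 k1 kd; rewrite ler_norml => /andP[? ?]; lra.
have : y ^+ 2 - profile k x ^+ 2 <= 6 * (t / 12).
  have -> : y ^+ 2 - profile k x ^+ 2 = (y - profile k x) * (y + profile k x) by ring.
  have : (y - profile k x) * (y + profile k x) <= t / 12 * (y + profile k x).
    by rewrite ler_wpM2r ?addr_ge0//; lra.
  have : t / 12 * (y + profile k x) <= t / 12 * 6.
    by rewrite ler_wpM2l ?(ltW t120)//; lra.
  lra.
by rewrite etaE /profile_eta; lra.
Qed.

(** The half-line [x <= 0] follows by reflection, which exchanges [defect_r] and [defect_l] up to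
    sign. The factor 128 is that of [excess_defect_r] and [excess_defect_l]. *)
Lemma ns_comparison L t : 0 <= L -> 0 < t ->
  \forall d \near (0 : R)^'+, forall b kap eta deta psi,
  near_soliton a k d b kap eta deta psi ->
  forall x, `|x| <= L -> profile_eta k x - eta x <= t.
Proof.
move=> L0 t0.
have [e /= e0 He] := comparison_right L0 t0.
near=> d => b kap eta deta psi ns.
have d0 : 0 < d by near: d; exact: nbhs_right_gt.
have dd : d * 128 < e.
  apply: (@le_lt_trans _ _ (e / 2)); last by rewrite ltr_pdivrMr// ltr_pMr// ltr1n.
  by near: d; apply: near0_mul; rewrite divr_gt0.
have d128 : 0 < d * 128 by rewrite mulr_gt0.
have kap1 : kap <= 1.
  by apply: (@sqr_le1 kap b); [case: ns|case: ns|rewrite addrC; case: ns].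
have kd : `|kap - k| <= d * 128 by apply: (le_trans (ns_kap ns)); lra.
have ball_d : ball (0 : R) e (d * 128) by rewrite /ball/= sub0r normrN gtr0_norm.
have {}He := He _ ball_d d128.
have [b0 kap0 bkap peta lpsi hi hE low ihi at0 ex _ _ _] := ns.
have Qr := excess_defect_r b0 kap0 bkap peta lpsi hi low ihi at0.
have Ql := excess_defect_l b0 kap0 bkap peta lpsi hi low ihi at0.
have lr := locL1_defect_r b0 bkap peta lpsi hi low ihi.
have ll := locL1_defect_l b0 bkap peta lpsi hi low ihi.
have R1 : forall M, 0 <= M -> \int[mu]_(x in `[0, M]) defect_r kap eta deta x ^+ 2 <= d * 128.
  by move=> M M0; apply: (le_trans (Qr M M0)); lra.
move=> x; rewrite ler_norml => /andP[x1 x2]; have [x0|x0] := leP 0 x.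
  exact: (He kap eta deta).
pose eta' x := eta (- x); pose deta' x := - deta (- x).
have peta' : primitive eta' deta' by exact: primitive_opp.
have dE : (fun x => defect_r kap eta' deta' x ^+ 2) =
          (fun x => defect_l kap eta deta (- x) ^+ 2).
  by apply/funext => y; rewrite /defect_r /defect_l /eta' /deta'; ring.
have lr' : locL1 (fun x => defect_r kap eta' deta' x ^+ 2).
  by rewrite dE; exact: (locL1_opp ll).
have R2 : forall M, 0 <= M -> \int[mu]_(x in `[0, M]) defect_r kap eta' deta' x ^+ 2 <= d * 128.
  move=> M M0; rewrite dE (itv_int_opp 0 M ll) oppr0.
  by apply: (le_trans (Ql M M0)); lra.
have := He kap eta' deta' kap0 kap1 peta' _ _ _ kd lr' R2 (- x).
rewrite profile_etaN /eta' opprK; apply.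
- by move=> y; exact: low.
- by move=> y; exact: ihi.
- by rewrite oppr0.
- by rewrite oppr_ge0 ltW.
- by rewrite lerNl.
Unshelve. all: by end_near. Qed.

End NearSoliton.

(** * From convergence of the momenta to convergence of [eta] in [L^2] *)

Section SolitonTail.
Context {R : realType}.
Local Notation mu := (@lebesgue_measure R).
Variables a k : R.
Hypothesis a0 : 0 < a.
Hypothesis k0 : 0 < k.
Hypothesis ak : a ^+ 2 + k ^+ 2 = 1.

Let s20 := @sqrt2_gt0 R.

Let s22 : Num.sqrt 2 <= 3 / 2 :> R.
Proof.
by rewrite -(@ler_pXn2r _ 2) ?nnegrE ?sqrtr_ge0 ?sqr_sqrtr//; lra.
Qed.

Let s21 : 1 <= Num.sqrt 2 :> R.
Proof.
by rewrite -(@ler_pXn2r _ 2) ?nnegrE ?sqrtr_ge0 ?sqr_sqrtr// expr1n; lra.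
Qed.

Let a20 : 0 < a ^+ 2. Proof. by rewrite exprn_gt0. Qed.

Let k1 : k <= 1.
Proof. by move: ak; have := sqr_ge0 a; have := k0; nra. Qed.

(** The argument of [a + i * profile k x], which is [i] times the soliton: the phase of the soliton
    is [profile_phase x - pi / 2]. *)
Definition profile_phase x := atan (profile k x / a).

Let rhoE x : 1 - profile_eta k x = a ^+ 2 + profile k x ^+ 2.
Proof. by rewrite /profile_eta -ak; ring. Qed.

Let rho_ge x : a ^+ 2 <= 1 - profile_eta k x.
Proof. by rewrite rhoE; have := sqr_ge0 (profile k x); lra. Qed.

Let rho0 x : 0 < 1 - profile_eta k x.
Proof. exact: lt_le_trans (rho_ge x). Qed.

Let peta1 x : profile_eta k x <= 1.
Proof. by have := rho0 x; lra. Qed.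

Lemma continuous_dphase :
  continuous (fun x => a / Num.sqrt 2 * profile_eta k x / (1 - profile_eta k x)).
Proof.
move=> x; apply: cvgM.
  by apply: cvgM; [exact: cvg_cst|exact: continuous_profile_eta].
apply: cvgV; first exact: lt0r_neq0.
by apply: cvgB; [exact: cvg_cst|exact: continuous_profile_eta].
Qed.

Lemma is_derive_profile_phase x : is_derive x (1 : R) profile_phase
  (a / Num.sqrt 2 * profile_eta k x / (1 - profile_eta k x)).
Proof.
have dl : is_derive x (1 : R) (fun t => profile k t / a) (profile_eta k x / Num.sqrt 2 / a).
  have dp := is_derive_profile k x.
  by apply: is_derive_eq; rewrite /GRing.scale/= mulr0 add0r mulrC.
have := @is_derive1_comp R atan (fun t => profile k t / a) x _ _ (is_derive1_atan _) dl.
move=> H; apply: (is_derive_eq H).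
rewrite rhoE; field.
by rewrite !lt0r_neq0// ltr_pwDl// sqr_ge0.
Qed.

Lemma primitive_profile_phase : primitive profile_phase
  (fun x => a / Num.sqrt 2 * profile_eta k x / (1 - profile_eta k x)).
Proof.
by apply: primitive_C1; [exact: is_derive_profile_phase|exact: continuous_dphase].
Qed.

(** Obtained by writing [eta^2 / (1 - eta) = eta / (1 - eta) - eta]: on the soliton, both terms are
    multiples of explicit derivatives, of [profile_phase] and of [profile k]. *)
Definition momentum_primitive x :=
  Num.sqrt 2 * (a^-1 * profile_phase x - profile k x).

Lemma primitive_momentum : primitive momentum_primitive
  (fun x => profile_eta k x ^+ 2 / (1 - profile_eta k x)).
Proof.
have := primitiveZ (Num.sqrt 2)
  (primitiveB (primitiveZ a^-1 primitive_profile_phase) (primitive_profile k)).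
apply: eq_primitive => // x; have r0 := lt0r_neq0 (rho0 x).
by field; rewrite r0 !lt0r_neq0.
Qed.

Lemma profile_phaseN x : profile_phase (- x) = - profile_phase x.
Proof. by rewrite /profile_phase profileN mulNr atanN. Qed.

Lemma momentum_primitiveN x : momentum_primitive (- x) = - momentum_primitive x.
Proof. by rewrite /momentum_primitive profile_phaseN profileN; ring. Qed.

Lemma cvg_momentum_primitive : momentum_primitive n%:R @[n --> \oo] -->
  Num.sqrt 2 * soliton_momentum a k / a.
Proof.
have -> : Num.sqrt 2 * soliton_momentum a k / a = Num.sqrt 2 * (a^-1 * atan (k / a) - k).
  by rewrite /soliton_momentum; field; exact: lt0r_neq0.
have cp := cvg_profile k0.
apply: cvgM; first exact: cvg_cst.
apply: cvgB; last exact: cp.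
apply: cvgM; first exact: cvg_cst.
have c1 : profile k n%:R / a @[n --> \oo] --> k / a.
  by apply: cvgM; [exact: cp|exact: cvg_cst].
apply: (cvg_comp _ _ c1); exact: continuous_atan.
Qed.

Let fstar_ge0 x : 0 <= profile_eta k x ^+ 2 / (1 - profile_eta k x).
Proof. by rewrite divr_ge0 ?sqr_ge0// ltW. Qed.

Lemma soliton_tail (s : R) : 0 < s -> exists n0 : nat,
  k - profile k n0%:R <= s /\
  Num.sqrt 2 * soliton_momentum a k / a - momentum_primitive n0%:R <= s.
Proof.
move=> s0.
have /cvgrPdist_le/(_ _ s0) [n1 _ H1] := cvg_profile k0.
have /cvgrPdist_le/(_ _ s0) [n2 _ H2] := cvg_momentum_primitive.
exists (maxn n1 n2); split.
  by have := H1 (maxn n1 n2) (leq_maxl _ _); apply: le_trans; exact: ler_norm.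
by have := H2 (maxn n1 n2) (leq_maxr _ _); apply: le_trans; exact: ler_norm.
Qed.

Section FractionBound.
Variables (d b kap lam : R) (eta deta psi : R -> R).
Hypothesis ns : near_soliton a k d b kap eta deta psi.
Hypothesis lam0 : 0 < lam.
Hypothesis ab : a / 2 <= b.

Let b0 : 0 < b. Proof. by case: ns. Qed.

Let brho x : b ^+ 2 <= 1 - eta x.
Proof. by have := ns_hi ns x; rewrite -(ns_bkap ns); lra. Qed.

Let b20 : 0 < b ^+ 2. Proof. by rewrite exprn_gt0. Qed.

Let erho0 x : 0 < 1 - eta x. Proof. exact: lt_le_trans (brho x). Qed.

Lemma ns_slip_integrable :
  mu.-integrable setT (EFin \o (fun x => slip b eta psi x ^+ 2)) /\
  \int[mu]_x slip b eta psi x ^+ 2 <= 8 / a ^+ 2 * d.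
Proof.
have [_ kap0 bkap peta lpsi hi hE low ihi at0 ex _ _ _] := ns.
have d0 : 0 <= d.
  exact: le_trans (excess_ge0 b0 kap0 bkap peta lpsi hi low ihi at0) ex.
have ls := locL1_slip b0 bkap peta lpsi hi ihi.
have sb (n : nat) : \int[mu]_(x in `[- n%:R, n%:R]) slip b eta psi x ^+ 2 <= 8 / a ^+ 2 * d.
  have := excess_slip b0 kap0 bkap peta lpsi hi low ihi at0 (ler0n R n).
  move=> H; apply: (le_trans H).
  apply: (@le_trans _ _ (2 / b ^+ 2 * d)).
    by rewrite ler_wpM2l// divr_ge0// ltW.
  rewrite ler_wpM2r//.
  have -> : 8 / a ^+ 2 = 2 / (a / 2) ^+ 2 by field; exact: lt0r_neq0.
  rewrite ler_wpM2l// lef_pV2 ?posrE ?exprn_gt0 ?divr_gt0//.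
  by rewrite ler_pXn2r ?nnegrE ?divr_ge0 ?(ltW a0) ?(ltW b0).
have sge0 x : 0 <= slip b eta psi x ^+ 2 by exact: sqr_ge0.
have Le := int_le_itv_int ls sge0 sb.
have si : mu.-integrable setT (EFin \o (fun x => slip b eta psi x ^+ 2)).
  apply: ge0_integrable => //; first by case: ls.
  by apply: (le_lt_trans Le); rewrite ltry.
by split=> //; exact: Rint_le_itv.
Qed.

(** By definition of [slip], [eta^2 / (1 - eta)] equals [sqrt 2 / b * (eta * psi - eta * slip)].
    Young's inequality with weight [lam] splits the last product into a part bounded by the energy,
    itself at most 1, and one bounded by the excess. *)
Lemma ns_fraction_bound A B : \int[mu]_(x in `[A, B]) (eta x ^+ 2 / (1 - eta x)) <=
  Num.sqrt 2 / b * (2 * (2^-1 * \int[mu]_x (eta x * psi x)) + 4 * lam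
    + 8 / a ^+ 2 * d / (4 * lam)).
Proof.
have [_ kap0 bkap peta lpsi hi hE low ihi at0 ex _ _ _] := ns.
have [si sI] := ns_slip_integrable.
have pi_ := eta_psi_integrable b0 bkap peta lpsi hi ihi.
have sb0 : 0 < Num.sqrt 2 / b by rewrite divr_gt0.
pose rhs x := Num.sqrt 2 / b * (eta x * psi x +
  (4 * lam * hdens eta deta psi x + (4 * lam)^-1 * slip b eta psi x ^+ 2)).
have i1 : mu.-integrable setT (EFin \o (fun x => 4 * lam * hdens eta deta psi x)).
  exact: (integrableZl measurableT _ hi).
have i2 : mu.-integrable setT (EFin \o (fun x => (4 * lam)^-1 * slip b eta psi x ^+ 2)).
  exact: (integrableZl measurableT _ si).
have i3 : mu.-integrable setT (EFin \o (fun x =>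
    4 * lam * hdens eta deta psi x + (4 * lam)^-1 * slip b eta psi x ^+ 2)).
  exact: (integrableD measurableT i1 i2).
have i4 : mu.-integrable setT (EFin \o (fun x => eta x * psi x +
    (4 * lam * hdens eta deta psi x + (4 * lam)^-1 * slip b eta psi x ^+ 2))).
  exact: (integrableD measurableT pi_ i3).
have i5 : mu.-integrable setT (EFin \o rhs).
  exact: (integrableZl measurableT _ i4).
have f0 x : 0 <= eta x ^+ 2 / (1 - eta x) by rewrite divr_ge0 ?sqr_ge0// ltW.
have frhs x : eta x ^+ 2 / (1 - eta x) <= rhs x.
  have r0 := lt0r_neq0 (erho0 x).
  have -> : eta x ^+ 2 / (1 - eta x) =
      Num.sqrt 2 / b * (eta x * psi x - eta x * slip b eta psi x).
    by rewrite /slip; field; rewrite r0 !lt0r_neq0.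
  rewrite /rhs ler_pM2l// lerD2l.
  have h1 := sqr_eta_le deta psi b0 bkap ihi x.
  have h2 : 4 * lam * hdens eta deta psi x >= lam * eta x ^+ 2.
    by rewrite [4 * lam]mulrC -mulrA ler_pM2l.
  have h3 := sqr_ge0 (2 * lam * eta x + slip b eta psi x).
  have h4 : - (eta x * slip b eta psi x) <= lam * eta x ^+ 2 + (4 * lam)^-1 * slip b eta psi x ^+ 2.
    have -> : lam * eta x ^+ 2 + (4 * lam)^-1 * slip b eta psi x ^+ 2 =
      (4 * lam)^-1 * (2 * lam * eta x + slip b eta psi x) ^+ 2 - eta x * slip b eta psi x.
      by field; exact: lt0r_neq0.
    by rewrite lerDr mulr_ge0// invr_ge0 mulr_ge0// ltW.
  lra.
have ceta := primitive_continuous peta.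
have cf : continuous (fun x => eta x ^+ 2 / (1 - eta x)).
  move=> x; apply: cvgM; first exact: (cvgM (ceta x) (ceta x)).
  apply: cvgV; first exact: lt0r_neq0.
  by apply: cvgB; [exact: cvg_cst|exact: ceta].
have rhs0 x : 0 <= rhs x by exact: le_trans (f0 x) (frhs x).
apply: (@le_trans _ _ (\int[mu]_x rhs x)).
  apply: le_trans (Rint_itv_le A B i5 rhs0).
  apply: itv_int_le => //; first exact: locL1_continuous.
  exact: locL1_integrable.
rewrite RintegralZl// RintegralD// RintegralD// RintegralZl// RintegralZl//.
rewrite ler_pM2l// mulrA divff// mul1r -addrA lerD2l; apply: lerD.
  by rewrite ger_pMr ?mulr_gt0.
by rewrite mulrC ler_pM2r// invr_gt0 mulr_gt0.
Qed.

End FractionBound.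

End SolitonTail.

Section NearSolitonL2.
Context {R : realType}.
Local Notation mu := (@lebesgue_measure R).
Variables a k : R.
Hypothesis a0 : 0 < a.
Hypothesis k0 : 0 < k.
Hypothesis ak : a ^+ 2 + k ^+ 2 = 1.

Let s20 := @sqrt2_gt0 R.

Let s22 : Num.sqrt 2 <= 3 / 2 :> R.
Proof.
by rewrite -(@ler_pXn2r _ 2) ?nnegrE ?sqrtr_ge0 ?sqr_sqrtr//; lra.
Qed.

Let a20 : 0 < a ^+ 2. Proof. by rewrite exprn_gt0. Qed.

Let k1 : k <= 1.
Proof. by move: ak; have := sqr_ge0 a; have := k0; nra. Qed.

Let rho_ge x : a ^+ 2 <= 1 - profile_eta k x.
Proof. by rewrite /profile_eta -ak; have := sqr_ge0 (profile k x); lra. Qed.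

Let rho0 x : 0 < 1 - profile_eta k x.
Proof. exact: lt_le_trans (rho_ge x). Qed.

Let peta1 x : profile_eta k x <= 1.
Proof. by have := rho0 x; lra. Qed.

Let pm := primitive_momentum a0 ak.

Let fstar_ge0 x : 0 <= profile_eta k x ^+ 2 / (1 - profile_eta k x).
Proof. by rewrite divr_ge0 ?sqr_ge0// ltW. Qed.

Lemma fraction_bound_near s : 0 < s -> \forall d \near (0 : R)^'+,
  forall b kap eta deta psi, near_soliton a k d b kap eta deta psi ->
  forall A B, \int[mu]_(x in `[A, B]) (eta x ^+ 2 / (1 - eta x)) <=
    2 * (Num.sqrt 2 * soliton_momentum a k / a) + s.
Proof.
move=> s0; set P := soliton_momentum a k.
(* Then [4 * lam * (2 / a) = s / 4]; [lam] is fixed before [d], which is divided by it. *)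
pose lam := s * a / 32.
have lam0 : 0 < lam by rewrite !mulr_gt0.
pose K := 3 / 2 * (4 / a + 4 * `|P| / a ^+ 2 + 4 / (lam * a ^+ 3)).
have s2 : 0 < s / 2 by rewrite divr_gt0.
apply: filterS3 (near0_mul K s2) (ns_b_lower k a0) (nbhs_right_gt 0).
move=> d dK Hb d0 b kap eta deta psi ns A B.
have ab := Hb _ _ _ _ _ ns.
have b0 := ns_b0 ns.
apply: (le_trans (ns_fraction_bound a0 ns lam0 ab A B)).
set M := 2^-1 * _; have := ns_mom ns; rewrite -/M -/P => MP.
have bd := ns_b ns.
have an := lt0r_neq0 a0; have bn := lt0r_neq0 b0; have ln := lt0r_neq0 lam0.
have b2 : b^-1 <= 2 / a.
  by rewrite -[2 / a]invf_div lef_pV2 ?posrE ?divr_gt0.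
have -> : Num.sqrt 2 / b * (2 * M + 4 * lam + 8 / a ^+ 2 * d / (4 * lam)) =
  2 * (Num.sqrt 2 * P / a) + Num.sqrt 2 * (2 * ((M - P) / b) + 2 * (P * (a - b) / (a * b))
   + (4 * lam + 2 * d / (a ^+ 2 * lam)) / b).
  by field; rewrite an bn ln.
rewrite lerD2l.
have e1 : (M - P) / b <= d * (2 / a).
  rewrite (le_trans (ler_norm _))// normrM (gtr0_norm (x := b^-1)) ?invr_gt0//.
  by apply: ler_pM => //; rewrite invr_ge0 ltW.
have e2 : P * (a - b) / (a * b) <= `|P| * d * (2 / a ^+ 2).
  rewrite (le_trans (ler_norm _))// normrM normrM.
  have h1 : `|(a * b)^-1| <= 2 / a ^+ 2.
    rewrite gtr0_norm ?invr_gt0 ?mulr_gt0// invfM.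
    have -> : 2 / a ^+ 2 = a^-1 * (2 / a) by field.
    by rewrite ler_pM2l// invr_gt0.
  apply: ler_pM => //; apply: ler_pM => //.
  by rewrite distrC.
have e3 : (4 * lam + 2 * d / (a ^+ 2 * lam)) / b <= (4 * lam + 2 * d / (a ^+ 2 * lam)) * (2 / a).
  apply: ler_wpM2l => //; apply: addr_ge0; first by rewrite mulr_ge0// ltW.
  by apply: divr_ge0; apply: mulr_ge0 => //; exact: ltW.
set X := 2 * ((M - P) / b) + _ + _.
have XB : X <= d * (4 / a + 4 * `|P| / a ^+ 2 + 4 / (lam * a ^+ 3)) + s / 4.
  apply: (@le_trans _ _ (2 * (d * (2 / a)) + 2 * (`|P| * d * (2 / a ^+ 2))
    + (4 * lam + 2 * d / (a ^+ 2 * lam)) * (2 / a))); first by rewrite /X; lra.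
  rewrite le_eqVlt; apply/orP; left; apply/eqP.
  have -> : s / 4 = 4 * lam * (2 / a) by rewrite /lam; field.
  by field; rewrite an ln.
set Z := d * (_ + _ + _) + _ in XB.
have Z0 : 0 <= Z.
  rewrite /Z addr_ge0 ?divr_ge0 ?(ltW s0)// mulr_ge0 ?(ltW d0)// !addr_ge0//.
  - by rewrite divr_ge0// ltW.
  - by rewrite divr_ge0 ?mulr_ge0// ltW.
  - by rewrite divr_ge0// mulr_ge0 ?(ltW lam0)// exprn_ge0// ltW.
apply: (@le_trans _ _ (Num.sqrt 2 * Z)); first by rewrite ler_pM2l.
apply: (@le_trans _ _ (3 / 2 * Z)); first by rewrite ler_wpM2r.
by rewrite /Z; rewrite /K in dK; lra.
Qed.

(** For [f s = s^2 / (1 - s)], the remainder of the tangent at [profile_eta] is exactly [(eta -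
    profile_eta)^2 / ((1 - eta) (1 - profile_eta)^2)], at least a sixteenth of the squared distance.
    The integral of [f (eta)] is bounded above through the momentum; the linear term is bounded by
    comparison on [[- n0, n0]] and by the decay of the soliton outside. *)
Lemma ns_L2 t : 0 < t -> \forall d \near (0 : R)^'+,
  forall b kap eta deta psi, near_soliton a k d b kap eta deta psi ->
  forall n : nat, \int[mu]_(x in `[- n%:R, n%:R]) (eta x - profile_eta k x) ^+ 2 <= t.
Proof.
move=> t0.
pose C := 2 / (a ^+ 2 * a ^+ 2).
have C0 : 0 < C by rewrite divr_gt0// mulr_gt0.
pose s := t / (64 * (2 + 48 * C)).
have C1 : 0 < 2 + 48 * C by lra.
have s0 : 0 < s by rewrite divr_gt0// mulr_gt0.
pose t1 := t / (128 * C).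
have t10 : 0 < t1 by rewrite divr_gt0// mulr_gt0.
have Ct1 : 0 < C * t1 by exact: mulr_gt0.
have C16 : 0 < C * 16 by exact: mulr_gt0.
have [n0 [tail1 tail2]] := soliton_tail a0 k0 s0.
apply: filterS2 (fraction_bound_near s0) (ns_comparison a0 k0 ak (ler0n R n0) t10).
move=> d Hf Hc b kap eta deta psi ns n.
have {}Hf := Hf _ _ _ _ _ ns; have {}Hc := Hc _ _ _ _ _ ns.
have b0 := ns_b0 ns.
have erho x : b ^+ 2 <= 1 - eta x by have := ns_hi ns x; rewrite -(ns_bkap ns); lra.
have erho0 x : 0 < 1 - eta x by apply: lt_le_trans (erho x); rewrite exprn_gt0.
have ceta := primitive_continuous (ns_peta ns).
have cpe := @continuous_profile_eta R k.
pose N := (maxn n n0)%:R : R.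
have nN : n%:R <= N by rewrite ler_nat leq_maxl.
have n0N : n0%:R <= N by rewrite ler_nat leq_maxr.
have n00 : (0 : R) <= n0%:R by rewrite ler0n.
have N0 : 0 <= N by exact: le_trans n0N.
(* The derivative of [s^2 / (1 - s)] at [profile_eta k x]. It is nonnegative, so a lower bound on
   [eta] alone controls the linear term. *)
pose df x := profile_eta k x * (2 - profile_eta k x) / (1 - profile_eta k x) ^+ 2.
have cdist : continuous (fun x => eta x - profile_eta k x).
  by move=> x; apply: cvgB; [exact: ceta|exact: cpe].
have csqr : continuous (fun x => (eta x - profile_eta k x) ^+ 2).
  by move=> x; exact: (cvgM (cdist x) (cdist x)).
have cr : continuous (fun x => 1 - eta x).
  by move=> x; apply: cvgB; [exact: cvg_cst|exact: ceta].
have crs : continuous (fun x => 1 - profile_eta k x).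
  by move=> x; apply: cvgB; [exact: cvg_cst|exact: cpe].
have cf : continuous (fun x => eta x ^+ 2 / (1 - eta x)).
  move=> x; apply: cvgM; first exact: (cvgM (ceta x) (ceta x)).
  by apply: cvgV; [exact: lt0r_neq0|exact: cr].
have cfs : continuous (fun x => profile_eta k x ^+ 2 / (1 - profile_eta k x)).
  move=> x; apply: cvgM; first exact: (cvgM (cpe x) (cpe x)).
  by apply: cvgV; [exact: lt0r_neq0|exact: crs].
have cdf : continuous df.
  move=> x; apply: cvgM.
    apply: cvgM; first exact: cpe.
    by apply: cvgB; [exact: cvg_cst|exact: cpe].
  apply: cvgV; first by rewrite expf_neq0// lt0r_neq0.
  exact: (cvgM (crs x) (crs x)).
have cdfd : continuous (fun x => df x * (profile_eta k x - eta x)).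
  move=> x; apply: cvgM; first exact: cdf.
  by apply: cvgB; [exact: cpe|exact: ceta].
have l1 := locL1_continuous csqr; have l2 := locL1_continuous cf.
have l3 := locL1_continuous cfs; have l4 := locL1_continuous cdfd.
have l5 : locL1 (profile_eta k) by exact: locL1_continuous.
have df_ge0 x : 0 <= df x.
  have := profile_eta_ge0 k x; have := peta1 x => h1 h2.
  by rewrite /df divr_ge0 ?sqr_ge0// mulr_ge0//; lra.
have dfC x : df x <= C * profile_eta k x.
  have h2 := profile_eta_ge0 k x.
  rewrite /df ler_pdivrMr; last by rewrite exprn_gt0.
  have : C * profile_eta k x * (a ^+ 2 * a ^+ 2) <= C * profile_eta k x * (1 - profile_eta k x) ^+ 2.
    apply: ler_wpM2l; first by rewrite mulr_ge0 ?(ltW C0).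
    by rewrite [leRHS]expr2; apply: ler_pM => //; exact: ltW.
  apply: le_trans.
  have -> : C * profile_eta k x * (a ^+ 2 * a ^+ 2) = profile_eta k x * 2.
    by rewrite /C; field; exact: lt0r_neq0.
  by rewrite ler_wpM2l//; lra.
apply: (@le_trans _ _ (\int[mu]_(x in `[- N, N]) (eta x - profile_eta k x) ^+ 2)).
  apply: itv_int_sub => //; [by move=> x; exact: sqr_ge0|by rewrite lerN2|].
  by have := ler0n R n; lra.
have NN : - N <= N by lra.
have point x : (eta x - profile_eta k x) ^+ 2 <=
    16 * ((eta x ^+ 2 / (1 - eta x) - profile_eta k x ^+ 2 / (1 - profile_eta k x))
     + df x * (profile_eta k x - eta x)).
  have r1 := erho0 x; have r2 := rho0 x.
  have n1 := lt0r_neq0 r1; have n2 := lt0r_neq0 r2.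
  have -> : eta x ^+ 2 / (1 - eta x) - profile_eta k x ^+ 2 / (1 - profile_eta k x)
     + df x * (profile_eta k x - eta x) =
     (eta x - profile_eta k x) ^+ 2 / ((1 - eta x) * (1 - profile_eta k x) ^+ 2).
    by rewrite /df; field; rewrite n1 n2.
  rewrite mulrCA ler_peMr ?sqr_ge0//.
  have h2 := profile_eta_ge0 k x; have h3 := ns_low ns x.
  rewrite ler_pdivlMr ?mul1r; last by rewrite mulr_gt0// exprn_gt0.
  have : (1 - profile_eta k x) ^+ 2 <= 1 by rewrite expr_le1//; lra.
  have := sqr_ge0 (1 - profile_eta k x); nra.
apply: (@le_trans _ _ (16 * (\int[mu]_(x in `[- N, N]) (eta x ^+ 2 / (1 - eta x))
  - \int[mu]_(x in `[- N, N]) (profile_eta k x ^+ 2 / (1 - profile_eta k x))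
  + \int[mu]_(x in `[- N, N]) (df x * (profile_eta k x - eta x))))).
  rewrite -itv_intB// -itv_intD//; last exact: locL1B.
  rewrite -itv_intZ; last by apply: locL1D => //; exact: locL1B.
  apply: itv_int_le => //.
  by apply: locL1Z; apply: locL1D => //; exact: locL1B.
have I1 := Hf (- N) N.
have I2 : 2 * (Num.sqrt 2 * soliton_momentum a k / a) - 2 * s <=
    \int[mu]_(x in `[- N, N]) (profile_eta k x ^+ 2 / (1 - profile_eta k x)).
  have nn0 : - n0%:R <= n0%:R :> R by lra.
  have := itv_int_sub l3 fstar_ge0 _ nn0 n0N.
  move=> /(_ (- N)); rewrite lerN2 => /(_ n0N); apply: le_trans.
  by rewrite (primitiveE pm nn0) momentum_primitiveN; lra.
have inner : \int[mu]_(x in `[- n0%:R, n0%:R]) (df x * (profile_eta k x - eta x)) <=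
    C * t1 * 3.
  have nn0 : - n0%:R <= n0%:R :> R by lra.
  apply: (@le_trans _ _ (\int[mu]_(x in `[- n0%:R, n0%:R]) (C * t1 * profile_eta k x))).
    apply: itv_int_le => //; first exact: locL1Z.
    move=> x xn; have xx : `|x| <= n0%:R by rewrite ler_norml.
    have h := Hc x xx.
    have : df x * (profile_eta k x - eta x) <= df x * t1 by rewrite ler_wpM2l.
    move=> h1; apply: (le_trans h1).
    by rewrite [leRHS]mulrAC ler_pM2r.
  rewrite itv_intZ// (ler_pM2l Ct1).
  have -> : \int[mu]_(x in `[- n0%:R, n0%:R]) profile_eta k x =
      Num.sqrt 2 * \int[mu]_(x in `[- n0%:R, n0%:R]) (profile_eta k x / Num.sqrt 2).
    rewrite -itv_intZ; last exact: primitive_locL1 (primitive_profile k).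
    by apply: itv_int_eq => x _; rewrite mulrC divfK// lt0r_neq0.
  rewrite (primitiveE (primitive_profile k) nn0) profileN.
  have := sqr_profile_le k n0%:R; have := profile_ge0 (ltW k0) n00.
  have kk : k ^+ 2 <= 1 by rewrite expr_le1// ltW.
  move=> h1 h2; have Y1 : profile k n0%:R <= 1 by nra.
  have Y0 : 0 <= profile k n0%:R - - profile k n0%:R by lra.
  apply: (@le_trans _ _ (3 / 2 * (profile k n0%:R - - profile k n0%:R))); last by lra.
  by rewrite ler_wpM2r.
(* Outside, [eta >= -15] gives only [profile_eta - eta <= 16], but [df <= C * profile_eta] and the
   tails of [profile_eta] have small integral. *)
have outer_bound A B : A <= B -> profile k B - profile k A <= s ->
   \int[mu]_(x in `[A, B]) (df x * (profile_eta k x - eta x)) <= C * 16 * (3 / 2 * s).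
  move=> AB ps.
  apply: (@le_trans _ _ (\int[mu]_(x in `[A, B]) (C * 16 * profile_eta k x))).
    apply: itv_int_le => //; first exact: locL1Z.
    move=> x _; have h := ns_low ns x; have h' := peta1 x.
    have : df x * (profile_eta k x - eta x) <= df x * 16 by rewrite ler_wpM2l//; lra.
    move=> h1; apply: (le_trans h1).
    by rewrite [leRHS]mulrAC ler_pM2r.
  rewrite itv_intZ// (ler_pM2l C16).
  have -> : \int[mu]_(x in `[A, B]) profile_eta k x =
      Num.sqrt 2 * \int[mu]_(x in `[A, B]) (profile_eta k x / Num.sqrt 2).
    rewrite -itv_intZ; last exact: primitive_locL1 (primitive_profile k).
    by apply: itv_int_eq => x _; rewrite mulrC divfK// lt0r_neq0.
  rewrite (primitiveE (primitive_profile k) AB).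
  apply: (@le_trans _ _ (Num.sqrt 2 * s)); first by rewrite ler_pM2l.
  by rewrite ler_wpM2r// ltW.
have pk x : profile k x <= k.
  have := sqr_profile_le k x => h; have := k0; nra.
have I3 : \int[mu]_(x in `[- N, N]) (df x * (profile_eta k x - eta x)) <=
    C * t1 * 3 + 2 * (C * 16 * (3 / 2 * s)).
  have h1 : - N <= - n0%:R by rewrite lerN2.
  have h2 : - n0%:R <= n0%:R :> R by lra.
  rewrite (itv_int_split l4 h1 (le_trans h2 n0N)) (itv_int_split l4 h2 n0N).
  have o1 : profile k (- n0%:R) - profile k (- N) <= s.
    by rewrite !profileN; have := pk N; lra.
  have o2 : profile k N - profile k n0%:R <= s by have := pk N; lra.
  have q1 := outer_bound _ _ h1 o1; have q2 := outer_bound _ _ n0N o2.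
  lra.
have e1 : 16 * (C * t1 * 3) = 3 / 8 * t by rewrite /t1; field; exact: lt0r_neq0.
have e2 : s * (2 + 48 * C) = t / 64.
  by rewrite /s; field; exact: lt0r_neq0.
have Cs : 0 <= C * s by rewrite mulr_ge0// ltW.
lra.
Qed.

End NearSolitonL2.

Lemma young_abs {R : realType} (w z lam : R) : 0 < lam ->
  `|2 * w * z| <= lam^-1 * w ^+ 2 + lam * z ^+ 2.
Proof.
move=> lam0; have ln := lt0r_neq0 lam0.
have e1 : lam^-1 * w ^+ 2 + lam * z ^+ 2 - 2 * w * z = lam^-1 * (w - lam * z) ^+ 2.
  by field.
have e2 : lam^-1 * w ^+ 2 + lam * z ^+ 2 + 2 * w * z = lam^-1 * (w + lam * z) ^+ 2.
  by field.
have g1 : 0 <= lam^-1 * (w - lam * z) ^+ 2 by rewrite mulr_ge0 ?sqr_ge0// invr_ge0 ltW.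
have g2 : 0 <= lam^-1 * (w + lam * z) ^+ 2 by rewrite mulr_ge0 ?sqr_ge0// invr_ge0 ltW.
by rewrite -e1 in g1; rewrite -e2 in g2; rewrite ler_norml; apply/andP; split; lra.
Qed.

Lemma norm_le_1B {R : realType} (s : R) : 0 < 1 - s -> `|s| <= 1 + (1 - s).
Proof. by move=> s1; rewrite ler_norml; apply/andP; split; lra. Qed.

(** * Uniform convergence of [eta] and local uniform convergence of the phase *)

Section NearSolitonUniform.
Context {R : realType}.
Local Notation mu := (@lebesgue_measure R).
Variables a k : R.
Hypothesis a0 : 0 < a.
Hypothesis k0 : 0 < k.
Hypothesis ak : a ^+ 2 + k ^+ 2 = 1.

Let s20 := @sqrt2_gt0 R.

Let s21 : 1 <= Num.sqrt 2 :> R.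
Proof.
by rewrite -(@ler_pXn2r _ 2) ?nnegrE ?sqrtr_ge0 ?sqr_sqrtr// expr1n; lra.
Qed.

Let k1 : k <= 1.
Proof. by move: ak; have := sqr_ge0 a; have := k0; nra. Qed.

Let a1 : a <= 1.
Proof. by move: ak; have := sqr_ge0 k; have := a0; nra. Qed.

Let kk1 : k ^+ 2 <= 1. Proof. by rewrite expr_le1// ltW. Qed.

Let rho_ge x : a ^+ 2 <= 1 - profile_eta k x.
Proof. by rewrite /profile_eta -ak; have := sqr_ge0 (profile k x); lra. Qed.

Let rho0 x : 0 < 1 - profile_eta k x.
Proof. by apply: lt_le_trans (rho_ge x); rewrite exprn_gt0. Qed.

Let deta_bound x : (Num.sqrt 2 * profile k x * profile_eta k x) ^+ 2 <= 2.
Proof.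
have -> : (Num.sqrt 2 * profile k x * profile_eta k x) ^+ 2 =
  Num.sqrt 2 ^+ 2 * (profile k x ^+ 2 * profile_eta k x ^+ 2) by ring.
rewrite sqr_sqrtr// ger_pMr//.
apply: mulr_ile1; [exact: sqr_ge0|exact: sqr_ge0| |].
  exact: le_trans (sqr_profile_le k x) kk1.
rewrite expr_le1 ?profile_eta_ge0//; exact: le_trans (profile_eta_le k x) kk1.
Qed.

(** The one-dimensional Sobolev argument: some point of [[x, x + 1]] has a small value of
    [w = eta - profile_eta], and [w^2] varies by at most the integral of [2 |w w'|], where [w] is
    small in [L^2] and [w'] bounded in [L^2]. *)
Lemma ns_uniform t : 0 < t -> \forall d \near (0 : R)^'+,
  forall b kap eta deta psi, near_soliton a k d b kap eta deta psi ->
  forall x, `|eta x - profile_eta k x| <= t.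
Proof.
move=> t0.
have tt : 0 < t ^+ 2 by rewrite exprn_gt0.
(* This keeps [260 * lam] well below [t^2]; 260 = 256 + 4 bounds the integral of the squared
   derivative of [eta - profile_eta] over a unit interval. *)
pose lam := t ^+ 2 / (32 * 64).
have lam0 : 0 < lam by rewrite divr_gt0// mulr_gt0.
have c0 : 0 < 2 + lam^-1 by rewrite addr_gt0// invr_gt0.
pose t2 := t ^+ 2 / 4 / (2 + lam^-1).
have t20 : 0 < t2 by rewrite !divr_gt0.
apply: filterS (ns_L2 a0 k0 ak t20) => d H b kap eta deta psi ns x.
have {}H := H _ _ _ _ _ ns.
have [b0 kap0 bkap peta lpsi hi hE low ihi at0 _ _ _ _] := ns.
pose df y := deta y - - (Num.sqrt 2 * profile k y * profile_eta k y).
have pd : primitive (fun y => eta y - profile_eta k y) df.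
  exact: primitiveB peta (primitive_profile_eta k).
have p2 := primitive_sqr pd.
have x1 : x <= x + 1 by rewrite lerDl.
pose n := Num.bound (`|x| + 1).
have xn : `|x| + 1 < n%:R by apply: archi_boundP; rewrite addr_ge0.
have nx : - n%:R <= x by have := ler_norm (- x); rewrite normrN; lra.
have xn' : x + 1 <= n%:R by have := ler_norm x; lra.
have cd := primitive_continuous pd.
have lsq : locL1 (fun y => (eta y - profile_eta k y) ^+ 2).
  by apply: locL1_continuous; exact: primitive_continuous p2.
have I1 : \int[mu]_(y in `[x, x + 1]) (eta y - profile_eta k y) ^+ 2 <= t2.
  by apply: le_trans (H n); apply: (itv_int_sub lsq _ nx x1 xn') => y; exact: sqr_ge0.
have [y /andP[xy yx] fy] : exists2 y, x <= y <= x + 1 &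
    (eta y - profile_eta k y) ^+ 2 < 2 * t2.
  apply: contrapT => nex.
  have Hge y : x <= y <= x + 1 -> 2 * t2 <= (eta y - profile_eta k y) ^+ 2.
    by move=> yy; rewrite leNgt; apply/negP => h; apply: nex; exists y.
  have := itv_int_le (locL1_cst (2 * t2)) lsq Hge.
  by rewrite itv_int_cst//; lra.
have ld : locL1 (fun y => hdens eta deta psi y) by exact: locL1_integrable.
have lrhs : locL1 (fun z => lam^-1 * (eta z - profile_eta k z) ^+ 2 +
    lam * (256 * hdens eta deta psi z + 4)).
  apply: locL1D; first exact: locL1Z.
  by apply: locL1Z; apply: locL1D; [exact: locL1Z|exact: locL1_cst].
have V : (eta x - profile_eta k x) ^+ 2 <= (eta y - profile_eta k y) ^+ 2 +
    (lam^-1 * t2 + lam * 260).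
  have := primitiveE p2 xy => E.
  rewrite -lerBlDl -opprB -E.
  apply: le_trans (ler_norm _) _; rewrite normrN.
  apply: (le_trans (itv_int_norm _ _ (primitive_locL1 p2))).
  apply: (@le_trans _ _ (\int[mu]_(z in `[x, y]) (lam^-1 * (eta z - profile_eta k z) ^+ 2 +
    lam * (256 * hdens eta deta psi z + 4)))).
    apply: itv_int_le => //; first exact: locL1_norm (primitive_locL1 p2).
    move=> z _; set w := eta z - profile_eta k z.
    have df2 : df z ^+ 2 <= 256 * hdens eta deta psi z + 4.
      have h1 := sqr_deta_le deta psi b0 bkap low ihi z.
      have h2 := deta_bound z; rewrite /df opprK.
      have := sqr_ge0 (deta z - Num.sqrt 2 * profile k z * profile_eta k z); lra.
    have h3 : lam * df z ^+ 2 <= lam * (256 * hdens eta deta psi z + 4) by rewrite ler_pM2l.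
    by apply: (le_trans (young_abs w (df z) lam0)); rewrite lerD2l.
  have hd0 z : 0 <= hdens eta deta psi z by exact: (hdens_ge0 deta psi b0 bkap ihi z).
  apply: (@le_trans _ _ (\int[mu]_(z in `[x, x + 1]) (lam^-1 * (eta z - profile_eta k z) ^+ 2 +
    lam * (256 * hdens eta deta psi z + 4)))).
    apply: (itv_int_sub lrhs _ (lexx x) xy yx) => z; have := hd0 z => h.
    apply: addr_ge0; apply: mulr_ge0; [|exact: sqr_ge0|exact: ltW|by lra].
    by rewrite invr_ge0 ltW.
  have l256 : locL1 (fun z => 256 * hdens eta deta psi z) by exact: locL1Z.
  rewrite itv_intD; last 2 first.
  - exact: locL1Z.
  - by apply: locL1Z; apply: locL1D => //; exact: locL1_cst.
  rewrite !itv_intZ//; last by apply: locL1D => //; exact: locL1_cst.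
  rewrite itv_intD//; last exact: locL1_cst.
  rewrite itv_int_cst// itv_intZ//.
  apply: lerD; first by rewrite ler_pM2l ?invr_gt0.
  rewrite ler_pM2l//.
  have := Rint_itv_le x (x + 1) hi hd0; lra.
have e3 : t2 * (2 + lam^-1) = t ^+ 2 / 4 by rewrite /t2 divfK// lt0r_neq0.
have e4 : t ^+ 2 = lam * (32 * 64) by rewrite /lam; field.
rewrite -(@ler_pXn2r _ 2) ?nnegrE ?normr_ge0 ?(ltW t0)//.
by rewrite real_normK ?num_real//; lra.
Qed.

(** The difference of the phase derivatives is controlled by [slip], [b - a] and
    [eta - profile_eta]. The first is small in [L^2] only, which suffices after integration over a
    length at most [L]. *)
Lemma ns_phase L t : 0 < L -> 0 < t -> \forall d \near (0 : R)^'+,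
  forall b kap eta deta psi phi, near_soliton a k d b kap eta deta psi ->
  primitive phi psi -> forall x, `|x| <= L ->
  `|(phi x - phi 0) - (profile_phase a k x - profile_phase a k 0)| <= t.
Proof.
move=> L0 t0.
have aa0 : 0 < a ^+ 2 by rewrite exprn_gt0.
have a40 : 0 < a ^+ 2 * a ^+ 2 by rewrite mulr_gt0.
pose t1 := t / (16 * L) * (a ^+ 2 * a ^+ 2).
have t10 : 0 < t1 by rewrite mulr_gt0// divr_gt0// mulr_gt0.
pose lam := t / (4 * L).
have lam0 : 0 < lam by rewrite divr_gt0// mulr_gt0.
pose K := L * (4 / a ^+ 2 + 1) + 8 / a ^+ 2 / (4 * lam).
have t40 : 0 < t / 4 by rewrite divr_gt0.
near=> d => b kap eta deta psi phi ns pphi.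
have dK : d * K <= t / 4 by near: d; exact: near0_mul.
have ab : a / 2 <= b.
  have H : forall b kap eta deta psi,
    near_soliton a k d b kap eta deta psi -> a / 2 <= b by near: d; exact: ns_b_lower.
  exact: H ns.
have U : forall x, `|eta x - profile_eta k x| <= t1.
  have H : forall b kap eta deta psi, near_soliton a k d b kap eta deta psi ->
    forall x, `|eta x - profile_eta k x| <= t1 by near: d; exact: ns_uniform.
  exact: H ns.
have d0 : 0 < d by near: d; exact: nbhs_right_gt.
have [b0 kap0 bkap peta lpsi hi hE low ihi at0 _ _ bd _] := ns.
have bb0 : 0 < b ^+ 2 by rewrite exprn_gt0.
have erho x : b ^+ 2 <= 1 - eta x by have := ihi x; rewrite -bkap; lra.
have erho0 x : 0 < 1 - eta x by exact: lt_le_trans (erho x).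
have [si sI] := ns_slip_integrable a0 ns ab.
have iaa : (b ^+ 2)^-1 <= 4 / a ^+ 2.
  have -> : 4 / a ^+ 2 = ((a / 2) ^+ 2)^-1 by field; exact: lt0r_neq0.
  rewrite lef_pV2 ?posrE ?exprn_gt0 ?divr_gt0//.
  by rewrite ler_pXn2r ?nnegrE ?divr_ge0 ?(ltW a0) ?(ltW b0).
pose dph y := psi y - a / Num.sqrt 2 * profile_eta k y / (1 - profile_eta k y).
have pD : primitive (fun y => phi y - profile_phase a k y) dph.
  exact: primitiveB pphi (primitive_profile_phase a0 ak).
pose e1 := d * (4 / a ^+ 2 + 1) + 4 / (a ^+ 2 * a ^+ 2) * t1.
have point y : `|dph y| <= e1 + lam + (4 * lam)^-1 * slip b eta psi y ^+ 2.
  have r1 := lt0r_neq0 (erho0 y); have r2 := lt0r_neq0 (rho0 y).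
  have sn := lt0r_neq0 s20.
  (* Both phase derivatives are [s / (1 - s)] up to factors, and the difference of two values of
     [s / (1 - s)] is that of the arguments divided by the product of the denominators. *)
  have -> : dph y = slip b eta psi y + ((b - a) * (eta y / (1 - eta y)) +
     a * ((eta y - profile_eta k y) / ((1 - eta y) * (1 - profile_eta k y)))) / Num.sqrt 2.
    by rewrite /dph /slip; field; rewrite r1 r2 sn.
  apply: (le_trans (ler_normD _ _)).
  have h1 : `|slip b eta psi y| <= lam + (4 * lam)^-1 * slip b eta psi y ^+ 2.
    have := young_abs (slip b eta psi y / 2) 1 lam0.
    have -> : 2 * (slip b eta psi y / 2) * 1 = slip b eta psi y by field.
    have -> : lam^-1 * (slip b eta psi y / 2) ^+ 2 + lam * 1 ^+ 2 =
       lam + (4 * lam)^-1 * slip b eta psi y ^+ 2 by field; exact: lt0r_neq0.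
    by [].
  suff h2 : `|((b - a) * (eta y / (1 - eta y)) +
     a * ((eta y - profile_eta k y) / ((1 - eta y) * (1 - profile_eta k y)))) / Num.sqrt 2| <= e1.
    by lra.
  rewrite normrM normfV (gtr0_norm s20) ler_pdivrMr//.
  have e10 : 0 <= e1.
    apply: addr_ge0.
      by rewrite mulr_ge0 ?(ltW d0)// addr_ge0// divr_ge0// ltW.
    by rewrite mulr_ge0 ?(ltW t10)// divr_ge0// ltW.
  apply: (@le_trans _ _ e1); last by rewrite ler_peMr.
  apply: (le_trans (ler_normD _ _)); rewrite /e1 !normrM; apply: lerD.
    apply: ler_pM => //.
    rewrite normfV (gtr0_norm (erho0 y)) ler_pdivrMr//.
    have eb : (b ^+ 2)^-1 * (1 - eta y) >= 1.
      by rewrite mulrC ler_pdivlMr// mul1r.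
    have : (4 / a ^+ 2 + 1) * (1 - eta y) >= ((b ^+ 2)^-1 + 1) * (1 - eta y).
      by rewrite ler_pM2r// lerD2r.
    apply: le_trans; rewrite mulrDl mul1r.
    by apply: (le_trans (norm_le_1B (erho0 y))); rewrite lerD2r.
  rewrite (gtr0_norm a0); apply: (@le_trans _ _ (`|eta y - profile_eta k y| *
     `|((1 - eta y) * (1 - profile_eta k y))^-1|)).
    by rewrite ler_piMl// mulr_ge0.
  rewrite mulrC; apply: ler_pM => //.
  rewrite normfV gtr0_norm ?mulr_gt0// invfM.
  have -> : 4 / (a ^+ 2 * a ^+ 2) = 4 / a ^+ 2 * (a ^+ 2)^-1 by field; exact: lt0r_neq0.
  apply: ler_pM; [by rewrite invr_ge0 ltW|by rewrite invr_ge0 ltW| |].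
    by apply: le_trans iaa; rewrite lef_pV2 ?posrE.
  by rewrite lef_pV2 ?posrE.
have lrhs : locL1 (fun y => e1 + lam + (4 * lam)^-1 * slip b eta psi y ^+ 2).
  apply: locL1D; first exact: locL1_cst.
  by apply: locL1Z; exact: locL1_integrable.
have bound u v : u <= v -> v - u <= L -> `|\int[mu]_(y in `[u, v]) dph y| <= t.
  move=> uv vuL; apply: (le_trans (itv_int_norm _ _ (primitive_locL1 pD))).
  apply: (@le_trans _ _ (\int[mu]_(y in `[u, v]) (e1 + lam + (4 * lam)^-1 * slip b eta psi y ^+ 2))).
    by apply: itv_int_le => //; exact: locL1_norm (primitive_locL1 pD).
  rewrite itv_intD; last 2 first.
  - exact: locL1_cst.
  - by apply: locL1Z; exact: locL1_integrable.
  rewrite itv_int_cst// itv_intZ; last exact: locL1_integrable.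
  have S1 : \int[mu]_(x in `[u, v]) slip b eta psi x ^+ 2 <= 8 / a ^+ 2 * d.
    by apply: le_trans sI; apply: Rint_itv_le => // z; exact: sqr_ge0.
  have S2 : (4 * lam)^-1 * \int[mu]_(x in `[u, v]) slip b eta psi x ^+ 2 <=
     (4 * lam)^-1 * (8 / a ^+ 2 * d).
    by rewrite ler_pM2l// invr_gt0 mulr_gt0.
  have S3 : (e1 + lam) * (v - u) <= (e1 + lam) * L.
    apply: ler_wpM2l => //; apply: addr_ge0; last exact: ltW.
    apply: addr_ge0.
      by rewrite mulr_ge0 ?(ltW d0)// addr_ge0// divr_ge0// ltW.
    by rewrite mulr_ge0 ?(ltW t10)// divr_ge0// ltW.
  have q1 : lam * L = t / 4 by rewrite /lam; field; exact: lt0r_neq0.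
  have q2 : 4 / (a ^+ 2 * a ^+ 2) * t1 * L = t / 4.
    by rewrite /t1; field; rewrite !lt0r_neq0.
  have q3 : d * (4 / a ^+ 2 + 1) * L + (4 * lam)^-1 * (8 / a ^+ 2 * d) = d * K.
    by rewrite /K; ring.
  have q4 : (e1 + lam) * L = d * (4 / a ^+ 2 + 1) * L + t / 4 + t / 4.
    by rewrite -{1}q2 -q1 /e1; ring.
  lra.
move=> x; rewrite ler_norml => /andP[x1 x2].
have [x0|x0] := leP 0 x.
  have := bound 0 x x0; rewrite subr0 => /(_ x2); rewrite (primitiveE pD x0).
  by apply: le_trans; rewrite le_eqVlt; apply/orP; left; apply/eqP; congr `|_|; ring.
have x0' := ltW x0.
have := bound x 0 x0'; rewrite sub0r => /(_ _); rewrite (primitiveE pD x0') => B.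
apply: le_trans (B _); last by lra.
by rewrite -normrN le_eqVlt; apply/orP; left; apply/eqP; congr `|_|; ring.
Unshelve. all: by end_near. Qed.

End NearSolitonUniform.

(** * Maps in hydrodynamical variables *)

Section Hydrodynamics.
Context {R : realType}.
Local Notation mu := (@lebesgue_measure R).

Lemma itv_int_ae_eq (f g : R -> R) A B : locL1 f -> locL1 g ->
  {ae mu, forall x, f x = g x} ->
  \int[mu]_(x in `[A, B]) f x = \int[mu]_(x in `[A, B]) g x.
Proof.
move=> [mf _] [mg _] fg; congr fine; apply: ae_eq_integral => //.
- by apply/measurable_EFinP; exact: measurable_funS mf.
- by apply/measurable_EFinP; exact: measurable_funS mg.
- have [N [mN N0 sN]] := fg; exists N; split=> // x /= nx.
  by apply: sN => /= fgx; apply: nx => _; rewrite fgx.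
Qed.

Lemma primitive_ae (f g g' : R -> R) : primitive f g -> locL1 g' ->
  {ae mu, forall x, g x = g' x} -> primitive f g'.
Proof.
move=> [cf lg fE] lg' gg'; split=> // A B AB.
by rewrite fE//; exact: itv_int_ae_eq.
Qed.

Variables v1 v2 g1 g2 phi psi0 rho : R -> R.
Hypothesis p1 : primitive v1 g1.
Hypothesis p2 : primitive v2 g2.
Hypothesis pphi : primitive phi psi0.
Hypothesis v1E : forall x, v1 x = rho x * cos (phi x).
Hypothesis v2E : forall x, v2 x = rho x * sin (phi x).
Hypothesis eta1 : forall x, eta v1 v2 x < 1.

(* The derivative of any phase of v1 + i v2, in terms of the derivatives g1, g2. *)
Definition dphase x := (v1 x * g2 x - v2 x * g1 x) / (1 - eta v1 v2 x).

Let etaE x : 1 - eta v1 v2 x = rho x ^+ 2.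
Proof.
rewrite /eta v1E v2E.
have -> : 1 - (1 - ((rho x * cos (phi x)) ^+ 2 + (rho x * sin (phi x)) ^+ 2)) =
  rho x ^+ 2 * (cos (phi x) ^+ 2 + sin (phi x) ^+ 2) by ring.
by rewrite cos2Dsin2 mulr1.
Qed.

Let rho2_gt0 x : 0 < rho x ^+ 2.
Proof. by rewrite -etaE subr_gt0. Qed.

(** Differentiating [v2 * cos phi - v1 * sin phi = 0] isolates [rho * psi0] without any regularity
    of [rho]. *)
Lemma dphase_ae : {ae mu, forall x, psi0 x = dphase x}.
Proof.
have ccos : continuous (fun x => cos (phi x)).
  move=> x; apply: (@continuous_comp _ _ _ phi cos).
    exact: (primitive_continuous pphi).
  exact: continuous_cos.
have csin : continuous (fun x => sin (phi x)).
  move=> x; apply: (@continuous_comp _ _ _ phi sin).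
    exact: (primitive_continuous pphi).
  exact: continuous_sin.
have pcos : primitive (fun x => cos (phi x)) (fun x => - sin (phi x) * psi0 x).
  apply: (primitive_comp (h' := fun y => - sin y) pphi).
  by move=> x; apply: cvgN; exact: csin.
have psin : primitive (fun x => sin (phi x)) (fun x => cos (phi x) * psi0 x).
  exact: (primitive_comp (h' := cos) pphi).
have pF := primitiveB (primitiveM p2 pcos) (primitiveM p1 psin).
have F0 : (fun x => v2 x * cos (phi x) - v1 x * sin (phi x)) = (fun=> 0).
  by apply/funext => x; rewrite v1E v2E; ring.
rewrite F0 in pF.
have := primitive_ae_unique pF (primitive_cst 0).
apply: filterS; first exact: (ae_filter_ringOfSetsType mu).
move=> x; rewrite /dphase etaE v1E v2E => H.
have r0 := lt0r_neq0 (rho2_gt0 x).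
have rn : rho x != 0 by move: r0; rewrite expf_eq0.
have cs := cos2Dsin2 (phi x).
have H2 : rho x * psi0 x * (cos (phi x) ^+ 2 + sin (phi x) ^+ 2) =
   g2 x * cos (phi x) - g1 x * sin (phi x).
  apply/eqP; rewrite eq_sym -subr_eq0 -H; apply/eqP; ring.
rewrite cs mulr1 in H2.
have -> : rho x * cos (phi x) * g2 x - rho x * sin (phi x) * g1 x =
   rho x * (g2 x * cos (phi x) - g1 x * sin (phi x)) by ring.
by rewrite -H2; field.
Qed.

Lemma locL1_dphase : locL1 dphase.
Proof.
have ceta := primitive_continuous (primitive_eta p1 p2).
have ci : continuous (fun x => (1 - eta v1 v2 x)^-1).
  move=> x; apply: cvgV; first by rewrite lt0r_neq0// subr_gt0.
  by apply: cvgB; [exact: cvg_cst|exact: ceta].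
have c1 : continuous (fun x => v1 x / (1 - eta v1 v2 x)).
  by move=> x; apply: cvgM; [exact: (primitive_continuous p1)|exact: ci].
have c2 : continuous (fun x => v2 x / (1 - eta v1 v2 x)).
  by move=> x; apply: cvgM; [exact: (primitive_continuous p2)|exact: ci].
have := locL1B (locL1M c1 (primitive_locL1 p2)) (locL1M c2 (primitive_locL1 p1)).
by congr locL1; apply/funext => x; rewrite /dphase; ring.
Qed.

Lemma primitive_dphase : primitive phi dphase.
Proof. exact: primitive_ae pphi locL1_dphase dphase_ae. Qed.

(** Lagrange's identity: [|v|^2 |v'|^2] is the sum of the squares of the scalar product and of the
    determinant of [v] and [v'], which are [- deta / 2] and [(1 - eta) * dphase]. *)
Lemma edens_hdens x : edens v1 v2 g1 g2 x =
  hdens (eta v1 v2) (deta v1 v2 g1 g2) dphase x.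
Proof.
have r0 : 1 - eta v1 v2 x != 0 by rewrite lt0r_neq0// subr_gt0.
have e : 1 - eta v1 v2 x = v1 x ^+ 2 + v2 x ^+ 2 by rewrite /eta; ring.
rewrite /hdens /edens /dphase /deta; set r := 1 - eta v1 v2 x in r0 e *.
have -> : 2^-1 * (g1 x ^+ 2 + g2 x ^+ 2) =
  2^-1 * (g1 x ^+ 2 + g2 x ^+ 2) * (v1 x ^+ 2 + v2 x ^+ 2) / r.
  by rewrite -e mulfK.
by field.
Qed.

End Hydrodynamics.

Section Complex.
Context {R : realType}.
Local Notation mu := (@lebesgue_measure R).
Implicit Types v : R -> R[i].

Lemma sqr_cmod (z : R[i]) : cmod z ^+ 2 = complex.Re z ^+ 2 + complex.Im z ^+ 2.
Proof.
by case: z => x y; rewrite /cmod /= sqr_sqrtr// addr_ge0// sqr_ge0.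
Qed.

Lemma cmod_ge0 (z : R[i]) : 0 <= cmod z.
Proof. by case: z => x y; rewrite /cmod /= sqrtr_ge0. Qed.

Definition rv v x := complex.Re (v x).
Definition iv v x := complex.Im (v x).
Definition drv v := wderiv (rv v).
Definition div v := wderiv (iv v).

Lemma eta_cmod v x : 1 - cmod (v x) ^+ 2 = eta (rv v) (iv v) x.
Proof. by rewrite sqr_cmod. Qed.

Lemma energy_density_edens v x :
  energy_density v x = edens (rv v) (iv v) (drv v) (div v) x.
Proof. by rewrite /energy_density eta_cmod sqr_cmod. Qed.

Lemma wderiv_cst0 : {ae mu, forall x, wderiv (cst (0 : R)) x = 0}.
Proof.
have H : H1loc (cst (0 : R)).
  apply/H1locP; split; first by move=> x; exact: cvg_cst.
  exists (cst 0); last exact: primitive_cst.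
  by apply: sqrL1_continuous => x; exact: cvg_cst.
have [_ pw] := wderivP H.
exact: primitive_ae_unique pw (primitive_cst 0).
Qed.

(** Were there no phase, [phase v] would be the default [cst 0], whose weak derivative vanishes
    almost everywhere, and the momentum would be 0. As [p > 0], the maps of a minimizing sequence
    have nonzero momentum eventually. *)
Lemma momentum_is_phase v : H1locC v -> momentum v != 0 -> is_phase v (phase v).
Proof.
move=> [H1 H2] Mv; have [ex|nex] := pselect (exists phi, is_phase v phi).
  exact: (xgetPex (cst 0) ex).
exfalso; move/eqP: Mv; apply; rewrite /momentum /phase.
have -> : xget (cst 0) [set phi | is_phase v phi] = cst 0.
  by case: xgetP => // phi _ h; exfalso; apply: nex; exists phi.
have [_ p1] := wderivP H1; have [_ p2] := wderivP H2.
have ceta := primitive_continuous (primitive_eta p1 p2).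
have H0 : H1loc (cst (0 : R)).
  apply/H1locP; split; first by move=> x; exact: cvg_cst.
  exists (cst 0); last exact: primitive_cst.
  by apply: sqrL1_continuous => x; exact: cvg_cst.
have [_ pw] := wderivP H0.
rewrite /Rintegral (@ae_eq_integral _ _ _ _ _ (fun=> 0%E))//.
- by rewrite integral0 mulr0.
- apply/measurable_EFinP; apply: measurable_funM.
    have := continuous_meas ceta; congr measurable_fun.
    by apply/funext => x; rewrite eta_cmod.
  by case: (primitive_locL1 pw).
- have [N [mN N0 sN]] := wderiv_cst0; exists N; split=> // x /= nx.
  by apply: sN => /= w0; apply: nx => _; rewrite w0 mulr0.
Qed.

End Complex.

(** * The minimum over the speeds *)

Section AngleFunctions.
Context {R : realType}.
Implicit Types al p : R.

(* (a, k) = (sin al, cos al) are the parameters of a soliton;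
   [angle_momentum al] is its momentum. *)
Definition angle_momentum al := pi / 2 - al - sin al * cos al.

(* A map of momentum p whose eta has maximum (cos al)^2 has at least this
   energy; see [angle_energyE]. *)
Definition angle_energy p al := Num.sqrt 2 *
  (sin al * p + cos al - cos al ^+ 3 / 3 - sin al * (pi / 2 - al)).

Lemma is_derive_angle_momentum al :
  is_derive al (1 : R) angle_momentum (- (2 * cos al ^+ 2)).
Proof.
have -> : angle_momentum = (fun x => pi / 2 - x - sin x * cos x) by [].
apply: is_derive_eq; rewrite /GRing.scale/=.
have h : sin al * sin al = 1 - cos al ^+ 2 by rewrite -(cos2Dsin2 al); ring.
transitivity (- 1 + sin al * sin al - cos al ^+ 2); first by ring.
by rewrite h; ring.
Qed.

(** The factor [p - angle_momentum al] changes sign once, [angle_momentum] being decreasing: the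
    minimum is at the soliton of momentum [p]. *)
Lemma is_derive_angle_energy p al : is_derive al (1 : R) (angle_energy p)
  (Num.sqrt 2 * cos al * (p - angle_momentum al)).
Proof.
have -> : angle_energy p = (fun x => Num.sqrt 2 *
  (sin x * p + cos x - cos x ^+ 3 / 3 - sin x * (pi / 2 - x))) by [].
apply: is_derive_eq.
rewrite /GRing.scale /= /angle_momentum.
by field.
Qed.

Variables al p : R.
Hypothesis al_bd : 0 < al < pi / 2.
Hypothesis al_p : angle_momentum al = p.

Let cos_gt0 (b : R) : 0 <= b -> b < pi / 2 -> 0 < cos b.
Proof.
move=> b0 b1; apply: cos_gt0_pihalf; rewrite b1 andbT.
by rewrite (lt_le_trans _ b0)// oppr_lt0 divr_gt0// pi_gt0.
Qed.

Let angle_momentum_decr (x y : R) : 0 <= x -> x < y -> y <= pi / 2 ->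
  angle_momentum y < angle_momentum x.
Proof.
move=> x0 xy y1; apply: (@ltr0_derive1_lt_cc R angle_momentum x y).
- by move=> z _; case: (is_derive_angle_momentum z).
- move=> z; rewrite in_itv/= => /andP[xz zy].
  rewrite derive1E; case: (is_derive_angle_momentum z) => _ ->.
  rewrite oppr_lt0 mulr_gt0// exprn_gt0// cos_gt0//; first exact: le_trans x0 (ltW xz).
  exact: lt_le_trans zy y1.
- apply: continuous_subspaceT => z.
  by case: (is_derive_angle_momentum z) => /derivable1_diffP /differentiable_continuous.
- by rewrite in_itv/= lexx (ltW xy).
- by rewrite in_itv/= lexx (ltW xy).
- exact: xy.
Qed.

Lemma angle_energy_decr (x y : R) : 0 <= x -> x < y -> y <= al ->
  angle_energy p y < angle_energy p x.
Proof.
have /andP[al0 al1] := al_bd.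
move=> x0 xy y1; apply: (@ltr0_derive1_lt_cc R (angle_energy p) x y).
- by move=> z _; case: (is_derive_angle_energy p z).
- move=> z; rewrite in_itv/= => /andP[xz zy].
  rewrite derive1E; case: (is_derive_angle_energy p z) => _ ->.
  have z0 : 0 <= z by exact: le_trans x0 (ltW xz).
  have zal : z < al by exact: lt_le_trans zy y1.
  rewrite pmulr_rlt0 ?subr_lt0 -?al_p; first exact: angle_momentum_decr (ltW al1).
  by rewrite mulr_gt0 ?sqrtr_gt0// cos_gt0// (lt_trans zal).
- apply: continuous_subspaceT => z.
  by case: (is_derive_angle_energy p z) => /derivable1_diffP /differentiable_continuous.
- by rewrite in_itv/= lexx (ltW xy).
- by rewrite in_itv/= lexx (ltW xy).
- exact: xy.
Qed.

Lemma angle_energy_incr (x y : R) : al <= x -> x < y -> y <= pi / 2 ->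
  angle_energy p x < angle_energy p y.
Proof.
have /andP[al0 al1] := al_bd.
move=> x0 xy y1; apply: (@gtr0_derive1_lt_cc R (angle_energy p) x y).
- by move=> z _; case: (is_derive_angle_energy p z).
- move=> z; rewrite in_itv/= => /andP[xz zy].
  rewrite derive1E; case: (is_derive_angle_energy p z) => _ ->.
  have zal : al < z by exact: le_lt_trans x0 xz.
  have z1 : z < pi / 2 by exact: lt_le_trans zy y1.
  rewrite pmulr_rgt0 ?subr_gt0 -?al_p.
    by apply: angle_momentum_decr => //; exact: ltW.
  by rewrite mulr_gt0 ?sqrtr_gt0// cos_gt0// (le_trans (ltW al0) (ltW zal)).
- apply: continuous_subspaceT => z.
  by case: (is_derive_angle_energy p z) => /derivable1_diffP /differentiable_continuous.
- by rewrite in_itv/= lexx (ltW xy).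
- by rewrite in_itv/= lexx (ltW xy).
- exact: xy.
Qed.

Lemma angle_energy_min (e : R) : 0 < e -> exists2 g, 0 < g &
  forall x, 0 <= x -> x <= pi / 2 -> angle_energy p x <= angle_energy p al + g ->
  `|x - al| < e.
Proof.
move=> e0; have /andP[al0 al1] := al_bd.
pose l := Num.max 0 (al - e); pose r := Num.min (pi / 2) (al + e).
have l0 : 0 <= l by rewrite /l le_max lexx.
have lal : l < al by rewrite /l gt_max al0 ltrBlDr ltrDl.
have r1 : r <= pi / 2 by rewrite /r ge_min lexx.
have ral : al < r by rewrite /r lt_min al1 ltrDl.
have dl := angle_energy_decr l0 lal (lexx al).
have dr := angle_energy_incr (lexx al) ral r1.
(* Half the smaller of the two gaps at the ends [l] and [r] of the neighbourhood; monotonicity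
   carries the gap outward. *)
pose g := Num.min (angle_energy p l - angle_energy p al)
  (angle_energy p r - angle_energy p al) / 2.
have g0 : 0 < g by rewrite /g divr_gt0// lt_min !subr_gt0 dl.
exists g => // x x0 x1 xg; rewrite ltNge; apply/negP => ex.
have hl : 2 * g <= angle_energy p l - angle_energy p al.
  by rewrite /g mulrC divfK// ge_min lexx.
have hr : 2 * g <= angle_energy p r - angle_energy p al.
  by rewrite /g mulrC divfK// ge_min lexx orbT.
have [xal|xal] := leP al x.
  move: ex; rewrite ger0_norm ?subr_ge0// => ex.
  have rx : r <= x by rewrite /r ge_min; apply/orP; right; lra.
  have : angle_energy p r <= angle_energy p x.
    move: rx; rewrite le_eqVlt => /predU1P[->//|rx].
    by apply/ltW; apply: angle_energy_incr => //; exact: ltW.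
  by lra.
move: ex; rewrite ltr0_norm ?subr_lt0// => ex.
have xl : x <= l by rewrite /l le_max; apply/orP; right; lra.
have : angle_energy p l <= angle_energy p x.
  move: xl; rewrite le_eqVlt => /predU1P[->//|xl].
  by apply/ltW; apply: angle_energy_decr => //; exact: ltW.
by lra.
Qed.

Lemma angle_energy_near (e : R) : 0 < e -> exists2 g, 0 < g &
  forall x, 0 <= x -> x <= pi / 2 -> angle_energy p x <= angle_energy p al + g ->
  `|sin x - sin al| <= e /\ `|cos x - cos al| <= e.
Proof.
move=> e0.
have H : \forall x \near al, `|sin x - sin al| <= e /\ `|cos x - cos al| <= e.
  have h1 := @cvgr_dist_le _ _ _ _ _ _ _ (@continuous_sin R al) e e0.
  have h2 := @cvgr_dist_le _ _ _ _ _ _ _ (@continuous_cos R al) e e0.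
  near=> x; split; first by rewrite distrC; near: x; exact: h1.
  by rewrite distrC; near: x; exact: h2.
have [e1 /= e10 He1] := (@nbhs_ballP _ _ _ _).1 H.
have [g g0 Hg] := angle_energy_min e10.
exists g => // x x0 x1 xg; apply: He1; rewrite /ball/= distrC; exact: Hg.
Unshelve. all: by end_near. Qed.

Lemma soliton_momentum_angle (b : R) : 0 < b -> b < pi / 2 ->
  soliton_momentum (sin b) (cos b) = angle_momentum b.
Proof.
move=> b0 b1; rewrite /soliton_momentum /angle_momentum.
have -> : cos b / sin b = tan (pi / 2 - b).
  rewrite /tan -[pi / 2 - b]opprB sinN cosN sinBpihalf cosBpihalf opprK.
  by [].
by rewrite tanK// in_itv/=; have := @pi_gt0 R; lra.
Qed.

Lemma angle_energyE (b : R) : 0 < b -> b < pi / 2 ->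
  angle_energy p b = Num.sqrt 2 * sin b * p + 2 * calib_value (sin b) (cos b).
Proof.
move=> b0 b1; rewrite /angle_energy /calib_value.
have h : atan (cos b / sin b) = pi / 2 - b.
  have := soliton_momentum_angle b0 b1; rewrite /soliton_momentum /angle_momentum.
  by move/addIr.
rewrite h; have s2 := @sqrt2K R.
have -> (x : R) : 2 * (x / Num.sqrt 2) = Num.sqrt 2 * x.
  have s0 := lt0r_neq0 (@sqrt2_gt0 R).
  by rewrite -[X in X * (x / _)]s2; field.
by ring.
Qed.

Lemma angle_energy_pihalf : angle_energy p (pi / 2) = Num.sqrt 2 * p.
Proof. by rewrite /angle_energy sin_pihalf cos_pihalf; ring. Qed.

(** The classical energy [(2 - c^2)^(3/2) / 3] of the soliton of speed [c = sqrt 2 * sin al]. *)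
Lemma angle_energy_al : angle_energy p al = 2 * Num.sqrt 2 / 3 * cos al ^+ 3.
Proof.
rewrite /angle_energy -al_p /angle_momentum.
have -> : sin al * (pi / 2 - al - sin al * cos al) + cos al - cos al ^+ 3 / 3
  - sin al * (pi / 2 - al) = cos al * (1 - sin al ^+ 2) - cos al ^+ 3 / 3 by ring.
have -> : 1 - sin al ^+ 2 = cos al ^+ 2 by rewrite -(cos2Dsin2 al); ring.
by field.
Qed.

Lemma angle_exists (b k : R) : 0 < b -> 0 < k -> b ^+ 2 + k ^+ 2 = 1 ->
  exists x, [/\ 0 < x, x < pi / 2, b = sin x & k = cos x].
Proof.
move=> b0 k0 bk; exists (acos k).
have k1 : k < 1.
  by rewrite -(@ltr_pXn2r _ 2)// ?nnegrE ?ltW// expr1n -bk ltrDr exprn_gt0.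
have kN : -1 <= k by rewrite (le_trans _ (ltW k0))// oppr_le0.
have kb : -1 <= k <= 1 by rewrite kN ltW.
split.
- by apply: acos_gt0; rewrite kN k1.
- rewrite -acos0; rewrite -ltr_cos ?in_itv/= ?acos_ge0 ?acos_lepi ?lexx ?ler01 ?oppr_le0 ?ler01//.
  by rewrite !acosK ?in_itv/= ?ler01 ?oppr_le0 ?ler01.
- rewrite sin_acos//; have -> : 1 - k ^+ 2 = b ^+ 2 by rewrite -bk; ring.
  by rewrite sqrtr_sqr gtr0_norm.
- by rewrite acosK// in_itv.
Qed.

End AngleFunctions.

(** * Admissible maps: energy, phase and momentum *)

Section FiniteEnergy.
Context {R : realType}.
Local Notation mu := (@lebesgue_measure R).
Implicit Types v : R -> R[i].

Lemma energy_threshold_lt1 : energy_threshold < 1 :> R.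
Proof.
have s2 := @sqrt2K R; have s0 := @sqrt2_gt0 R.
rewrite /energy_threshold.
suff : Num.sqrt 2 < 3 / 2 :> R by lra.
rewrite -(@ltr_pXn2r _ 2)// ?nnegrE ?ltW//.
rewrite sqr_sqrtr//; lra.
Qed.

Definition vdens v := edens (rv v) (iv v) (drv v) (div v).

Lemma H1locC_primitive v : H1locC v ->
  [/\ primitive (rv v) (drv v), primitive (iv v) (div v),
      sqrL1 (drv v) & sqrL1 (div v)].
Proof.
move=> [h1 h2]; have [s1 p1] := wderivP h1; have [s2 p2] := wderivP h2.
split; [exact: p1|exact: p2|exact: s1|exact: s2].
Qed.

Lemma locL1_edens (v1 v2 g1 g2 : R -> R) : continuous v1 -> continuous v2 ->
  sqrL1 g1 -> sqrL1 g2 -> locL1 (edens v1 v2 g1 g2).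
Proof.
move=> c1 c2 [_ l1] [_ l2].
have ce : continuous (fun x => eta v1 v2 x ^+ 2).
  have c0 : continuous (eta v1 v2).
    move=> x; apply: cvgB; first exact: cvg_cst.
    by apply: cvgD; apply: cvgM; [exact: c1|exact: c1|exact: c2|exact: c2].
  by move=> x; apply: cvgM; exact: c0.
exact: locL1D (locL1Z _ (locL1D l1 l2)) (locL1Z _ (locL1_continuous ce)).
Qed.

Lemma finite_energy v : admissible v ->
  [/\ mu.-integrable setT (EFin \o vdens v),
      energy v = (\int[mu]_x vdens v x)%:E &
      \int[mu]_x vdens v x < energy_threshold].
Proof.
move=> [Hv Ev]; have [p1 p2 s1 s2] := H1locC_primitive Hv.
have le : locL1 (vdens v).
  exact: locL1_edens (primitive_continuous p1) (primitive_continuous p2) s1 s2.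
have EE : energy v = (\int[mu]_x (vdens v x)%:E)%E.
  by rewrite /energy; apply: eq_integral => x _; rewrite energy_density_edens.
have ei : mu.-integrable setT (EFin \o vdens v).
  apply: ge0_integrable; [by case: le|by move=> x; exact: edens_ge0|].
  by rewrite -EE (lt_trans Ev)// ltry.
have EF : energy v = (\int[mu]_x vdens v x)%:E.
  by rewrite EE /Rintegral fineK//; apply: integrable_fin_num.
by split=> //; move: Ev; rewrite EF lte_fin.
Qed.

Section Phase.
Variable v : R -> R[i].
Hypothesis Av : admissible v.
Hypothesis Mv : momentum v != 0.

Let Hv : H1locC v. Proof. by case: Av. Qed.
Let p1 : primitive (rv v) (drv v). Proof. by case: (H1locC_primitive Hv). Qed.
Let p2 : primitive (iv v) (div v). Proof. by case: (H1locC_primitive Hv). Qed.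
Let ei : mu.-integrable setT (EFin \o vdens v). Proof. by case: (finite_energy Av). Qed.
Let iph : is_phase v (phase v). Proof. exact: momentum_is_phase. Qed.

Definition vphase := dphase (rv v) (iv v) (drv v) (div v).

Lemma veta_lt1 x : eta (rv v) (iv v) x < 1.
Proof. by apply: (eta_lt1 p1 p2 ei); case: (finite_energy Av). Qed.

Lemma rv_phase x : rv v x = cmod (v x) * cos (phase v x).
Proof. by rewrite /rv {1}(iph.2 x) /expi /=; ring. Qed.

Lemma iv_phase x : iv v x = cmod (v x) * sin (phase v x).
Proof. by rewrite /iv {1}(iph.2 x) /expi /=; ring. Qed.

Lemma primitive_vphase : primitive (phase v) vphase.
Proof.
have [_ pw] := wderivP iph.1.
exact: (primitive_dphase p1 p2 pw rv_phase iv_phase veta_lt1).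
Qed.

(** [wderiv (phase v)] is an unspecified representative; almost everywhere it is the explicit
    [vphase]. *)
Lemma momentumE : momentum v = 2^-1 * \int[mu]_x (eta (rv v) (iv v) x * vphase x).
Proof.
have [_ pw] := wderivP iph.1.
have ceta := primitive_continuous (primitive_eta p1 p2).
rewrite /momentum; congr (_ * fine _); apply: ae_eq_integral => //.
- have := (locL1M ceta (primitive_locL1 pw)).1; move/measurable_EFinP.
  by congr measurable_fun; apply/funext => x; rewrite eta_cmod.
- by have := (locL1M ceta (primitive_locL1 primitive_vphase)).1; move/measurable_EFinP.
- have [N [mN N0 sN]] := dphase_ae p1 p2 pw rv_phase iv_phase veta_lt1.
  exists N; split=> // x /= nx; apply: sN => /= fgx; apply: nx => _.
  by rewrite fgx eta_cmod.
Qed.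

Lemma vdens_hdens x :
  vdens v x = hdens (eta (rv v) (iv v)) (deta (rv v) (iv v) (drv v) (div v)) vphase x.
Proof. by apply: edens_hdens; exact: veta_lt1. Qed.

End Phase.

End FiniteEnergy.

Section Centering.
Context {R : realType}.
Local Notation mu := (@lebesgue_measure R).
Implicit Types v : R -> R[i].

Lemma integrable_shift (x0 : R) (f : R -> R) : mu.-integrable setT (EFin \o f) ->
  mu.-integrable setT (EFin \o (fun x => f (x + x0))).
Proof.
move=> fi.
exact: (integrable_mp (measurable_shift x0) (@lebesgue_measure_shift R x0) fi).
Qed.

Lemma Rint_shift (x0 : R) (f : R -> R) : measurable_fun setT f ->
  \int[mu]_x f (x + x0) = \int[mu]_x f x.
Proof.
move=> mf; rewrite /Rintegral; congr fine.
by rewrite (integral_shift x0 (f := EFin \o f))//; exact/measurable_EFinP.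
Qed.

(* When [eta <= 0] everywhere, completing the square in [hdens] gives
   [hdens >= eta * psi / sqrt 2] pointwise. *)
Lemma energy_ge_momentum (eta deta psi : R -> R) : continuous eta -> locL1 psi ->
  mu.-integrable setT (EFin \o hdens eta deta psi) -> (forall x, eta x <= 0) ->
  Num.sqrt 2 * (2^-1 * \int[mu]_x (eta x * psi x)) <=
  \int[mu]_x hdens eta deta psi x.
Proof.
move=> ceta lpsi hi eta0; have s2 := @sqrt2K R; have s0 := @sqrt2_gt0 R.
have lep : locL1 (fun x => eta x * psi x) by exact: locL1M.
have hb x : psi x ^+ 2 / 2 + eta x ^+ 2 / 4 <= hdens eta deta psi x.
  have e0 := eta0 x; rewrite /hdens.
  have h1 : 0 <= deta x ^+ 2 / (8 * (1 - eta x)).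
    by rewrite divr_ge0 ?sqr_ge0//; lra.
  have h2 : 0 <= psi x ^+ 2 := sqr_ge0 _.
  by nra.
(* Used with [c = 1] and [c = -1], for which the last term vanishes: this bounds the momentum
   density in absolute value and so gives its integrability. *)
have tE x c : psi x ^+ 2 / 2 + eta x ^+ 2 / 4 - c * (Num.sqrt 2 / 2 * (eta x * psi x)) =
  (psi x - c * (Num.sqrt 2 / 2) * eta x) ^+ 2 / 2 + (1 - c ^+ 2) * eta x ^+ 2 / 4.
  have h : (Num.sqrt 2 / 2) ^+ 2 = 1 / 2 :> R by rewrite expr_div_n expr2 s2; field.
  transitivity (psi x ^+ 2 / 2 + eta x ^+ 2 / 4 - c * (Num.sqrt 2 / 2 * (eta x * psi x))
    + c ^+ 2 * eta x ^+ 2 / 2 * ((Num.sqrt 2 / 2) ^+ 2 - 1 / 2)).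
    by rewrite h; ring.
  by field.
have ab x : `|Num.sqrt 2 / 2 * (eta x * psi x)| <= hdens eta deta psi x.
  apply: le_trans (hb x); rewrite ler_norml; apply/andP; split.
    have := tE x (-1); rewrite sqrrN expr1n subrr !mul0r addr0 => h.
    have : 0 <= (psi x - -1 * (Num.sqrt 2 / 2) * eta x) ^+ 2 / 2.
      by rewrite divr_ge0// sqr_ge0.
    by rewrite -h; lra.
  have := tE x 1; rewrite expr1n subrr !mul0r addr0 => h.
  have : 0 <= (psi x - 1 * (Num.sqrt 2 / 2) * eta x) ^+ 2 / 2.
    by rewrite divr_ge0// sqr_ge0.
  by rewrite -h; lra.
have li : locL1 (fun x => Num.sqrt 2 / 2 * (eta x * psi x)) by exact: locL1Z.
have ii : mu.-integrable setT (EFin \o (fun x => Num.sqrt 2 / 2 * (eta x * psi x))).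
  exact: le_integrable_ge0 li.1 hi ab.
have i2 : mu.-integrable setT (EFin \o (fun x => eta x * psi x)).
  have := integrableZl measurableT (2 / Num.sqrt 2) ii.
  congr (_.-integrable _ _); apply/funext => x /=; congr EFin.
  by field; rewrite lt0r_neq0.
have -> : Num.sqrt 2 * (2^-1 * \int[mu]_x (eta x * psi x)) =
   Num.sqrt 2 / 2 * \int[mu]_x (eta x * psi x) by ring.
rewrite -RintegralZl//; apply: le_Rintegral => // x _.
exact: le_trans (ler_norm _) (ab x).
Qed.

End Centering.

(** * Stability of the soliton *)

Section NearMinimizers.
Context {R : realType}.
Local Notation mu := (@lebesgue_measure R).
Implicit Types v : R -> R[i].

Local Notation veta v := (eta (rv v) (iv v)).
Local Notation vdeta v := (deta (rv v) (iv v) (drv v) (div v)).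

(** The excess equals, up to [3 / 2 * d], the energy minus [angle_energy p x], where
    [(b, kap) = (sin x, cos x)]. Its nonnegativity makes [x] an almost minimizer of
    [angle_energy p], hence close to [al]; minimality of [al] in turn makes the excess small. *)
Lemma near_minimizer (al p D : R) : 0 < al < pi / 2 -> angle_momentum al = p ->
  0 < p -> 0 < D -> exists2 d, 0 < d & forall v, admissible v ->
  \int[mu]_x vdens v x <= angle_energy p al + d -> `|momentum v - p| <= d ->
  momentum v != 0 /\ exists x0 b kap, near_soliton (sin al) (cos al) D b kap
    (fun x => veta v (x + x0)) (fun x => vdeta v (x + x0)) (fun x => vphase v (x + x0)).
Proof.
move=> al_bd al_p p0 D0; have /andP[al0 al1] := al_bd.
have s0 := @sqrt2_gt0 R; have s2 := @sqrt2K R.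
have s1 : Num.sqrt 2 <= 3 / 2 :> R by move: s0 s2; clear; nra.
have [g g0 Hg] := angle_energy_near al_bd al_p D0.
have gap : 0 < angle_energy p (pi / 2) - angle_energy p al.
  by rewrite subr_gt0; apply: (angle_energy_incr al_bd al_p).
have [d d0 [dg dD dp dgap]] : exists2 d, 0 < d & [/\ 3 * d <= g, 3 * d <= D,
    2 * d <= p & 3 * d < angle_energy p (pi / 2) - angle_energy p al].
  set G := _ - _ in gap *.
  pose m := Num.min (Num.min g D) (Num.min p G).
  have m0 : 0 < m by rewrite !lt_min g0 D0 p0.
  have [mg mD mp mG] : [/\ m <= g, m <= D, m <= p & m <= G].
    by rewrite /m !ge_min !lexx ?orbT.
  by exists (m / 4); [rewrite divr_gt0|split; lra].
exists d => // v Av Ed Md.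
have Mn : momentum v != 0.
  apply: contraTneq Md => ->; rewrite sub0r normrN gtr0_norm// -ltNge; lra.
split=> //.
have [ei _ Eth] := finite_energy Av.
have Hv : H1locC v by case: Av.
have [p1 p2 _ _] := H1locC_primitive Hv.
have pe : primitive (veta v) (vdeta v) := primitive_eta p1 p2.
have pph := primitive_vphase Av Mn.
have lps := primitive_locL1 pph.
have ME := momentumE Av Mn.
have dE : vdens v = hdens (veta v) (vdeta v) (vphase v).
  by apply/funext => x; exact: vdens_hdens.
have E1 : \int[mu]_x vdens v x <= 1.
  exact/ltW/(lt_trans Eth)/energy_threshold_lt1.
(* If [eta <= 0] everywhere there is no positive maximum to centre at. Then the energy is at least
   [sqrt 2] times the momentum, close to [angle_energy p (pi / 2)], which exceeds the minimum by
   more than [3 * d]. *)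
have [neg|pos] := pselect (forall x, veta v x <= 0).
  exfalso.
  have hi : mu.-integrable setT (EFin \o hdens (veta v) (vdeta v) (vphase v)).
    by rewrite -dE.
  have := energy_ge_momentum (primitive_continuous pe) lps hi neg.
  rewrite -ME -dE => h; rewrite angle_energy_pihalf in dgap.
  by move: Md; rewrite ler_norml => /andP[Md _]; nra.
have [x1 x1p] : exists x1, 0 < veta v x1.
  apply/not_existsP => ne; apply: pos => x; rewrite leNgt; apply/negP; exact: ne.
have [x0 Hx0] := eta_max p1 p2 ei x1p.
have x0p : 0 < veta v x0 by exact: lt_le_trans x1p (Hx0 x1).
have x01 : veta v x0 < 1 by exact: veta_lt1.
pose kap := Num.sqrt (veta v x0); pose b := Num.sqrt (1 - veta v x0).
have kap2 : kap ^+ 2 = veta v x0 by rewrite sqr_sqrtr// ltW.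
have b2 : b ^+ 2 = 1 - veta v x0 by rewrite sqr_sqrtr// subr_ge0 ltW.
have kap0 : 0 < kap by rewrite sqrtr_gt0.
have b0 : 0 < b by rewrite sqrtr_gt0 subr_gt0.
have bk : b ^+ 2 + kap ^+ 2 = 1 by rewrite b2 kap2 subrK.
exists x0, b, kap.
pose e x := veta v (x + x0); pose de x := vdeta v (x + x0).
pose ps x := vphase v (x + x0).
have hE : hdens e de ps = (fun x => vdens v (x + x0)).
  by apply/funext => x; rewrite dE.
have hi : mu.-integrable setT (EFin \o hdens e de ps).
  by rewrite hE; exact: integrable_shift.
have IE : \int[mu]_x hdens e de ps x = \int[mu]_x vdens v x.
  rewrite hE; apply: (Rint_shift x0 (f := vdens v)).
  by have := measurable_int _ ei => /measurable_EFinP.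
have IM : 2^-1 * \int[mu]_x (e x * ps x) = momentum v.
  rewrite ME; congr (_ * _).
  apply: (Rint_shift x0 (f := fun x => veta v x * vphase v x)).
  exact: (locL1M (primitive_continuous pe) lps).1.
have pes : primitive e de := primitive_shift x0 pe.
have lpss : locL1 ps by exact: locL1_shift.
have elow x : -15 <= e x by apply: (eta_lower p1 p2 ei).
have ehi x : e x <= kap ^+ 2 by rewrite kap2; exact: Hx0.
have e0 : e 0 = kap ^+ 2 by rewrite kap2 /e add0r.
have xc0 := excess_ge0 b0 kap0 bk pes lpss hi elow ehi e0.
have [x [x0' x1' bE kE]] := angle_exists b0 kap0 bk.
have xE : excess b kap e de ps =
   \int[mu]_x vdens v x - Num.sqrt 2 * b * momentum v - 2 * calib_value b kap.
  by rewrite /excess IE IM.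
have aE : angle_energy p x = Num.sqrt 2 * b * p + 2 * calib_value b kap.
  by rewrite (angle_energyE p x0' x1') -bE -kE.
have b1 : b <= 1 by move: bk b0; have := sqr_ge0 kap; clear; nra.
have sb : Num.sqrt 2 * b * (p - momentum v) <= 3 / 2 * d.
  have := Md; rewrite ler_norml => /andP[m1 m2].
  have sb0 : 0 <= Num.sqrt 2 * b by rewrite mulr_ge0// ltW.
  have sb1 : Num.sqrt 2 * b <= 3 / 2 by move: s1 s0 b0 b1; clear; nra.
  apply: (@le_trans _ _ (Num.sqrt 2 * b * d)); first by apply: ler_wpM2l => //; move: m1; clear; lra.
  by apply: ler_wpM2r => //; exact: ltW.
have xle : excess b kap e de ps <= angle_energy p al - angle_energy p x + 5 / 2 * d.
  by rewrite xE aE; move: Ed sb; clear; lra.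
have near_al : angle_energy p x <= angle_energy p al + g.
  by move: xle xc0 dg d0; rewrite -/(excess b kap e de ps); clear; lra.
have [bD kD] := Hg x (ltW x0') (ltW x1') near_al.
have xmin : angle_energy p al <= angle_energy p x.
  have [lt|lt|->//] := ltgtP x al.
    exact/ltW/(angle_energy_decr al_bd al_p (ltW x0') lt (lexx al)).
  exact/ltW/(angle_energy_incr al_bd al_p (lexx al) lt (ltW x1')).
constructor => //.
- by rewrite IE.
- by change (excess b kap e de ps <= D); move: xle xmin dD d0; clear; lra.
- by rewrite kE.
- by rewrite bE.
- change (`|2^-1 * \int[mu]_x (e x * ps x) - soliton_momentum (sin al) (cos al)| <= D).
  rewrite IM soliton_momentum_angle// al_p; by apply: le_trans Md _; move: dD d0; clear; lra.
Qed.

End NearMinimizers.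

(** * Convergence of the derivatives in [L^2] *)

Section DerivativeBound.
Context {R : realType}.
Local Notation mu := (@lebesgue_measure R).
Variable k : R.
Hypothesis k0 : 0 < k.
Hypothesis k1 : k <= 1.

Let s0 := @sqrt2_gt0 R.
Let s22 := @sqrt2K R.
Let Y := profile k.
Let e := profile_eta k.
Let e_ge0 x : 0 <= e x. Proof. exact: profile_eta_ge0. Qed.
Let ce : continuous e. Proof. exact: continuous_profile_eta. Qed.
Let cY : continuous Y. Proof. exact: continuous_profile. Qed.

Lemma Rint_profile_eta A B : A <= B ->
  \int[mu]_(x in `[A, B]) e x = Num.sqrt 2 * (Y B - Y A).
Proof.
move=> AB.
have h := primitiveE (primitive_profile k) AB.
rewrite -/Y -/e in h; rewrite -h -itv_intZ.
  by apply: itv_int_eq => x _; field; have := s0; move/lt0r_neq0.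
exact: primitive_locL1 (primitive_profile k).
Qed.

Lemma profile_ndecr A B : A <= B -> Y A <= Y B.
Proof.
move=> AB; have h : 0 <= \int[mu]_(x in `[A, B]) e x.
  by apply: itv_int_ge0 => x _; exact: profile_eta_ge0.
by move: h; rewrite Rint_profile_eta// pmulr_rge0// subr_ge0.
Qed.

Lemma profile_abs_le x : `|Y x| <= k.
Proof.
by rewrite -(@ler_pXn2r _ 2)// ?nnegrE ?(ltW k0)// real_normK ?num_real// sqr_profile_le.
Qed.

Lemma Rint_sqr_profile_eta A B : A <= B -> \int[mu]_(x in `[A, B]) e x ^+ 2 =
  Num.sqrt 2 * (k ^+ 2 * Y B - Y B ^+ 3 / 3) - Num.sqrt 2 * (k ^+ 2 * Y A - Y A ^+ 3 / 3).
Proof.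
move=> AB.
have pQ : primitive (fun x => Num.sqrt 2 * (k ^+ 2 * Y x - Y x ^+ 3 / 3))
   (fun x => Num.sqrt 2 * (k ^+ 2 - Y x ^+ 2) * (e x / Num.sqrt 2)).
  apply: (primitive_comp (h := fun y => Num.sqrt 2 * (k ^+ 2 * y - y ^+ 3 / 3))
     (h' := fun y => Num.sqrt 2 * (k ^+ 2 - y ^+ 2)) (primitive_profile k)).
    by move=> y; apply: is_derive_eq; rewrite /GRing.scale/=; field.
  move=> y; apply: cvgM; first exact: cvg_cst.
  by apply: cvgB; [exact: cvg_cst|apply: cvgM; exact: cY].
rewrite -(primitiveE pQ AB); apply: itv_int_eq => x _.
by rewrite /e /profile_eta -/Y; field; have := s0; move/lt0r_neq0.
Qed.

Section Cross.
Variables (G g : R -> R) (N n : nat) (s t : R).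
Hypothesis pG : primitive G g.
Hypothesis G5 : forall x, `|G x| <= 5.
Hypothesis Gt : forall x, `|x| <= N%:R -> `|G x| <= t.
Hypothesis t0 : 0 <= t.
Hypothesis Nn : (N <= n)%N.
Hypothesis Ns : k - Y N%:R <= s.

Let nN : N%:R <= n%:R :> R. Proof. by rewrite ler_nat. Qed.
Let N0 : 0 <= N%:R :> R. Proof. exact: ler0n. Qed.

(** Only the primitive [G] of [g] is known to be small, and only on [[- N, N]]. Integrating by parts
    moves the derivative to [e], with [e' = - sqrt 2 * Y * e]; outside, [|G| <= 5] and [e] has tails
    of integral at most [sqrt 2 * s]. *)
Lemma cross_term : `|\int[mu]_(x in `[- n%:R, n%:R]) (e x * g x)| <= 40 * s + 4 * t.
Proof.
have hN := nN; have hN0 := N0; have hs := Ns; have ht := t0; have hs0 := s0.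
have hs22 := s22.
have YN := profile_ndecr nN.
have Yn := profile_abs_le n%:R.
have YNk := profile_abs_le N%:R.
have Y0 : 0 <= Y N%:R by apply: profile_ge0; [exact: ltW|].
have Yn0 := le_trans Y0 YN.
rewrite ger0_norm// in Yn; rewrite ger0_norm// in YNk.
have Ynn x : Y (- x) = - Y x by exact: profileN.
have lg := primitive_locL1 pG.
have leg : locL1 (fun x => e x * g x) by exact: locL1M.
have cG := primitive_continuous pG.
have cYe : continuous (fun x => Y x * e x * G x).
  by move=> x; apply: cvgM; [apply: cvgM; [exact: cY|exact: ce]|exact: cG].
have lYe := locL1_continuous cYe.
have nn : - n%:R <= n%:R :> R by lra.
have pM := primitiveM (primitive_profile_eta k) pG.
have EI : \int[mu]_(x in `[- n%:R, n%:R]) (e x * g x) =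
  e n%:R * G n%:R - e (- n%:R) * G (- n%:R)
  + Num.sqrt 2 * \int[mu]_(x in `[- n%:R, n%:R]) (Y x * e x * G x).
  rewrite -(primitiveE pM nn) -itv_intZ// -itv_intD; [|exact: (primitive_locL1 pM)|exact: locL1Z].
  by apply: itv_int_eq => x _; rewrite -/Y -/e; ring.
have en : e n%:R <= 2 * s.
  have -> : e n%:R = (k - Y n%:R) * (k + Y n%:R) by rewrite /e /profile_eta -/Y; ring.
  have := k1; nra.
have part A B c : A <= B -> 0 <= c -> (forall x, A <= x <= B -> `|G x| <= c) ->
    \int[mu]_(x in `[A, B]) `|Y x * e x * G x| <= c * (Num.sqrt 2 * (Y B - Y A)).
  move=> AB c0 Gc; rewrite -Rint_profile_eta// -itv_intZ; last exact: locL1_continuous.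
  apply: itv_int_le; [exact: locL1_norm|exact/locL1Z/locL1_continuous|].
  move=> x xAB; have eg := e_ge0 x.
  rewrite normrM (normrM (Y x)) [`|e x|]ger0_norm//.
  have h1 := le_trans (profile_abs_le x) k1; have h2 := Gc x xAB.
  rewrite -/Y in h1.
  have h3 : `|Y x| * `|G x| <= c by rewrite -[c]mul1r; apply: ler_pM.
  have -> : `|Y x| * e x * `|G x| = (`|Y x| * `|G x|) * e x by ring.
  exact: ler_wpM2r.
have I3 : \int[mu]_(x in `[- n%:R, n%:R]) `|Y x * e x * G x| <=
    10 * Num.sqrt 2 * s + 2 * Num.sqrt 2 * t.
  have ln := locL1_norm lYe.
  rewrite (itv_int_split (b := - N%:R) ln); [|lra|lra].
  rewrite (itv_int_split (a := - N%:R) (b := N%:R) ln); [|lra|lra].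
  have A1 : \int[mu]_(x in `[- n%:R, - N%:R]) `|Y x * e x * G x| <= 5 * (Num.sqrt 2 * s).
    apply: (le_trans (@part _ _ 5 _ _ _)) => //; first lra.
    by rewrite ler_pM2l// ler_pM2l// !Ynn; lra.
  have A3 : \int[mu]_(x in `[N%:R, n%:R]) `|Y x * e x * G x| <= 5 * (Num.sqrt 2 * s).
    apply: (le_trans (@part _ _ 5 _ _ _)) => //.
    by rewrite ler_pM2l// ler_pM2l//; lra.
  have A2 : \int[mu]_(x in `[- N%:R, N%:R]) `|Y x * e x * G x| <= t * (Num.sqrt 2 * 2).
    apply: (le_trans (@part _ _ t _ _ _)) => //; first lra.
      by move=> x; rewrite -ler_norml => /Gt.
    apply: ler_wpM2l => //; rewrite ler_pM2l// Ynn.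
    by have := k1; lra.
  lra.
rewrite EI; apply: (le_trans (ler_normD _ _)).
have B1 : `|e n%:R * G n%:R - e (- n%:R) * G (- n%:R)| <= 20 * s.
  have eN : e (- n%:R) = e n%:R by exact: profile_etaN.
  apply: (le_trans (ler_normB _ _)); rewrite eN (normrM (e n%:R) (G n%:R)) (normrM (e n%:R)) [`|e _|]ger0_norm//.
  have g1 := G5 n%:R; have g2 := G5 (- n%:R); have e1 := e_ge0 n%:R.
  rewrite -mulrDr; apply: (@le_trans _ _ (2 * s * 10)); last lra.
  by apply: ler_pM => //; lra.
have B2 : `|Num.sqrt 2 * \int[mu]_(x in `[- n%:R, n%:R]) (Y x * e x * G x)| <=
   20 * s + 4 * t.
  rewrite normrM gtr0_norm//.
  have : Num.sqrt 2 * `|\int[mu]_(x in `[- n%:R, n%:R]) (Y x * e x * G x)| <=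
     Num.sqrt 2 * (10 * Num.sqrt 2 * s + 2 * Num.sqrt 2 * t).
    rewrite ler_pM2l//; apply: le_trans I3; exact: itv_int_norm.
  have -> : Num.sqrt 2 * (10 * Num.sqrt 2 * s + 2 * Num.sqrt 2 * t) =
    (Num.sqrt 2 * Num.sqrt 2) * (10 * s + 2 * t) by ring.
  by rewrite hs22; lra.
by move: B1 B2; lra.
Qed.

End Cross.
End DerivativeBound.

Section SolitonDerivative.
Context {R : realType}.
Local Notation mu := (@lebesgue_measure R).

(** Convergence of norms and weak convergence give strong convergence. The squared distance expands
    into an energy term, a term in [eta - profile_eta] and the scalar product treated by
    [cross_term]; an upper bound on the energy suffices. *)
Lemma near_derivative (a k t : R) : 0 < a -> 0 < k -> a ^+ 2 + k ^+ 2 = 1 -> 0 < t -> exists N : nat, exists2 t1, 0 < t1 &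
  forall (w1 w2 h1 h2 : R -> R) C S, C ^+ 2 + S ^+ 2 = 1 ->
  primitive w1 h1 -> primitive w2 h2 -> sqrL1 h1 -> sqrL1 h2 ->
  mu.-integrable setT (EFin \o edens w1 w2 h1 h2) ->
  \int[mu]_x edens w1 w2 h1 h2 x <= 2 * Num.sqrt 2 / 3 * k ^+ 3 + t1 ->
  (forall x, -15 <= eta w1 w2 x) ->
  (forall x, `|x| <= N%:R -> (w1 x - (C * profile k x + S * a)) ^+ 2 +
                             (w2 x - (S * profile k x - C * a)) ^+ 2 <= t1) ->
  (forall n : nat, \int[mu]_(x in `[- n%:R, n%:R])
                     (eta w1 w2 x - profile_eta k x) ^+ 2 <= t1) ->
  forall n : nat, \int[mu]_(x in `[- n%:R, n%:R])
    ((h1 x - C * (profile_eta k x / Num.sqrt 2)) ^+ 2 +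
     (h2 x - S * (profile_eta k x / Num.sqrt 2)) ^+ 2) <= t.
Proof.
move=> a0 k0 ak t0; have s0 := @sqrt2_gt0 R; have s22 := @sqrt2K R.
have s32 : Num.sqrt 2 <= 3 / 2 :> R by move: s0 s22; clear; nra.
have k1 : k <= 1.
  by rewrite -(@ler_pXn2r _ 2)// ?nnegrE ?(ltW k0)// expr1n -ak lerDr sqr_ge0.
have sp : 0 < t / 200 by rewrite divr_gt0 ?ltr0n.
have [N [HN _]] := soliton_tail a0 k0 sp.
exists N; pose t1 := Num.min ((t / 50) ^+ 2) (t / 16).
have t10 : 0 < t1 by rewrite lt_min exprn_gt0 ?divr_gt0.
exists t1 => // w1 w2 h1 h2 C S CS p1 p2 q1 q2 ei Ele low near L2.
have t1a : t1 <= (t / 50) ^+ 2 by rewrite ge_min lexx.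
have t1b : t1 <= t / 16 by rewrite ge_min lexx orbT.
pose f x := (h1 x - C * (profile_eta k x / Num.sqrt 2)) ^+ 2 +
     (h2 x - S * (profile_eta k x / Num.sqrt 2)) ^+ 2.
have ceta := primitive_continuous (primitive_eta p1 p2).
have ces : continuous (profile_eta k) := @continuous_profile_eta R k.
have f0 x : 0 <= f x by rewrite addr_ge0// sqr_ge0.
have lf : locL1 f.
  have cc c : continuous (fun x => - c * (profile_eta k x / Num.sqrt 2)).
    move=> x; apply: cvgM; first exact: cvg_cst.
    by apply: cvgM; [exact: ces|exact: cvg_cst].
  have [_ l1] := sqrL1D q1 (sqrL1_continuous (cc C)).
  have [_ l2] := sqrL1D q2 (sqrL1_continuous (cc S)).
  have := locL1D l1 l2; congr locL1; apply/funext => x; rewrite /f; ring.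
suff H n : (N <= n)%N -> \int[mu]_(x in `[- n%:R, n%:R]) f x <= t.
  move=> n; apply: le_trans (H (maxn n N) (leq_maxr _ _)).
  have hn : n%:R <= (maxn n N)%:R :> R by rewrite ler_nat leq_maxl.
  have hn0 : 0 <= n%:R :> R := ler0n _ _.
  apply: itv_int_sub => //; first by rewrite lerN2.
  by rewrite (le_trans _ hn0)// oppr_le0.
move=> Nn.
have nn : - n%:R <= n%:R :> R by have : 0 <= n%:R :> R := ler0n _ _; clear; lra.
(* The component of the map along the direction [(C, S)] in which the rotated soliton moves, minus
   that of the soliton: the terms in [a] cancel. *)
pose G x := C * w1 x + S * w2 x - profile k x.
pose g x := C * h1 x + S * h2 x - profile_eta k x / Num.sqrt 2.
have pG : primitive G g.
  exact: primitiveB (primitiveD (primitiveZ C p1) (primitiveZ S p2)) (primitive_profile k).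
have lam0 : 0 < t / 16 by rewrite divr_gt0.
have lamn : t / 16 != 0 by rewrite lt0r_neq0.
have fle x : f x <= 2 * edens w1 w2 h1 h2 x - (1 - t / 32) * profile_eta k x ^+ 2
   + 8 / t * (eta w1 w2 x - profile_eta k x) ^+ 2 - Num.sqrt 2 * (profile_eta k x * g x).
  rewrite /f /g /edens; set E := eta w1 w2 x; set e := profile_eta k x.
  set u1 := h1 x; set u2 := h2 x.
  have key : 2 * (2^-1 * (u1 ^+ 2 + u2 ^+ 2) + 4^-1 * E ^+ 2) - (1 - t / 32) * e ^+ 2
     + 8 / t * (E - e) ^+ 2 - Num.sqrt 2 * (e * (C * u1 + S * u2 - e / Num.sqrt 2))
   - ((u1 - C * (e / Num.sqrt 2)) ^+ 2 + (u2 - S * (e / Num.sqrt 2)) ^+ 2) =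
    (E - e) ^+ 2 / 2 + t / 32 * (e + 16 / t * (E - e)) ^+ 2.
    have -> : e / Num.sqrt 2 = Num.sqrt 2 / 2 * e.
      by rewrite -[X in _ / X * _]s22; field; rewrite lt0r_neq0.
    have r2 : Num.sqrt 2 ^+ 2 = 2 :> R by rewrite expr2.
    have -> : (u1 - C * (Num.sqrt 2 / 2 * e)) ^+ 2 + (u2 - S * (Num.sqrt 2 / 2 * e)) ^+ 2 =
      u1 ^+ 2 + u2 ^+ 2 - Num.sqrt 2 * (e * (C * u1 + S * u2))
      + (C ^+ 2 + S ^+ 2) * Num.sqrt 2 ^+ 2 / 4 * e ^+ 2 by field.
    rewrite CS r2.
    have -> : Num.sqrt 2 * (e * (C * u1 + S * u2 - Num.sqrt 2 / 2 * e)) =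
       Num.sqrt 2 * (e * (C * u1 + S * u2)) - Num.sqrt 2 ^+ 2 / 2 * e ^+ 2 by field.
    by rewrite r2; field; rewrite lt0r_neq0.
  rewrite -subr_ge0 key addr_ge0//; first by rewrite divr_ge0// sqr_ge0.
  by rewrite mulr_ge0 ?sqr_ge0// divr_ge0// ltW.
have G5 x : `|G x| <= 5.
  have h := low x; rewrite /eta in h.
  have := profile_abs_le k0 x; rewrite ler_norml => /andP[y1 y2].
  have hD : (C * w1 x + S * w2 x) ^+ 2 <= 16.
    apply: (@le_trans _ _ (w1 x ^+ 2 + w2 x ^+ 2)); last by move: h; clear; lra.
    have -> : w1 x ^+ 2 + w2 x ^+ 2 =
      (C ^+ 2 + S ^+ 2) * (w1 x ^+ 2 + w2 x ^+ 2) by rewrite CS mul1r.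
    rewrite -subr_ge0.
    have -> : (C ^+ 2 + S ^+ 2) * (w1 x ^+ 2 + w2 x ^+ 2) - (C * w1 x + S * w2 x) ^+ 2 =
      (C * w2 x - S * w1 x) ^+ 2 by ring.
    exact: sqr_ge0.
  have : `|C * w1 x + S * w2 x| <= 4.
    by rewrite -(@ler_pXn2r _ 2)// ?nnegrE// real_normK ?num_real//; move: hD; clear; lra.
  rewrite !ler_norml /G => /andP[d1 d2].
  by move: d1 d2 y1 y2 k1; clear; lra.
have Gt x : `|x| <= N%:R -> `|G x| <= t / 50.
  move=> xN; have h := near x xN.
  rewrite -(@ler_pXn2r _ 2)// ?nnegrE ?divr_ge0 ?(ltW t0)// real_normK ?num_real//.
  apply: le_trans t1a; apply: le_trans h.
  set A := w1 x - _; set B := w2 x - _.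
  have -> : G x = C * A + S * B.
    rewrite /G /A /B; rewrite -[profile k x in LHS]mul1r -CS; ring.
  have -> : A ^+ 2 + B ^+ 2 = (C ^+ 2 + S ^+ 2) * (A ^+ 2 + B ^+ 2) by rewrite CS mul1r.
  rewrite -subr_ge0.
  have -> : (C ^+ 2 + S ^+ 2) * (A ^+ 2 + B ^+ 2) - (C * A + S * B) ^+ 2 =
    (C * B - S * A) ^+ 2 by ring.
  exact: sqr_ge0.
have t50 : 0 <= t / 50 by rewrite divr_ge0// ltW.
have X := cross_term k0 k1 pG G5 Gt t50 Nn HN.
have lE : locL1 (edens w1 w2 h1 h2) := locL1_integrable ei.
have le2 : locL1 (fun x => profile_eta k x ^+ 2).
  by apply: locL1_continuous => x; apply: cvgM; exact: ces.
have ld2 : locL1 (fun x => (eta w1 w2 x - profile_eta k x) ^+ 2).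
  apply: locL1_continuous => x.
  by apply: cvgM; (apply: cvgB; [exact: ceta|exact: ces]).
have leg : locL1 (fun x => profile_eta k x * g x) by apply: locL1M => //; case: pG.
apply: (le_trans (itv_int_le lf _ (fun x _ => fle x))).
  by apply: locL1B; [apply: locL1D; [apply: locL1B|]|]; exact: locL1Z.
rewrite itv_intB; [|by apply: locL1D; [apply: locL1B|]; exact: locL1Z|exact: locL1Z].
rewrite itv_intD; [|by apply: locL1B; exact: locL1Z|exact: locL1Z].
rewrite itv_intB; [|exact: locL1Z|exact: locL1Z].
rewrite !itv_intZ//.
have I1 : \int[mu]_(x in `[- n%:R, n%:R]) edens w1 w2 h1 h2 x <=
    2 * Num.sqrt 2 / 3 * k ^+ 3 + t1.
  apply: le_trans Ele; apply: Rint_itv_le => // x; exact: edens_ge0.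
have I3 := L2 n.
(* The leading terms cancel: over the whole line the integral of [profile_eta^2] is
   [4 sqrt 2 / 3 * k^3], twice the energy of the soliton. *)
have [I2a I2b] : \int[mu]_(x in `[- n%:R, n%:R]) profile_eta k x ^+ 2 <=
    4 * Num.sqrt 2 / 3 * k ^+ 3 /\
  4 * Num.sqrt 2 / 3 * k ^+ 3 - 3 * (t / 200) <=
   \int[mu]_(x in `[- n%:R, n%:R]) profile_eta k x ^+ 2.
  rewrite Rint_sqr_profile_eta// profileN.
  have Y1 : k - t / 200 <= profile k n%:R.
    have NnR : N%:R <= n%:R :> R by rewrite ler_nat.
    have := @profile_ndecr R k _ _ NnR.
    by move: HN; clear; lra.
  have Y0 : 0 <= profile k n%:R by apply: profile_ge0; [exact: ltW|].
  have := profile_abs_le k0 n%:R; rewrite ger0_norm// => Yk.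
  move: Y1 Y0 Yk; set y := profile k n%:R => Y1 Y0 Yk.
  have D : 4 * Num.sqrt 2 / 3 * k ^+ 3 -
     (Num.sqrt 2 * (k ^+ 2 * y - y ^+ 3 / 3) -
      Num.sqrt 2 * (k ^+ 2 * - y - (- y) ^+ 3 / 3)) =
     Num.sqrt 2 * (2 / 3 * ((k - y) ^+ 2 * (2 * k + y))) by field.
  have D0 : 0 <= (k - y) ^+ 2 * (2 * k + y).
    by rewrite mulr_ge0 ?sqr_ge0//; move: k0 Y0; clear; lra.
  have D1 : (k - y) ^+ 2 * (2 * k + y) <= t / 200 * 3.
    apply: ler_pM; rewrite ?sqr_ge0//.
    - by move: k0 Y0; clear; lra.
    - apply: (@le_trans _ _ (k - y)); last by move: Y1; clear; lra.
      rewrite expr2 -[leRHS]mulr1; apply: ler_wpM2l; first by rewrite subr_ge0.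
      by move: k1 Y0; clear; lra.
    - by move: k1 Yk; clear; lra.
  have D2 : Num.sqrt 2 * (2 / 3 * ((k - y) ^+ 2 * (2 * k + y))) <= 3 / 2 * (2 / 3 * (t / 200 * 3)).
    apply: ler_pM => //; first by rewrite mulr_ge0.
    by rewrite ler_pM2l.
  have D3 : 0 <= Num.sqrt 2 * (2 / 3 * ((k - y) ^+ 2 * (2 * k + y))).
    by rewrite mulr_ge0// ?(ltW s0)// mulr_ge0.
  by move: D D2 D3; clear; lra.
have k3 : k ^+ 3 <= 1 by rewrite exprn_ile1// ltW.
have k30 : 0 <= k ^+ 3 by rewrite exprn_ge0// ltW.
have E2 : 4 * Num.sqrt 2 / 3 * k ^+ 3 <= 2.
  apply: (@le_trans _ _ (4 * (3 / 2) / 3 * 1)); last by clear; lra.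
  by apply: ler_pM => //; move: s32; clear; lra.
have I4 : 8 / t * \int[mu]_(x in `[- n%:R, n%:R]) (eta w1 w2 x - profile_eta k x) ^+ 2
   <= 8 / 2500 * t.
  apply: (@le_trans _ _ (8 / t * (t / 50) ^+ 2)).
    by apply: ler_wpM2l; [rewrite divr_ge0// ltW|exact: le_trans I3 t1a].
  have -> : 8 / t * (t / 50) ^+ 2 = 8 / 2500 * t by field; rewrite lt0r_neq0.
  exact: lexx.
have I5 : - (Num.sqrt 2 * \int[mu]_(x in `[- n%:R, n%:R]) (profile_eta k x * g x)) <=
   3 / 2 * (40 * (t / 200) + 4 * (t / 50)).
  rewrite -mulrN; apply: (@le_trans _ _ (Num.sqrt 2 * (40 * (t / 200) + 4 * (t / 50)))).
    rewrite ler_pM2l//; apply: le_trans X; rewrite -normrN; exact: ler_norm.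
  by apply: ler_wpM2r => //; move: t0; clear; lra.
have I6 : t / 32 * \int[mu]_(x in `[- n%:R, n%:R]) profile_eta k x ^+ 2 <= t / 32 * 2.
  by apply: ler_wpM2l; [rewrite divr_ge0// ltW|exact: le_trans I2a E2].
move: I1 I2b I4 I5 I6 t1b t0; clear; lra.
Qed.

End SolitonDerivative.

Section Stability.
Context {R : realType}.
Local Notation mu := (@lebesgue_measure R).
Implicit Types v : R -> R[i].

Lemma polar_profile (a k x : R) : 0 < a ->
  Num.sqrt (a ^+ 2 + profile k x ^+ 2) * cos (profile_phase a k x) = a /\
  Num.sqrt (a ^+ 2 + profile k x ^+ 2) * sin (profile_phase a k x) = profile k x.
Proof.
move=> a0; set y := profile k x; have an := lt0r_neq0 a0.
have s0 : 0 < Num.sqrt (1 + (y / a) ^+ 2).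
  by rewrite sqrtr_gt0; have := sqr_ge0 (y / a); move: (_ / _) => z; clear; lra.
have cE : cos (profile_phase a k x) = (Num.sqrt (1 + (y / a) ^+ 2))^-1.
  exact: cos_atan.
have rE : Num.sqrt (a ^+ 2 + y ^+ 2) = a * Num.sqrt (1 + (y / a) ^+ 2).
  rewrite -{2}(ger0_norm (ltW a0)) -sqrtr_sqr -sqrtrM ?sqr_ge0//.
  by congr Num.sqrt; field.
have H1 : Num.sqrt (a ^+ 2 + y ^+ 2) * cos (profile_phase a k x) = a.
  by rewrite cE rE; field; rewrite lt0r_neq0.
split=> //.
have tE : tan (profile_phase a k x) = y / a by rewrite /profile_phase atanK.
have cn : cos (profile_phase a k x) != 0 by rewrite cE invr_neq0// lt0r_neq0.
have -> : sin (profile_phase a k x) = y / a * cos (profile_phase a k x).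
  by rewrite -tE /tan mulfVK.
rewrite mulrCA H1; field; exact: an.
Qed.

(** Law of cosines: the squared distance is [(r - r')^2 + 2 r r' (1 - cos (s - s'))], where
    [(r - r')^2 <= |r^2 - r'^2|] and [2 r r' <= 16 + 1]. *)
Lemma polar_dist (r r' s s' t t' : R) : 0 <= r -> 0 <= r' -> r ^+ 2 <= 16 ->
  r' ^+ 2 <= 1 -> `|r ^+ 2 - r' ^+ 2| <= t -> 1 - cos (s - s') <= t' ->
  (r * cos s - r' * cos s') ^+ 2 + (r * sin s - r' * sin s') ^+ 2 <= t + 17 * t'.
Proof.
move=> r0 r0' r16 r1' rt ct.
have -> : (r * cos s - r' * cos s') ^+ 2 + (r * sin s - r' * sin s') ^+ 2 =
   (r - r') ^+ 2 + 2 * r * r' * (1 - cos (s - s')).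
  rewrite cosB.
  have -> : (r * cos s - r' * cos s') ^+ 2 + (r * sin s - r' * sin s') ^+ 2 =
    r ^+ 2 * (cos s ^+ 2 + sin s ^+ 2) + r' ^+ 2 * (cos s' ^+ 2 + sin s' ^+ 2)
    - 2 * r * r' * (cos s * cos s' + sin s * sin s') by ring.
  by rewrite !cos2Dsin2; ring.
have c0 : 0 <= 1 - cos (s - s') by rewrite subr_ge0 cos_le1.
apply: lerD.
  apply: le_trans rt.
  have -> : r ^+ 2 - r' ^+ 2 = (r - r') * (r + r') by ring.
  rewrite normrM [`|r + r'|]ger0_norm ?addr_ge0// -[_ ^+ 2]ger0_norm ?sqr_ge0//.
  rewrite normrX expr2; apply: ler_wpM2l => //.
  by rewrite ler_norml; move: r0 r0'; clear; lra.
apply: ler_pM => //; first by rewrite !mulr_ge0.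
have := sqr_ge0 (r - r'); move: r16 r1'; clear.
have -> : (r - r') ^+ 2 = r ^+ 2 + r' ^+ 2 - 2 * r * r' by ring.
lra.
Qed.

Lemma cos_near0 (t : R) : 0 < t -> exists2 s, 0 < s &
  forall x, `|x| <= s -> 1 - cos x <= t.
Proof.
move=> t0; have h : \forall x \near (0 : R), `|1 - cos x| <= t.
  by rewrite -cos0; exact: (@cvgr_dist_le _ _ _ _ _ _ _ (@continuous_cos R 0)).
have [s /= s0 H] := (@nbhs_ballP _ _ _ _).1 h.
exists (s / 2); first by rewrite divr_gt0.
move=> x xs; apply: le_trans (ler_norm _) _; apply: H.
rewrite /ball/= sub0r normrN; apply: (le_lt_trans xs); move: s0; clear; lra.
Qed.

(** The target is [exp (i th) * (profile - i * sin al)] in real and imaginary parts. The [L^2]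
    distances are bounded on all [[- n, n]], which makes sense before integrability over the line is
    known. *)
Definition soliton_close (al t L : R) (v : R -> R[i]) (x0 th : R) :=
  [/\ forall x, `|x| <= L ->
        (rv v (x + x0) - (cos th * profile (cos al) x + sin th * sin al)) ^+ 2 +
        (iv v (x + x0) - (sin th * profile (cos al) x - cos th * sin al)) ^+ 2 <= t,
      forall n : nat, \int[mu]_(x in `[- n%:R, n%:R])
        (eta (rv v) (iv v) (x + x0) - profile_eta (cos al) x) ^+ 2 <= t &
      forall n : nat, \int[mu]_(x in `[- n%:R, n%:R])
        ((drv v (x + x0) - cos th * (profile_eta (cos al) x / Num.sqrt 2)) ^+ 2 +
         (div v (x + x0) - sin th * (profile_eta (cos al) x / Num.sqrt 2)) ^+ 2) <= t].

(** The order of choices matters: [near_derivative] fixes [N] and [t1], then [D] is taken so small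
    that [near_soliton] yields the [L^2], uniform and phase bounds, and [near_minimizer] finally
    gives [d]. *)
Lemma stability (al p L t : R) : 0 < al < pi / 2 -> angle_momentum al = p ->
  0 < p -> 0 < t -> exists2 d, 0 < d & forall v, admissible v ->
  \int[mu]_x vdens v x <= angle_energy p al + d -> `|momentum v - p| <= d ->
  exists x0 th, soliton_close al t L v x0 th.
Proof.
move=> al_bd al_p p0 t0; have /andP[al0 al1] := al_bd.
rewrite /soliton_close; set a := sin al; set k := cos al.
have a0 : 0 < a by apply: sin_gt0_pihalf; rewrite al0.
have k0 : 0 < k.
  by apply: cos_gt0_pihalf; rewrite al1 andbT (lt_trans _ al0)// oppr_lt0 divr_gt0// pi_gt0.
have ak : a ^+ 2 + k ^+ 2 = 1 by rewrite addrC cos2Dsin2.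
have [N [t1 t10 Hder]] := near_derivative a0 k0 ak t0.
pose T := Num.min t t1.
have T0 : 0 < T by rewrite lt_min t0.
have Tt : T <= t by rewrite ge_min lexx.
have Tt1 : T <= t1 by rewrite ge_min lexx orbT.
(* Wide enough for both the requested [L] and the interval on which [near_derivative] needs
   closeness. *)
pose L' := Num.max L N%:R + 1.
have LL' : L <= L'.
  apply: (@le_trans _ _ (Num.max L N%:R)); first by rewrite le_max lexx.
  by rewrite lerDl.
have NL' : N%:R <= L'.
  apply: (@le_trans _ _ (Num.max L N%:R)); first by rewrite le_max lexx orbT.
  by rewrite lerDl.
have L'0 : 0 < L' by rewrite ltr_pwDr// le_max ler0n orbT.
have T20 : 0 < T / 2 by rewrite divr_gt0.
have T40 : 0 < T / 34 by rewrite divr_gt0.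
have [s sp cosn] := cos_near0 T40.
near (0 : R)^'+ => D.
have D0 : 0 < D by near: D; exact: nbhs_right_gt.
have HL2 : forall b kap eta deta psi, near_soliton a k D b kap eta deta psi ->
    forall n : nat, \int[mu]_(x in `[- n%:R, n%:R]) (eta x - profile_eta k x) ^+ 2 <= T.
  by near: D; exact: ns_L2.
have HU : forall b kap eta deta psi, near_soliton a k D b kap eta deta psi ->
    forall x, `|eta x - profile_eta k x| <= T / 2.
  by near: D; exact: ns_uniform.
have HP : forall b kap eta deta psi phi, near_soliton a k D b kap eta deta psi ->
    primitive phi psi -> forall x, `|x| <= L' ->
    `|(phi x - phi 0) - (profile_phase a k x - profile_phase a k 0)| <= s.
  by near: D; exact: ns_phase.
have [d d0 Hmin] := near_minimizer al_bd al_p p0 D0.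
exists (Num.min d t1); first by rewrite lt_min d0.
move=> v Av Ev Mv.
have Ev1 : \int[mu]_x vdens v x <= angle_energy p al + d.
  by apply: le_trans Ev _; rewrite lerD2l ge_min lexx.
have Ev2 : \int[mu]_x vdens v x <= angle_energy p al + t1.
  by apply: le_trans Ev _; rewrite lerD2l ge_min lexx orbT.
have Mv1 : `|momentum v - p| <= d by apply: le_trans Mv _; rewrite ge_min lexx.
have [Mn [x0 [b [kap ns]]]] := Hmin v Av Ev1 Mv1.
pose phi x := phase v (x + x0).
have pphi : primitive phi (fun x => vphase v (x + x0)).
  exact: primitive_shift (primitive_vphase Av Mn).
have L2 := HL2 _ _ _ _ _ ns; have U := HU _ _ _ _ _ ns.
have P := HP _ _ _ _ _ _ ns pphi.
(* At the centre the soliton has phase [- pi / 2]. *)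
pose th := phi 0 + pi / 2.
have cth : cos th = - sin (phi 0) by rewrite /th cosDpihalf.
have sth : sin th = cos (phi 0) by rewrite /th sinDpihalf.
have unif x : `|x| <= L' ->
    (rv v (x + x0) - (cos th * profile k x + sin th * a)) ^+ 2 +
    (iv v (x + x0) - (sin th * profile k x - cos th * a)) ^+ 2 <= T.
  move=> xL; rewrite cth sth.
  have [A1 A2] := polar_profile k x a0.
  set r := Num.sqrt _ in A1 A2.
  have r2 : r ^+ 2 = 1 - profile_eta k x.
    by rewrite sqr_sqrtr ?addr_ge0 ?sqr_ge0// /profile_eta -ak; ring.
  have r0 : 0 <= r by exact: sqrtr_ge0.
  move: (profile_phase a k x) A1 A2 (P x xL) => pp A1 A2 Px.
  pose q := phi 0 + pp.
  have -> : - sin (phi 0) * profile k x + cos (phi 0) * a = r * cos q.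
    by rewrite /q cosD -{1}A2 -{1}A1; ring.
  have -> : cos (phi 0) * profile k x - - sin (phi 0) * a = r * sin q.
    by rewrite /q sinD -{1}A2 -{1}A1; ring.
  rewrite (rv_phase Av Mn) (iv_phase Av Mn).
  have rho2 : cmod (v (x + x0)) ^+ 2 = 1 - eta (rv v) (iv v) (x + x0).
    by rewrite sqr_cmod /eta /rv /iv; ring.
  apply: (@le_trans _ _ (T / 2 + 17 * (T / 34))); last by clear; lra.
  apply: polar_dist => //.
  - exact: cmod_ge0.
  - by rewrite rho2; have := ns_low ns x; clear; lra.
  - by rewrite r2; have := profile_eta_ge0 k x; clear; lra.
  - rewrite rho2 r2 distrC; have := U x; congr (_ <= _); congr `| _ |; ring.
  - apply: cosn; move: Px.
    have -> : profile_phase a k 0 = 0 by rewrite /profile_phase profile0 mul0r atan0.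
    by congr (_ <= _); congr `| _ |; rewrite /q /phi; ring.
have Hv : H1locC v by case: Av.
have [p1 p2 q1 q2] := H1locC_primitive Hv.
have [ei _ _] := finite_energy Av.
exists x0, th; split.
- by move=> x xL; apply: le_trans Tt; apply: unif; exact: le_trans LL'.
- by move=> n; exact: le_trans (L2 n) Tt.
- apply: (Hder (fun x => rv v (x + x0)) (fun x => iv v (x + x0))).
  + exact: cos2Dsin2.
  + exact: primitive_shift.
  + exact: primitive_shift.
  + exact: sqrL1_shift.
  + exact: sqrL1_shift.
  + exact: (integrable_shift x0 ei).
  + apply: (@le_trans _ _ (\int[mu]_x vdens v x)).
      rewrite le_eqVlt; apply/orP; left; apply/eqP.
      apply: (Rint_shift x0 (f := vdens v)).
      by have := measurable_int _ ei => /measurable_EFinP.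
    by move: Ev2; rewrite (angle_energy_al al_p).
  + exact: (ns_low ns).
  + by move=> x xN; apply: le_trans Tt1; apply: unif; exact: le_trans NL'.
  + by move=> n; exact: le_trans (L2 n) Tt1.
Unshelve. all: by end_near. Qed.

End Stability.

(** * The soliton as an admissible map *)

Section SolitonFacts.
Context {R : realType}.
Local Notation mu := (@lebesgue_measure R).

(** The speed is [sqrt 2 * sin al], with [al] given by the intermediate value theorem for
    [angle_momentum], which runs from [pi / 2] to 0; the strict bounds on [p] exclude both
    endpoints. *)
Lemma speed_exists (p : R) : 0 < p < pi / 2 -> exists c : R, 0 < c < Num.sqrt 2 /\
  p = pi / 2 - atan (c / Num.sqrt (2 - c ^+ 2)) - c / 2 * Num.sqrt (2 - c ^+ 2).
Proof.
move=> /andP[p0 p1]; have s0 := @sqrt2_gt0 R; have s22 := @sqrt2K R.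
have pi0 : 0 <= pi / 2 :> R by rewrite divr_ge0// pi_ge0.
have [al] : exists2 al, al \in `[(0 : R), pi / 2] & angle_momentum al = p.
  apply: IVT => //.
    apply: continuous_subspaceT => z.
    by case: (is_derive_angle_momentum z) => /derivable1_diffP /differentiable_continuous.
  rewrite /angle_momentum sin0 sin_pihalf cos_pihalf.
  have -> : pi / 2 - 0 - 0 * cos 0 = pi / 2 :> R by ring.
  have -> : pi / 2 - pi / 2 - 1 * 0 = 0 :> R by ring.
  rewrite minElt maxElt (lt_gtF (lt_trans p0 p1)).
  by rewrite (ltW p0) (ltW p1).
rewrite in_itv/= => /andP[l0 l1] alp.
have al0 : 0 < al.
  rewrite lt_neqAle l0 andbT; apply: contraTneq p1 => h.
  rewrite -alp -h /angle_momentum sin0; have -> : pi / 2 - 0 - 0 * cos 0 = pi / 2 :> R by ring.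
  by rewrite ltxx.
have al1 : al < pi / 2.
  rewrite lt_neqAle l1 andbT; apply: contraTneq p0 => h.
  rewrite -alp h /angle_momentum cos_pihalf.
  have -> : pi / 2 - pi / 2 - sin (pi / 2) * 0 = 0 :> R by ring.
  by rewrite ltxx.
have a0 : 0 < sin al by apply: sin_gt0_pihalf; rewrite al0.
have k0 : 0 < cos al.
  by apply: cos_gt0_pihalf; rewrite al1 andbT (lt_le_trans _ (ltW al0))// oppr_lt0 (lt_trans al0).
have cs := cos2Dsin2 al.
have r2 : Num.sqrt 2 ^+ 2 = 2 :> R by rewrite expr2.
have sE : Num.sqrt (2 - (Num.sqrt 2 * sin al) ^+ 2) = Num.sqrt 2 * cos al.
  have -> : 2 - (Num.sqrt 2 * sin al) ^+ 2 = (Num.sqrt 2 * cos al) ^+ 2.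
    by rewrite !exprMn r2 -[X in X - _]mulr1 -cs; ring.
  by rewrite sqrtr_sqr ger0_norm// mulr_ge0// ltW.
exists (Num.sqrt 2 * sin al); split.
  rewrite mulr_gt0//= -[ltRHS]mulr1 ltr_pM2l//.
  have : sin al ^+ 2 < 1 by rewrite -cs ltrDr exprn_gt0.
  by rewrite expr_lt1// ltW.
rewrite sE -mulf_div divff ?lt0r_neq0// mul1r -/(tan al) tanK; last first.
  by rewrite in_itv/= al1 (lt_trans _ al0)// oppr_lt0 (lt_trans al0).
rewrite -[LHS]alp /angle_momentum.
have -> : Num.sqrt 2 * sin al / 2 * (Num.sqrt 2 * cos al) =
   Num.sqrt 2 ^+ 2 * (sin al * cos al) / 2 by ring.
by rewrite r2; field.
Qed.

Lemma speed_angle (p : R) : 0 < p < pi / 2 -> exists al : R,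
  [/\ 0 < al < pi / 2, angle_momentum al = p &
      soliton (speed p) = (fun x => profile (cos al) x -i* sin al)].
Proof.
move=> /speed_exists h; have s0 := @sqrt2_gt0 R; have s22 := @sqrt2K R.
have r2 : Num.sqrt 2 ^+ 2 = 2 :> R by rewrite expr2.
have := xgetPex 0 h; rewrite -/(speed p); set c := speed p => -[/andP[c0 c1] cp].
have c2 : c ^+ 2 < 2 by rewrite -r2 ltr_pXn2r// nnegrE ltW.
have w0 : 0 < Num.sqrt (2 - c ^+ 2) by rewrite sqrtr_gt0 subr_gt0.
have w2 : Num.sqrt (2 - c ^+ 2) ^+ 2 = 2 - c ^+ 2 by rewrite sqr_sqrtr// subr_ge0 ltW.
have sn := lt0r_neq0 s0.
have kE : Num.sqrt ((2 - c ^+ 2) / 2) = Num.sqrt (2 - c ^+ 2) / Num.sqrt 2.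
  by rewrite sqrtrM ?sqrtrV// subr_ge0 ltW.
move: w0 w2 kE cp; set w := Num.sqrt (2 - c ^+ 2) => w0 w2 kE cp.
have a0 : 0 < c / Num.sqrt 2 by rewrite divr_gt0.
have k0 : 0 < w / Num.sqrt 2 by rewrite divr_gt0.
have ak : (c / Num.sqrt 2) ^+ 2 + (w / Num.sqrt 2) ^+ 2 = 1.
  by rewrite !expr_div_n r2 w2; field.
have [al [al0 al1 aE kaE]] := angle_exists a0 k0 ak.
exists al; split; first by rewrite al0.
  rewrite cp /angle_momentum -aE -kaE.
  have tE : c / w = tan al.
    by rewrite /tan -aE -kaE; field; rewrite sn lt0r_neq0.
  rewrite tE tanK; last first.
    by rewrite in_itv/= al1 (lt_trans _ al0)// oppr_lt0 (lt_trans al0).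
  have -> : c / Num.sqrt 2 * (w / Num.sqrt 2) = c * w / Num.sqrt 2 ^+ 2 by field.
  by rewrite r2; ring.
have wE : w / Num.sqrt 2 / Num.sqrt 2 = w / 2.
  by rewrite -mulrA -invfM s22.
by apply/funext => x; rewrite /soliton -/w kE -kaE /profile -aE wE.
Qed.

End SolitonFacts.

Section SolitonEnergy.
Context {R : realType}.
Local Notation mu := (@lebesgue_measure R).
Variables a k : R.
Hypothesis a0 : 0 < a.
Hypothesis k0 : 0 < k.
Hypothesis ak : a ^+ 2 + k ^+ 2 = 1.

Let V x := profile k x -i* a.
Let s0 := @sqrt2_gt0 R.
Let s22 := @sqrt2K R.
Let D x := profile_eta k x / Num.sqrt 2.
Let cD : continuous D.
Proof. by move=> x; apply: cvgM; [exact: continuous_profile_eta|exact: cvg_cst]. Qed.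

Lemma soliton_H1loc : H1locC V.
Proof.
split; apply/H1locP; split.
- exact: continuous_profile.
- exists D; [exact: sqrL1_continuous|exact: primitive_profile].
- by move=> x; exact: cvg_cst.
- exists (cst 0); last exact: primitive_cst.
  by apply: sqrL1_continuous => x; exact: cvg_cst.
Qed.

Lemma soliton_drv : {ae mu, forall x, drv V x = D x}.
Proof.
have [_ pw] := wderivP soliton_H1loc.1.
exact: primitive_ae_unique pw (primitive_profile k).
Qed.

Lemma soliton_div : {ae mu, forall x, div V x = 0}.
Proof.
have [_ pw] := wderivP soliton_H1loc.2.
exact: primitive_ae_unique pw (primitive_cst (- a)).
Qed.

Lemma soliton_eta x : eta (rv V) (iv V) x = profile_eta k x.
Proof. by rewrite /eta /rv /iv /= sqrrN /profile_eta -ak; ring. Qed.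

(** Equipartition: both parts of the density are [profile_eta^2 / 4]. On [[- n, n]] the deficit from
    the full value is a positive multiple of [(k - y)^2 * (2 k + y)], where [y = profile k n]. *)
Lemma soliton_energy_le : (energy V <= (2 * Num.sqrt 2 / 3 * k ^+ 3)%:E)%E.
Proof.
have s22' := s22; have s0' := s0.
have [p1 p2 q1 q2] := H1locC_primitive soliton_H1loc.
have le := locL1_edens (primitive_continuous p1) (primitive_continuous p2) q1 q2.
have l2 : locL1 (fun x => 2^-1 * profile_eta k x ^+ 2).
  apply/locL1Z/locL1_continuous => x.
  by apply: cvgM; exact: continuous_profile_eta.
have -> : energy V = (\int[mu]_x (2^-1 * profile_eta k x ^+ 2)%:E)%E.
  apply: ae_eq_integral => //.
  - apply/measurable_EFinP; have := le.1; congr measurable_fun.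
    by apply/funext => x; rewrite energy_density_edens.
  - by apply/measurable_EFinP; exact: l2.1.
  - have H : {ae mu, forall x, drv V x = D x /\ div V x = 0}.
      apply: filterS2 soliton_drv soliton_div; first exact: (ae_filter_ringOfSetsType mu).
      by move=> x h1 h2.
    have [N [mN N0 sN]] := H; exists N; split=> // x /= nx.
    apply: sN => /= -[h1 h2]; apply: nx => _.
    rewrite energy_density_edens /edens soliton_eta h1 h2 /D expr_div_n.
    by rewrite [Num.sqrt 2 ^+ 2]expr2 s22'; congr EFin; field.
apply: int_le_itv_int => // [x|n]; first by rewrite mulr_ge0// sqr_ge0.
have nn : - n%:R <= n%:R :> R by have : 0 <= n%:R :> R := ler0n _ _; lra.
rewrite itv_intZ; last first.
  by apply: locL1_continuous => x; apply: cvgM; exact: continuous_profile_eta.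
rewrite Rint_sqr_profile_eta// profileN.
have Y0 : 0 <= profile k n%:R by apply: profile_ge0; [exact: ltW|].
have := profile_abs_le k0 n%:R; rewrite ger0_norm// => Yk.
move: Y0 Yk; set y := profile k n%:R => Y0 Yk.
rewrite -subr_ge0.
have -> : 2 * Num.sqrt 2 / 3 * k ^+ 3 -
  2^-1 * (Num.sqrt 2 * (k ^+ 2 * y - y ^+ 3 / 3) -
    Num.sqrt 2 * (k ^+ 2 * - y - (- y) ^+ 3 / 3)) =
  Num.sqrt 2 * (3^-1 * ((k - y) ^+ 2 * (2 * k + y))) by field.
rewrite mulr_ge0 ?(ltW s0')// mulr_ge0// mulr_ge0 ?sqr_ge0// addr_ge0//.
by rewrite mulr_ge0// ltW.
Qed.

Lemma soliton_admissible : admissible V.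
Proof.
split; first exact: soliton_H1loc.
apply: (le_lt_trans soliton_energy_le); rewrite lte_fin /energy_threshold.
have c0 : 0 < 2 * Num.sqrt 2 / 3 :> R by rewrite divr_gt0// mulr_gt0.
rewrite -[ltRHS]mulr1 ltr_pM2l//.
have k1 : k ^+ 2 < 1 by rewrite -ak ltrDr exprn_gt0.
by rewrite exprn_ilt1 ?ltW// -(@expr_lt1 _ 2)// ltW.
Qed.

(** Exhibiting a phase makes [phase V] a true phase; its derivative is then [dphase] almost
    everywhere, and the integrand becomes a multiple of [profile_eta^2 / (1 - profile_eta)], with
    primitive [momentum_primitive]. *)
Lemma soliton_momentumE : momentum V = soliton_momentum a k.
Proof.
have s22' := s22; have s0' := s0; have sn := lt0r_neq0 s0'; have an := lt0r_neq0 a0.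
have eph : exists phi, is_phase V phi.
  exists (fun x => profile_phase a k x - pi / 2).
  have pp := primitive_profile_phase a0 ak.
  have pB := primitiveB pp (primitive_cst (pi / 2)).
  split.
    apply/H1locP; split; first exact: (primitive_continuous pB).
    eexists; last exact: pB.
    apply: sqrL1_continuous => x; apply: cvgB; last exact: cvg_cst.
    exact: continuous_dphase.
  move=> x; have [A1 A2] := polar_profile k x a0.
  have cE : cmod (V x) = Num.sqrt (a ^+ 2 + profile k x ^+ 2).
    by rewrite /cmod /V /= sqrrN addrC.
  rewrite cE /expi cosBpihalf sinBpihalf /V.
  move: A1 A2; set r := Num.sqrt _; move: (profile_phase a k x) => q A1 A2.
  apply/eqP; rewrite eq_complex /=; apply/andP; split; apply/eqP.
    by rewrite -A2; ring.
  by rewrite -[in LHS]A1; ring.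
have iph : is_phase V (phase V) := xgetPex (cst 0) eph.
have [_ pw] := wderivP iph.1.
have p1 : primitive (rv V) D := primitive_profile k.
have p2 : primitive (iv V) (cst 0) := primitive_cst (- a).
have e1 x : eta (rv V) (iv V) x < 1.
  rewrite soliton_eta; apply: (le_lt_trans (profile_eta_le k x)).
  by rewrite -ak ltrDr exprn_gt0.
have v1E x : rv V x = cmod (V x) * cos (phase V x).
  by rewrite /rv {1}(iph.2 x) /expi /=; ring.
have v2E x : iv V x = cmod (V x) * sin (phase V x).
  by rewrite /iv {1}(iph.2 x) /expi /=; ring.
have dae := dphase_ae p1 p2 pw v1E v2E e1.
have rn x : 1 - profile_eta k x != 0 by rewrite -soliton_eta lt0r_neq0// subr_gt0.
have fE x : profile_eta k x * dphase (rv V) (iv V) D (cst 0) x =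
   a / Num.sqrt 2 * (profile_eta k x ^+ 2 / (1 - profile_eta k x)).
  rewrite /dphase soliton_eta /rv /iv /= /D; field.
  by rewrite rn.
pose f x := profile_eta k x ^+ 2 / (1 - profile_eta k x).
have pm := primitive_momentum a0 ak.
have lf : locL1 f := primitive_locL1 pm.
have f0 x : 0 <= f x.
  by rewrite /f divr_ge0 ?sqr_ge0// -soliton_eta subr_ge0 ltW.
have nn (n : nat) : - n%:R <= n%:R :> R by have : 0 <= n%:R :> R := ler0n _ _; lra.
have fn n : \int[mu]_(x in `[- n%:R, n%:R]) f x = 2 * momentum_primitive a k n%:R.
  by rewrite (primitiveE pm (nn n)) momentum_primitiveN; ring.
have cf : 2 * momentum_primitive a k n%:R @[n --> \oo] -->
    2 * (Num.sqrt 2 * soliton_momentum a k / a).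
  by apply: cvgM; [exact: cvg_cst|exact: cvg_momentum_primitive].
have cfR : \int[mu]_(x in `[- n%:R, n%:R]) f x @[n --> \oo] -->
    2 * (Num.sqrt 2 * soliton_momentum a k / a).
  by apply: cvg_trans cf; apply: near_eq_cvg; apply: nearW => n /=; rewrite fn.
have fi : mu.-integrable setT (EFin \o f).
  apply: ge0_integrable; [exact: lf.1|exact: f0|].
  have cc := cvg_itv_int lf f0.
  have cF : ((\int[mu]_(x in `[- n%:R, n%:R]) f x)%:E @[n --> \oo] -->
      (2 * (Num.sqrt 2 * soliton_momentum a k / a))%:E)%E.
    by apply/fine_cvgP; split; [near=> n|exact: cfR].
  have -> : (\int[mu]_x (f x)%:E = (2 * (Num.sqrt 2 * soliton_momentum a k / a))%:E)%E.
    exact: cvg_unique cc cF.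
  exact: ltry.
have If : \int[mu]_x f x = 2 * (Num.sqrt 2 * soliton_momentum a k / a).
  exact: cvg_unique (cvg_Rint fi f0) cfR.
have gE x : (1 - cmod (V x) ^+ 2) * dphase (rv V) (iv V) D (cst 0) x =
    a / Num.sqrt 2 * f x by rewrite eta_cmod soliton_eta fE.
rewrite /momentum.
have -> : \int[mu]_x ((1 - cmod (V x) ^+ 2) * wderiv (phase V) x) =
   \int[mu]_x (a / Num.sqrt 2 * f x).
  have ceta := primitive_continuous (primitive_eta p1 p2).
  congr fine; apply: ae_eq_integral => //.
  - have := (locL1M ceta (primitive_locL1 pw)).1; move/measurable_EFinP.
    by congr measurable_fun; apply/funext => x; rewrite eta_cmod.
  - by apply/measurable_EFinP; exact: (locL1Z _ lf).1.
  - have [N [mN N0 sN]] := dae; exists N; split=> // x /= nx.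
    by apply: sN => /= fgx; apply: nx => _; rewrite fgx; congr EFin; exact: gE.
rewrite RintegralZl// If.
have -> : 2^-1 * (a / Num.sqrt 2 * (2 * (Num.sqrt 2 * soliton_momentum a k / a))) =
   soliton_momentum a k by field; rewrite an.
by [].
Unshelve. all: by end_near. Qed.

End SolitonEnergy.

(** Consequently energies that converge to [Emin p] eventually fall below [angle_energy p al + d],
    as [stability] asks. *)
Lemma Emin_le {R : realType} (al p : R) : 0 < al < pi / 2 -> angle_momentum al = p ->
  (Emin p <= (angle_energy p al)%:E)%E.
Proof.
move=> al_bd al_p; have /andP[al0 al1] := al_bd.
have a0 : 0 < sin al by apply: sin_gt0_pihalf; rewrite al0.
have k0 : 0 < cos al.
  by apply: cos_gt0_pihalf; rewrite al1 andbT (lt_trans _ al0)// oppr_lt0 (lt_trans al0).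
have ak : sin al ^+ 2 + cos al ^+ 2 = 1 by rewrite addrC cos2Dsin2.
rewrite (angle_energy_al al_p).
apply: le_trans (soliton_energy_le k0 ak).
apply: ereal_inf_lbound; eexists; last reflexivity.
split; first exact: soliton_admissible.
by rewrite soliton_momentumE// soliton_momentum_angle.
Qed.

(** * Compactness of minimizing sequences *)

Section SquareIntegrable.
Context {R : realType}.
Local Notation mu := (@lebesgue_measure R).

Lemma Lnorm2_le (f : R -> R) (C : R) : locL1 (fun x => f x ^+ 2) ->
  (forall n : nat, \int[mu]_(x in `[- n%:R, n%:R]) f x ^+ 2 <= C) ->
  (Lnorm mu 2%:E (fun x => (f x)%:E) <= (Num.sqrt C)%:E)%E.
Proof.
move=> lf fC.
have C0 : 0 <= C.
  by apply: le_trans (fC 0%N); apply: itv_int_ge0 => x _; exact: sqr_ge0.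
have H : (\int[mu]_x (f x ^+ 2)%:E <= C%:E)%E.
  by apply: int_le_itv_int => // x; exact: sqr_ge0.
have I0 : (0 <= \int[mu]_x (f x ^+ 2)%:E)%E.
  by apply: integral_ge0 => x _; rewrite lee_fin sqr_ge0.
have -> : Lnorm mu 2%:E (fun x => (f x)%:E) = ((\int[mu]_x (f x ^+ 2)%:E) `^ 2^-1)%E.
  rewrite Lnorm.unlock; congr (_ `^ _)%E; apply: eq_integral => x _.
  by rewrite /= powR_mulrn// real_normK// num_real.
have -> : (Num.sqrt C)%:E = (C%:E `^ 2^-1)%E by rewrite poweR_EFin powR12_sqrt.
by apply: gt0_ler_poweR => //; rewrite in_itv/= leey ?lee_fin ?I0 ?C0.
Qed.

Lemma L2_le (f g : R -> R) : measurable_fun setT f ->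
  mu.-integrable setT (EFin \o g) -> (forall x, f x ^+ 2 <= g x) -> L2 f.
Proof.
move=> mf gi fg.
have mf2 : measurable_fun setT (fun x => f x ^+ 2) by exact: measurable_funX.
have fi : mu.-integrable setT (EFin \o (fun x => f x ^+ 2)).
  by apply: le_integrable_ge0 gi _ => // x; rewrite ger0_norm ?sqr_ge0.
have f0 x : 0 <= f x ^+ 2 := sqr_ge0 _.
rewrite /L2 inE; apply/andP; split; rewrite inE/=; first exact: mf.
rewrite /finite_norm.
apply: (le_lt_trans (Lnorm2_le (C := \int[mu]_x f x ^+ 2) (locL1_integrable fi) _)).
  by move=> n; exact: Rint_itv_le fi f0.
exact: ltry.
Qed.

Lemma cvg_Lnorm2 (f : nat -> R -> R) :
  (forall n, locL1 (fun x => f n x ^+ 2)) ->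
  (forall e, 0 < e -> \forall n \near \oo, forall m : nat,
      \int[mu]_(x in `[- m%:R, m%:R]) f n x ^+ 2 <= e) ->
  Lnorm mu 2%:E (fun x => (f n x)%:E) @[n --> \oo] --> 0%E.
Proof.
move=> lf H.
have L n e : (forall m : nat, \int[mu]_(x in `[- m%:R, m%:R]) f n x ^+ 2 <= e ^+ 2) ->
    0 <= e -> (Lnorm mu 2%:E (fun x => (f n x)%:E) <= e%:E)%E.
  move=> h e0; apply: le_trans (Lnorm2_le (lf n) h) _.
  by rewrite sqrtr_sqr ger0_norm.
apply/fine_cvgP; split.
  near=> n; rewrite ge0_fin_numE ?Lnorm_ge0//.
  apply: (le_lt_trans (L n 1 _ ler01)); last exact: ltry.
  by near: n; rewrite expr1n; exact: H.
apply/cvgrPdist_le => e e0; near=> n; rewrite sub0r normrN /=.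
have h : (Lnorm mu 2%:E (fun x => (f n x)%:E) <= e%:E)%E.
  apply: (L n e _ (ltW e0)).
  by near: n; apply: H; rewrite exprn_gt0.
rewrite ger0_norm ?fine_ge0 ?Lnorm_ge0//.
rewrite -lee_fin fineK// ge0_fin_numE ?Lnorm_ge0//; exact: le_lt_trans h (ltry _).
Unshelve. all: by end_near. Qed.

Lemma L2_eta_shift (v : R -> R[i]) x0 : admissible v ->
  L2 (fun x => 1 - cmod (v (x + x0)) ^+ 2) /\ L2C (fun x => wderivC v (x + x0)).
Proof.
move=> Av; have [ei _ _] := finite_energy Av.
have [Hv _] := Av; have [p1 p2 q1 q2] := H1locC_primitive Hv.
have gi : mu.-integrable setT (EFin \o (fun x => 4 * vdens v (x + x0))).
  have := integrableZl measurableT 4 (integrable_shift x0 ei).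
  by congr (_.-integrable _ _).
have e0 x : 0 <= (drv v x) ^+ 2 := sqr_ge0 _.
have e1 x : 0 <= (div v x) ^+ 2 := sqr_ge0 _.
have e2 x : 0 <= (eta (rv v) (iv v) x) ^+ 2 := sqr_ge0 _.
split; last split.
- apply: L2_le gi _.
    have -> : (fun x => 1 - cmod (v (x + x0)) ^+ 2) = (fun x => eta (rv v) (iv v) (x + x0)).
      by apply/funext => x; rewrite eta_cmod.
    apply: (continuous_meas (f := fun x => eta (rv v) (iv v) (x + x0))).
    exact: primitive_continuous (primitive_shift x0 (primitive_eta p1 p2)).
  move=> x; rewrite eta_cmod /vdens /edens.
  by have := e0 (x + x0); have := e1 (x + x0); have := e2 (x + x0); lra.
- apply: L2_le gi _; first exact: (sqrL1_shift x0 q1).1.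
  move=> x; rewrite /vdens /edens /= -/(drv v).
  by have := e0 (x + x0); have := e1 (x + x0); have := e2 (x + x0); lra.
- apply: L2_le gi _; first exact: (sqrL1_shift x0 q2).1.
  move=> x; rewrite /vdens /edens /= -/(div v).
  by have := e0 (x + x0); have := e1 (x + x0); have := e2 (x + x0); lra.
Qed.

End SquareIntegrable.

Lemma strict_subsequence (P : nat -> nat -> Prop) :
  (forall j M, exists2 m, (M <= m)%N & P j m) ->
  exists2 s : nat -> nat, {homo s : m n / (m < n)%N} & forall j, P j (s j).
Proof.
move=> H; have H' jM : exists m, (jM.2 <= m)%N /\ P jM.1 m.
  by have [m] := H jM.1 jM.2; exists m.
have [f Hf] := choice H'.
pose s := fix s j := if j is j'.+1 then f (j, (s j').+1) else f (0%N, 0%N).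
exists s; last by case=> [|j]; apply: (Hf (_, _)).2.
by apply: homo_ltn => [|j]; [exact: ltn_trans|exact: (Hf (j.+1, (s j).+1)).1].
Qed.

Section Compactness.
Context {R : realType}.
Local Notation mu := (@lebesgue_measure R).

Lemma soliton_close_le (al t t' L L' : R) v x0 th : t <= t' -> L' <= L ->
  soliton_close al t L v x0 th -> soliton_close al t' L' v x0 th.
Proof.
move=> tt LL [h1 h2 h3]; split=> [x xL|n|n]; apply: le_trans tt => //.
by apply: h1; exact: le_trans LL.
Qed.

Lemma locL1_close (v : R -> R[i]) (x0 c d k : R) : H1locC v ->
  locL1 (fun x => (drv v (x + x0) - c * (profile_eta k x / Num.sqrt 2)) ^+ 2 +
         (div v (x + x0) - d * (profile_eta k x / Num.sqrt 2)) ^+ 2).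
Proof.
move=> Hv; have [_ _ q1 q2] := H1locC_primitive Hv.
have cc c' : continuous (fun x => - (c' * (profile_eta k x / Num.sqrt 2))).
  move=> x; apply: cvgN; apply: cvgM; first exact: cvg_cst.
  by apply: cvgM; [exact: continuous_profile_eta|exact: cvg_cst].
have [_ l1] := sqrL1D (sqrL1_shift x0 q1) (sqrL1_continuous (cc c)).
have [_ l2] := sqrL1D (sqrL1_shift x0 q2) (sqrL1_continuous (cc d)).
exact: locL1D l1 l2.
Qed.

(** The factor 2 is [(x + y)^2 <= 2 x^2 + 2 y^2]. Turning the soliton moves it by at most [e]
    pointwise, in squared distance, and its derivative by at most [2 * e] in squared [L^2] norm. *)
Lemma soliton_close_rot (al t L e : R) v x0 th th' : 0 < al < pi / 2 ->
  H1locC v -> soliton_close al t L v x0 th ->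
  (cos th - cos th') ^+ 2 + (sin th - sin th') ^+ 2 <= e ->
  soliton_close al (2 * t + 4 * e) L v x0 th'.
Proof.
move=> al_bd Hv [h1 h2 h3] qe; have /andP[al0 al1] := al_bd.
have s0 := @sqrt2_gt0 R; have s22 := @sqrt2K R.
have k0 : 0 < cos al.
  by apply: cos_gt0_pihalf; rewrite al1 andbT (lt_trans _ al0)// oppr_lt0 (lt_trans al0).
have k1 : cos al <= 1 by exact: cos_le1.
have cs := cos2Dsin2 al.
set k := cos al in h1 h2 h3 k0 k1 cs *; set a := sin al in h1 cs *.
set q := _ + _ in qe; have q0 : 0 <= q by rewrite /q addr_ge0// sqr_ge0.
have e0 : 0 <= e by exact: le_trans qe.
have t0 : 0 <= t.
  by apply: le_trans (h2 0%N); apply: itv_int_ge0 => x _; exact: sqr_ge0.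
rewrite /soliton_close -/k -/a; split.
- move=> x xL; set y := profile k x.
  set w1 := rv v _; set w2 := iv v _.
  apply: (@le_trans _ _ (2 * ((w1 - (cos th * y + sin th * a)) ^+ 2 +
      (w2 - (sin th * y - cos th * a)) ^+ 2) + 2 * (q * (y ^+ 2 + a ^+ 2)))).
    rewrite -subr_ge0 /q; set X := (X in 0 <= X).
    have -> : X = ((w1 - (cos th * y + sin th * a)) -
        ((cos th - cos th') * y + (sin th - sin th') * a)) ^+ 2 +
      ((w2 - (sin th * y - cos th * a)) -
        ((sin th - sin th') * y - (cos th - cos th') * a)) ^+ 2 by rewrite /X; ring.
    by rewrite addr_ge0// sqr_ge0.
  have ya : y ^+ 2 + a ^+ 2 <= 1 by rewrite -cs lerD2r sqr_profile_le.
  have ya0 : 0 <= y ^+ 2 + a ^+ 2 by rewrite addr_ge0// sqr_ge0.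
  have qy : q * (y ^+ 2 + a ^+ 2) <= e by rewrite -[e]mulr1; apply: ler_pM.
  by have := h1 x xL; rewrite -/y -/w1 -/w2; move: qy e0; clear; lra.
- by move=> n; apply: (le_trans (h2 n)); move: t0 e0; clear; lra.
move=> n; pose D x := profile_eta k x / Num.sqrt 2.
have cD2 : continuous (fun x => D x ^+ 2).
  by move=> x; apply: cvgM; (apply: cvgM; [exact: continuous_profile_eta|exact: cvg_cst]).
have lD2 := locL1_continuous cD2.
have lf := locL1_close x0 (cos th) (sin th) k Hv.
apply: (@le_trans _ _ (\int[mu]_(x in `[- n%:R, n%:R])
   (2 * ((drv v (x + x0) - cos th * D x) ^+ 2 + (div v (x + x0) - sin th * D x) ^+ 2)
     + 2 * q * D x ^+ 2))).
  apply: itv_int_le; first exact: locL1_close.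
    by apply: locL1D; exact: locL1Z.
  move=> x _; rewrite -/(D x) -subr_ge0 /q; set X := (X in 0 <= X).
  have -> : X = ((drv v (x + x0) - cos th * D x) - (cos th - cos th') * D x) ^+ 2 +
    ((div v (x + x0) - sin th * D x) - (sin th - sin th') * D x) ^+ 2 by rewrite /X; ring.
  by rewrite addr_ge0// sqr_ge0.
rewrite itv_intD; [|exact: locL1Z|exact: locL1Z].
rewrite !itv_intZ//.
have nn : - n%:R <= n%:R :> R by have : 0 <= n%:R :> R := ler0n _ _; clear; lra.
(* [D^2 = profile_eta^2 / 2 <= profile_eta / 2], whose integral is explicit. *)
have ID : \int[mu]_(x in `[- n%:R, n%:R]) D x ^+ 2 <= 2.
  have cp : continuous (fun x => 2^-1 * profile_eta k x).
    by move=> x; apply: cvgM; [exact: cvg_cst|exact: continuous_profile_eta].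
  apply: (@le_trans _ _ (\int[mu]_(x in `[- n%:R, n%:R]) (2^-1 * profile_eta k x))).
    apply: itv_int_le => //; first exact: locL1_continuous.
    move=> x _; rewrite /D expr_div_n [Num.sqrt 2 ^+ 2]expr2 s22 mulrC.
    apply: ler_wpM2l => //; rewrite expr2 -[leRHS]mulr1.
    apply: ler_wpM2l; first exact: profile_eta_ge0.
    by apply: (le_trans (profile_eta_le k x)); rewrite -cs lerDl sqr_ge0.
  rewrite itv_intZ; last by apply: locL1_continuous; exact: continuous_profile_eta.
  rewrite Rint_profile_eta// profileN.
  have := profile_abs_le k0 n%:R => /(le_trans (ler_norm _)) yk.
  have -> : 2^-1 * (Num.sqrt 2 * (profile k n%:R - - profile k n%:R)) =
    Num.sqrt 2 * profile k n%:R by field.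
  apply: (@le_trans _ _ (Num.sqrt 2 * 1)).
    by rewrite ler_pM2l//; exact: le_trans k1.
  by rewrite mulr1; move: s0 s22; clear; nra.
have IDq : 2 * q * \int[mu]_(x in `[- n%:R, n%:R]) D x ^+ 2 <= 4 * e.
  apply: (@le_trans _ _ (2 * e * 2)); last by clear; lra.
  apply: ler_pM => //; [by rewrite mulr_ge0| |by rewrite ler_pM2l].
  by apply: itv_int_ge0 => x _; exact: sqr_ge0.
apply: lerD => //; rewrite ler_pM2l//; exact: h3.
Qed.

Lemma angle_reduce (th : R) : exists2 th', th' \in `[- pi, pi] &
  cos th' = cos th /\ sin th' = sin th.
Proof.
have c1 : -1 <= cos th <= 1 by rewrite cos_geN1 cos_le1.
have h0 := acos_ge0 c1; have h1 := acos_lepi c1.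
have p0 := @pi_ge0 R.
have ca : cos (acos (cos th)) = cos th by apply: acosK; rewrite in_itv.
have sa : sin (acos (cos th)) = `|sin th|.
  by rewrite sin_acos// -sin2cos2 sqrtr_sqr.
have [s0|s0] := leP 0 (sin th).
  exists (acos (cos th)); last by rewrite ca sa ger0_norm.
  by rewrite in_itv/=; apply/andP; split=> //; lra.
exists (- acos (cos th)); last by rewrite cosN sinN ca sa ltr0_norm// opprK.
by rewrite in_itv/=; apply/andP; split; lra.
Qed.

Variables (p al : R) (u : nat -> R -> R[i]).
Hypothesis p0 : 0 < p.
Hypothesis al_bd : 0 < al < pi / 2.
Hypothesis al_p : angle_momentum al = p.
Hypothesis hu : forall n : nat, admissible (u n).
Hypothesis hmom : momentum (u n) @[n --> \oo] --> p.
Hypothesis hE : energy (u n) @[n --> \oo] --> Emin p.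

(** The angle is reduced to the compact [[- pi, pi]] so that a cluster point can be taken. *)
Lemma eventually_close (t L : R) : 0 < t -> exists N : nat, forall n, (N <= n)%N ->
  exists x0, exists2 th, th \in `[- pi, pi] & soliton_close al t L (u n) x0 th.
Proof.
move=> t0; have [d d0 H] := stability L al_bd al_p p0 t0.
have [N1 _ H1] : \forall n \near \oo, `|momentum (u n) - p| <= d.
  have /cvgrPdist_le/(_ _ d0) := hmom; apply: filterS => n.
  by rewrite distrC.
have [N2 _ H2] : \forall n \near \oo, (energy (u n) < (angle_energy p al + d)%:E)%E.
  have Em : (Emin p < (angle_energy p al + d)%:E)%E.
    by apply: (le_lt_trans (Emin_le al_bd al_p)); rewrite lte_fin ltrDl.
  have nE : nbhs (Emin p) [set y | (y < (angle_energy p al + d)%:E)%E].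
    by apply: open_nbhs_nbhs; split; [exact: open_ereal_lt_ereal|exact: Em].
  exact: hE nE.
exists (maxn N1 N2) => n; rewrite geq_max => /andP[n1 n2].
have [_ EE _] := finite_energy (hu n).
have En : \int[mu]_x vdens (u n) x <= angle_energy p al + d.
  by have := H2 n n2; rewrite /= EE lte_fin => /ltW.
have [x0 [th [h1 h2 h3]]] := H (u n) (hu n) En (H1 n n1).
have [th' thI [ce se]] := angle_reduce th.
by exists x0, th' => //; rewrite /soliton_close ce se; split.
Qed.

(** Take phases adapted to tolerance [1 / (m + 1)] and radius [m]; a cluster point of them serves
    all tolerances at once, because a nearby angle can be replaced by it through
    [soliton_close_rot]. *)
Lemma limit_phase : exists th, forall (t L : R) (M : nat), 0 < t ->
  exists2 n, (M <= n)%N & exists x0, soliton_close al t L (u n) x0 th.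
Proof.
have H (m : nat) : exists nt : nat * R, [/\ (m <= nt.1)%N, nt.2 \in `[- pi, pi] &
    exists x0, soliton_close al m.+1%:R^-1 m%:R (u nt.1) x0 nt.2].
  have [|N HN] := @eventually_close m.+1%:R^-1 m%:R; first by rewrite invr_gt0.
  have [x0 [th thI c]] := HN (maxn m N) (leq_maxr _ _).
  by exists (maxn m N, th); split => //=; [exact: leq_maxl|exists x0].
have [f Hf] := choice H.
have [th [_ clu]] : `[- pi, pi] `&` cluster ((fun m => (f m).2) @ \oo) !=set0.
  apply: (@segment_compact R (- pi) pi).
  by exists 0%N => // m _; have [_ h _] := Hf m; exact: h.
exists th => t L M t0.
have t80 : 0 < t / 8 by rewrite divr_gt0.
(* With [e = t / 8] and tolerance [1 / (m + 1) <= t / 4], [soliton_close_rot] gives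
   [2 * (t / 4) + 4 * (t / 8) = t]. *)
pose B := [set x | (cos x - cos th) ^+ 2 + (sin x - sin th) ^+ 2 < t / 8].
have nB : nbhs th B.
  have cq : continuous (fun x => (cos x - cos th) ^+ 2 + (sin x - sin th) ^+ 2).
    move=> x; apply: cvgD.
      by apply: cvgM; (apply: cvgB; [exact: continuous_cos|exact: cvg_cst]).
    by apply: cvgM; (apply: cvgB; [exact: continuous_sin|exact: cvg_cst]).
  have /cvgrPdist_lt/(_ _ t80) := cq th.
  apply: filterS => x; rewrite /B /= !subrr expr0n addr0 sub0r normrN.
  apply: le_lt_trans.
  exact: ler_norm.
have [K [KM KL Kt]] : exists K : nat, [/\ (M <= K)%N, L <= K%:R & 4 / t <= K%:R].
  exists (maxn M (maxn (Num.bound `|L|) (Num.bound (4 / t)))); split.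
  - exact: leq_maxl.
  - apply: (le_trans (ler_norm L)); apply: (@le_trans _ _ (Num.bound `|L|)%:R).
      exact/ltW/archi_boundP/normr_ge0.
    by rewrite ler_nat; apply: leq_trans (leq_maxr _ _); exact: leq_maxl.
  - apply: (@le_trans _ _ (Num.bound (4 / t))%:R).
      by apply/ltW/archi_boundP; rewrite divr_ge0// ltW.
    by rewrite ler_nat; apply: leq_trans (leq_maxr _ _); exact: leq_maxr.
have [y [[m Km ym] By]] := clu ((fun m => (f m).2) @` [set m | (K <= m)%N]) B
  (ex_intro2 _ _ K I (fun m Km => ex_intro2 _ _ m Km erefl)) nB.
have [mf _ [x0 c]] := Hf m.
have KmR : K%:R <= m%:R :> R by rewrite ler_nat.
exists (f m).1; first by apply: leq_trans mf; exact: leq_trans Km.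
exists x0; rewrite -ym /= in By.
have [Hv _] := hu (f m).1.
apply: soliton_close_le (soliton_close_rot al_bd Hv c (ltW By)); last exact: le_trans KmR.
have mt : m.+1%:R^-1 <= t / 4.
  rewrite -[leRHS]invrK lef_pV2 ?posrE ?invr_gt0 ?divr_gt0//.
  rewrite invf_div; apply: (le_trans Kt); apply: (le_trans KmR).
  by rewrite ler_nat.
by move: mt t0; move: (m.+1%:R^-1) => z; lra.
Qed.

End Compactness.

Lemma sqr_cmod_sub {R : realType} (z w : R[i]) : cmod (z - w) ^+ 2 =
  (complex.Re z - complex.Re w) ^+ 2 + (complex.Im z - complex.Im w) ^+ 2.
Proof. by rewrite sqr_cmod; case: z => z1 z2; case: w. Qed.

Lemma expi_mul {R : realType} (t : R) (z : R[i]) : expi t * z =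
  (cos t * complex.Re z - sin t * complex.Im z) +i*
  (cos t * complex.Im z + sin t * complex.Re z).
Proof. by case: z. Qed.

Theorem theorem3 (R : realType) (p : R) (u : nat -> R -> R[i])
  (hp : 0 < p < pi / 2)
  (hu : forall n : nat, H1locC (u n) /\ (energy (u n) < energy_threshold%:E)%E)
  (hmom : momentum (u n) @[n --> \oo] --> p)
  (hE : energy (u n) @[n --> \oo] --> Emin p) :
  exists (sigma : nat -> nat) (a : nat -> R) (theta : R),
    [/\ {homo sigma : m n / (m < n)%N},
        cvg_locally_uniformly
          (fun n x => u (sigma n) (x + a (sigma n)))
          (fun x => expi theta * soliton (speed p) x),
        cvg_L2
          (fun n x => 1 - cmod (u (sigma n) (x + a (sigma n))) ^+ 2)
          (fun x => 1 - cmod (soliton (speed p) x) ^+ 2)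
      & cvg_L2C
          (fun n x => wderivC (u (sigma n)) (x + a (sigma n)))
          (fun x => expi theta * wderivC (soliton (speed p)) x)].
Proof.
have /andP[p0 _] := hp.
have [al [al_bd al_p solE]] := speed_angle hp; have /andP[al0 al1] := al_bd.
have a0 : 0 < sin al by apply: sin_gt0_pihalf; rewrite al0.
have k0 : 0 < cos al.
  by apply: cos_gt0_pihalf; rewrite al1 andbT (lt_trans _ al0)// oppr_lt0 (lt_trans al0).
have ak : sin al ^+ 2 + cos al ^+ 2 = 1 by rewrite addrC cos2Dsin2.
have [th Hth] := limit_phase p0 al_bd al_p hu hmom hE.
(* The [j]-th term is close within [1 / (j + 1)] on radius [j], for the single angle [th]. *)
have [s s_incr Hs] := strict_subsequence (fun (j M : nat) =>
  Hth j.+1%:R^-1 j%:R M (etrans (invr_gt0 j.+1%:R) (ltr0Sn R j))).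
have [X HX] := choice Hs.
have s_inj : injective s.
  move=> i j sij; case: (ltngtP i j) => // /s_incr; by rewrite sij ltnn.
(* The translations are read at [sigma n] in the statement, so the centres [X j] are carried along
   the injective [s]; elsewhere the value is an arbitrary default. *)
pose a i := xget 0 [set x | exists2 j, s j = i & x = X j].
have aE j : a (s j) = X j.
  rewrite /a; case: xgetP => [x _ [j' /s_inj -> //]|/(_ (X j)) []].
  by exists j.
have inv_near (e : R) : 0 < e -> \forall n \near \oo, n.+1%:R^-1 < e.
  move=> e0; exists (Num.bound e^-1) => // n /= en.
  rewrite invf_plt ?posrE//; apply: (lt_le_trans (archi_boundP _)).
    by rewrite invr_ge0 ltW.
  by rewrite ler_nat ltnW.
exists s, a, th; rewrite solE; set V := (fun x => _ -i* _).
have AV : admissible V by exact: soliton_admissible.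
have HV : H1locC V by case: AV.
have [pV1 pV2 qV1 qV2] := H1locC_primitive HV.
have [eiV _ _] := finite_energy AV.
have Hu n : H1locC (u n) by case: (hu n).
split=> //.
- move=> K cK e e0.
  have [B KB] : exists B : nat, forall x, K x -> `|x| <= B%:R.
    have [M [Mr MK]] := compact_bounded cK.
    exists (Num.bound (`|M| + 1)) => x Kx.
    have M1 : M < `|M| + 1 by rewrite (le_lt_trans (ler_norm M))// ltrDl.
    apply: (le_trans (MK _ M1 x Kx)); apply/ltW/archi_boundP.
    by rewrite addr_ge0.
  have e20 : 0 < e ^+ 2 by rewrite exprn_gt0.
  near=> n => x Kx; rewrite aE.
  have [h1 _ _] := HX n.
  rewrite -(@ltr_pXn2r _ 2)// ?nnegrE ?cmod_ge0 ?(ltW e0)//.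
  rewrite sqr_cmod_sub expi_mul /=.
  apply: (@le_lt_trans _ _ n.+1%:R^-1); last by near: n; exact: inv_near.
  have xn : `|x| <= n%:R.
    by apply: (le_trans (KB x Kx)); rewrite ler_nat; near: n; exists B.
  have := h1 x xn; rewrite /rv /iv; congr (_ + _ <= _); congr (_ ^+ 2); ring.
- split.
  + by move=> n; exact: (L2_eta_shift (a (s n)) (hu (s n))).1.
  + have := (L2_eta_shift 0 AV).1; congr (L2 _).
    by apply/funext => x; rewrite addr0.
  + have gE n x : (1 - cmod (u (s n) (x + a (s n))) ^+ 2) - (1 - cmod (V x) ^+ 2) =
        eta (rv (u (s n))) (iv (u (s n))) (x + X n) - profile_eta (cos al) x.
      by rewrite aE !eta_cmod (soliton_eta ak).
    apply: cvg_Lnorm2.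
      move=> n; have [p1 p2 _ _] := H1locC_primitive (Hu (s n)).
      have ce := primitive_continuous (primitive_shift (X n) (primitive_eta p1 p2)).
      have cV : continuous (profile_eta (cos al)) := @continuous_profile_eta R _.
      have ld : locL1 (fun x =>
          (eta (rv (u (s n))) (iv (u (s n))) (x + X n) - profile_eta (cos al) x) ^+ 2).
        apply: locL1_continuous => x.
        by apply: cvgM; (apply: cvgB; [exact: ce|exact: cV]).
      by have := ld; congr locL1; apply/funext => x; rewrite -gE.
    move=> e e0; near=> n => m; have [_ h2 _] := HX n.
    apply: (@le_trans _ _ n.+1%:R^-1); last first.
      by apply/ltW; near: n; exact: inv_near.
    apply: le_trans (h2 m); rewrite le_eqVlt; apply/orP; left; apply/eqP.
    by apply: itv_int_eq => x _; rewrite gE.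
- split.
  + by move=> n; exact: (L2_eta_shift (a (s n)) (hu (s n))).2.
  + have gi : (@lebesgue_measure R).-integrable setT
        (EFin \o (fun x => 2 * vdens V x)).
      by have := integrableZl measurableT 2 eiV; congr (_.-integrable _ _).
    (* Cauchy-Schwarz for a unit vector [(c, d)]: each component of the rotated derivative is
       dominated by the energy density. *)
    have dle (c d : R) x : c ^+ 2 + d ^+ 2 = 1 ->
        (c * drv V x + d * div V x) ^+ 2 <= 2 * vdens V x.
      move=> cd; have h : 0 <= eta (rv V) (iv V) x ^+ 2 := sqr_ge0 _.
      apply: (@le_trans _ _ (drv V x ^+ 2 + div V x ^+ 2)); last first.
        by rewrite /vdens /edens; move: h; lra.
      rewrite -subr_ge0; set D := (X in 0 <= X).
      have -> : D = (c * div V x - d * drv V x) ^+ 2 +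
          (1 - (c ^+ 2 + d ^+ 2)) * (drv V x ^+ 2 + div V x ^+ 2) by rewrite /D; ring.
      by rewrite cd subrr mul0r addr0 sqr_ge0.
    have mdle (c d : R) : measurable_fun setT (fun x => c * drv V x + d * div V x).
      by case: (locL1D (locL1Z c (sqrL1_locL1 qV1)) (locL1Z d (sqrL1_locL1 qV2))).
    have cs := cos2Dsin2 th.
    split.
      have -> : (fun x => complex.Re (expi th * wderivC V x)) =
          (fun x => cos th * drv V x + (- sin th) * div V x).
        by apply/funext => x; rewrite expi_mul /= mulNr.
      by apply: L2_le gi _ => // x; apply: dle; rewrite sqrrN.
    have -> : (fun x => complex.Im (expi th * wderivC V x)) =
        (fun x => sin th * drv V x + cos th * div V x).
      by apply/funext => x; rewrite expi_mul /= addrC.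
    by apply: L2_le gi _ => // x; apply: dle; rewrite addrC.
  + have gE n x : cmod (wderivC (u (s n)) (x + a (s n)) - expi th * wderivC V x) ^+ 2 =
        (drv (u (s n)) (x + X n) + (- cos th * drv V x + sin th * div V x)) ^+ 2 +
        (div (u (s n)) (x + X n) + (- sin th * drv V x + - cos th * div V x)) ^+ 2.
      rewrite aE sqr_cmod_sub expi_mul /= /drv /div /rv /iv.
      by congr (_ ^+ 2 + _ ^+ 2); ring.
    have lE n : locL1 (fun x =>
        cmod (wderivC (u (s n)) (x + a (s n)) - expi th * wderivC V x) ^+ 2).
      have [_ _ q1 q2] := H1locC_primitive (Hu (s n)).
      have qc (c d : R) : sqrL1 (fun x => c * drv V x + d * div V x).
        by apply: sqrL1D; apply: sqrL1Ml => // x; exact: cvg_cst.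
      have [_ l1] := sqrL1D (sqrL1_shift (X n) q1) (qc (- cos th) (sin th)).
      have [_ l2] := sqrL1D (sqrL1_shift (X n) q2) (qc (- sin th) (- cos th)).
      by have := locL1D l1 l2; congr locL1; apply/funext => x; rewrite gE.
    apply: cvg_Lnorm2; first exact: lE.
    move=> e e0; near=> n => m; have [_ _ h3] := HX n.
    apply: (@le_trans _ _ n.+1%:R^-1); last first.
      by apply/ltW; near: n; exact: inv_near.
    apply: le_trans (h3 m); rewrite le_eqVlt; apply/orP; left; apply/eqP.
    (* [wderivC] of the soliton is the classical derivative only almost everywhere, so the two
       integrands are compared up to a null set. *)
    apply: itv_int_ae_eq; [exact: lE|exact: locL1_close|].
    have H : {ae (@lebesgue_measure R), forall x,
        drv V x = profile_eta (cos al) x / Num.sqrt 2 /\ div V x = 0}.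
      apply: filterS2 (soliton_drv (sin al) (cos al)) (soliton_div (sin al) (cos al)).
        exact: (ae_filter_ringOfSetsType (@lebesgue_measure R)).
      by move=> x h1 h2.
    apply: filterS H; first exact: (ae_filter_ringOfSetsType (@lebesgue_measure R)).
    by move=> x [d1 d2]; rewrite gE d1 d2; ring.
Unshelve. all: by end_near. Qed.
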